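(* Suppose that $N\subset M$ is a unital inclusion of $\mathrm{II}_1$ factors with $[M:N]<\infty$. Then $$\mathcal G(\langle M,e_N\rangle)\leq\mathcal G(M).$$
   Context: For a $\mathrm{II}_1$ factor $M$ with its faithful normal trace $\tau$, $\tau(1)=1$, let $\mathcal P(M)$ be the collection of all finite sets of mutually orthogonal projections in $M$ which sum to $1$. For $x\in M$ and $P\in\mathcal P(M)$ put $\mathcal I(x;P)=\sum_{p,q\in P,\ pxq\neq 0}\tau(p)\tau(q)$. For a finite subset $X\subset M$ put $\mathcal I(X;P)=\sum_{x\in X}\mathcal I(x;P)$ and $\mathcal I(X)=\inf_{P\in\mathcal P(M)}\mathcal I(X;P)$. $W^*(X)$ denotes the von Neumann algebra generated by $X$ (not automatically assumed to contain the identity of $M$). The generator invariant is $\mathcal G(M)=\inf\{\mathcal I(X): X\subset M\text{ finite},\ W^*(X)=M\}$, with $\mathcal G(M)=\infty$ if $M$ is not finitely generated. For a unital inclusion $N\subset M$ of $\mathrm{II}_1$ factors, $e_N$ is the orthogonal projection of $L^2(M)$ onto $L^2(N)$, and the basic construction $\langle M,e_N\rangle$ is the von Neumann subalgebra of $\mathbb B(L^2(M))$ generated by $M$ and $e_N$. $N$ has finite index if $\langle M,e_N\rangle$ is a $\mathrm{II}_1$ factor, and then $[M:N]=\mathrm{Tr}(1)$, where $\mathrm{Tr}$ is the unique trace on $\langle M,e_N\rangle$ normalised by $\mathrm{Tr}(e_N)=1$. The invariant $\mathcal G(\langle M,e_N\rangle)$ is computed with respect to the normalised trace $[M:N]^{-1}\mathrm{Tr}$.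 *)

(* Defs.v *)
From HB Require Import structures.
From mathcomp Require Import all_boot all_order all_algebra.
From mathcomp Require Export complex finmap.
From mathcomp Require Import all_classical all_reals ereal topology normedtype.

Set Implicit Arguments.
Unset Strict Implicit.
Unset Printing Implicit Defensive.

Import Order.TTheory GRing.Theory Num.Theory.
Import numFieldNormedType.Exports.

Local Open Scope classical_set_scope.
Local Open Scope ring_scope.

(* Inner products are linear in the first variable.  The library order on R[i]
   is the partial one: 0 <= z means that z is real and nonnegative.           *)
HB.mixin Record CompleteNormedModule_isHilbert (R : realType) V
    & CompleteNormedModule R[i] V := {
  hdot : V -> V -> R[i] ;
  hdotPl : forall a u v w, hdot (a *: u + v) w = a * hdot u w + hdot v w ;
  hdotC : forall u v, hdot u v = (hdot v u)^* ;
  hdot_norm : forall u, hdot u u = `|u| ^+ 2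
}.

#[short(type="hilbertType")]
HB.structure Definition Hilbert (R : realType) :=
  {V of CompleteNormedModule R[i] V & CompleteNormedModule_isHilbert R V}.

Section Operators.
Context {R : realType} {V : hilbertType R}.
Implicit Types (S T x y p q : V -> V) (A X : set (V -> V)).

(* B(V); continuity of a linear map is boundedness. *)
Definition bounded_op : set (V -> V) := [set T | linear T /\ continuous T].

(* Every bounded operator has exactly one adjoint; the default value 0 is
   irrelevant for them.                                                       *)
Definition adjoint T : V -> V :=
  xget 0 [set S | forall u v, hdot (T u) v = hdot u (S v)].

Definition pos_op T : Prop := forall v, 0 <= hdot (T v) v.

Definition le_op S T : Prop := pos_op (T - S).

Record star_subalgebra A : Prop := {
  star_subalgebra_bounded : A `<=` bounded_op ;
  star_subalgebra0 : A 0 ;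
  star_subalgebraP : forall (a : R[i]) x y, A x -> A y -> A (a *: x + y) ;
  star_subalgebraM : forall x y, A x -> A y -> A (x \o y) ;
  star_subalgebra_adjoint : forall x, A x -> A (adjoint x)
}.

(* Closedness in B(V) for the weak operator topology: the sets of S with
   |<(T - S) u, v>| < e for all (u, v) in s are a base of neighbourhoods of T. *)
Definition wot_closed A : Prop :=
  forall T, bounded_op T ->
    (forall (s : seq (V * V)) (e : R), 0 < e ->
       exists2 S, A S & forall uv : V * V, uv \in s ->
         `|hdot (T uv.1 - S uv.1) uv.2| < e%:C%C) ->
    A T.

(* W*(X), not required to contain the identity. *)
Definition Wstar X : set (V -> V) :=
  [set T | forall A, star_subalgebra A -> wot_closed A -> X `<=` A -> A T].

Record von_neumann_algebra A : Prop := {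
  vna_star : star_subalgebra A ;
  vna_closed : wot_closed A ;
  vna_unital : A idfun
}.

Definition is_factor A : Prop :=
  von_neumann_algebra A /\
  forall x, A x -> (forall y, A y -> x \o y = y \o x) ->
    exists a : R[i], x = a *: (idfun : V -> V).

Definition finite_dimensional A : Prop :=
  exists (n : nat) (b : 'I_n -> V -> V), forall x, A x ->
    exists c : 'I_n -> R[i], x = \sum_(i < n) c i *: b i.

Definition directed_op (D : set (V -> V)) : Prop :=
  forall x y, D x -> D y -> exists2 z, D z & le_op x z /\ le_op y z.

Definition lub_op_in A (D : set (V -> V)) x : Prop :=
  [/\ A x, forall d, D d -> le_op d x &
      forall y, A y -> (forall d, D d -> le_op d y) -> le_op x y].

(* Faithful normal finite traces on A.  Only the values of tau on A matter. *)
Record finite_trace A (tau : (V -> V) -> R[i]) : Prop := {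
  trace_linear : forall (a : R[i]) x y, A x -> A y ->
    tau (a *: x + y) = a * tau x + tau y ;
  trace_ge0 : forall x, A x -> pos_op x -> 0 <= tau x ;
  trace_comm : forall x y, A x -> A y -> tau (x \o y) = tau (y \o x) ;
  trace_faithful : forall x, A x -> pos_op x -> tau x = 0 -> x = 0 ;
  trace_normal : forall D x,
    D !=set0 -> D `<=` A -> D `<=` pos_op -> directed_op D ->
    lub_op_in A D x ->
    complex.Re (tau x) = sup [set complex.Re (tau d) | d in D]
}.

Definition tracial_state A (tau : (V -> V) -> R[i]) : Prop :=
  finite_trace A tau /\ tau idfun = 1.

Definition II1_factor A : Prop :=
  [/\ is_factor A, ~ finite_dimensional A & exists tau, tracial_state A tau].

Definition projection p : Prop :=
  [/\ bounded_op p, p \o p = p & adjoint p = p].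

Definition projection_partition A (P : {fset (V -> V)}) : Prop :=
  [/\ forall p, p \in P -> A p /\ projection p,
      forall p q, p \in P -> q \in P -> p != q -> p \o q = 0 &
      \sum_(p <- P) p = idfun].

(* Traces of projections are real, hence the real parts. *)
Definition inv_elt (tau : (V -> V) -> R[i]) x (P : {fset (V -> V)}) : R :=
  \sum_(p <- P) \sum_(q <- P | p \o x \o q != 0)
    complex.Re (tau p) * complex.Re (tau q).

Definition inv_fam tau (X P : {fset (V -> V)}) : R :=
  \sum_(x <- X) inv_elt tau x P.

Definition inv_inf A tau (X : {fset (V -> V)}) : \bar R :=
  ereal_inf [set (inv_fam tau X P)%:E | P in projection_partition A].

(* ereal_inf set0 = +oo covers algebras that are not finitely generated. *)
Definition generator_invariant A tau : \bar R :=
  ereal_inf [set inv_inf A tau X | X in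
    [set X : {fset (V -> V)} | [set` X] `<=` A /\ Wstar [set` X] = A]].

Definition orthogonal_projection_onto (S : set V) (e : V -> V) : Prop :=
  forall v, S (e v) /\ forall w, S w -> hdot (v - e v) w = 0.

End Operators.

Section BasicConstruction.
Context {R : realType} {K L : hilbertType R}.
Implicit Types (M N : set (K -> K)) (eta : (K -> K) -> L) (eN : L -> L).

(* L, with eta : M -> L, is the completion of M for <x, y> = tau (y^* x). *)
Record is_L2 M (tau : (K -> K) -> R[i]) eta : Prop := {
  L2_linear : forall (a : R[i]) x y, M x -> M y ->
    eta (a *: x + y) = a *: eta x + eta y ;
  L2_hdot : forall x y, M x -> M y ->
    hdot (eta x) (eta y) = tau (adjoint y \o x) ;
  L2_dense : closure (eta @` M) = setT
}.

(* M represented on L by the extensions of eta y |-> eta (x y). *)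
Definition left_mult M eta : set (L -> L) :=
  [set T | bounded_op T /\
     exists2 x, M x & forall y, M y -> T (eta y) = eta (x \o y)].

Definition L2_projection N eta eN : Prop :=
  orthogonal_projection_onto (closure (eta @` N)) eN.

Definition basic_construction M eta eN : set (L -> L) :=
  Wstar (left_mult M eta `|` [set eN]).

Definition finite_index M eta eN : Prop :=
  II1_factor (basic_construction M eta eN).

Definition jones_trace M eta eN (Tr : (L -> L) -> R[i]) : Prop :=
  finite_trace (basic_construction M eta eN) Tr /\ Tr eN = 1.

Definition jones_index (Tr : (L -> L) -> R[i]) : R[i] := Tr idfun.

Definition normalised_trace (Tr : (L -> L) -> R[i]) (x : L -> L) : R[i] :=
  (jones_index Tr)^-1 * Tr x.

End BasicConstruction.

(* Main.v *)
(* Let X generate M, let P be a partition, and let r be a nonzero projection of M of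
   small trace below some p in P.  Splitting p into r and p - r does not increase the
   cost of X, and the element r e_N costs at most tau(r).  Traces on a factor being
   unique, the normalised trace of <M, e_N> restricts to tau on M, so it is enough
   that X and r e_N generate <M, e_N>.

   By the double commutant theorem, let t commute with X, r e_N and their adjoints.  It commutes with
   M, because the representation of M on L^2(M) is normal.  It also commutes with
   k = e_N r e_N.  The vectors z of L^2(N) with k n z = 0 for all n in N form an
   N-N-bimodule; the projection of the trace vector onto a bimodule defines a trace on
   N, so by uniqueness of the trace a bimodule is 0 or L^2(N), and this one is 0.
   Hence N k N spans a dense subspace of L^2(N), which t thus leaves invariant.

   Uniqueness of the trace and normality of the representation both rest on a maximality
   argument: if F1(1) < F2(1) for normal positive functionals, then F1 <= F2 on c M c
   for some nonzero c >= 0. *)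
From HB Require Import structures.
Require Import Defs.
From mathcomp Require Import all_boot all_order all_algebra.
From mathcomp Require Import all_classical all_reals ereal topology normedtype.
From mathcomp Require Import ring lra.

Set Implicit Arguments.
Unset Strict Implicit.
Unset Printing Implicit Defensive.

Local Open Scope classical_set_scope.
Local Open Scope ring_scope.

Import Order.TTheory GRing.Theory Num.Theory.
Import numFieldNormedType.Exports.

(** * Hilbert spaces and bounded operators *)

(** The equation [Wstar X = M] lives on K while commutants are taken on L = L^2(M), so weak limits
    must be carried from K to L. Comparing tau with the vector functional of some v with |v|^2 > 1
    gives c <> 0 with tau (c z^* z c) <= |z w0|^2, where w0 = c v. So z w0 |-> eta (z c) is bounded,
    and coefficients of [lam z] at the vectors eta (x c y) are coefficients of z on K; these vectors
    span a dense subspace because M c M is an ideal in a factor. Domination on c M c also yields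
    uniqueness of the trace: in a factor c u g <> 0 for some u once c and g are nonzero, so the
    inequality spreads to all of M. No spectral theorem is used. Projections onto subspaces
    invariant under the commutant lie in the algebra by the double commutant theorem, and square
    roots come from an iteration. Small projections exist because a minimal one would carry matrix
    units, whose number the trace bounds, and would make M finite-dimensional. *)

Section RealHilbert.
Context {R : realType} {W : lmodType R[i]} (dot : W -> W -> R).
Hypothesis dotD : forall u v w, dot (u + v) w = dot u w + dot v w.
Hypothesis dotZ : forall r u w, dot (r%:C%C *: u) w = r * dot u w.
Hypothesis dotC : forall u v, dot u v = dot v u.
Hypothesis dot_ge0 : forall u, 0 <= dot u u.
Hypothesis dot_complete : forall u : nat -> W,
  (forall e, 0 < e -> exists N, forall m n, (N <= m)%N -> (N <= n)%N ->
     dot (u m - u n) (u m - u n) < e) ->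
  exists l, forall e, 0 < e -> exists N, forall n, (N <= n)%N ->
     dot (u n - l) (u n - l) < e.
Let q u := dot u u.

Lemma dotNl u w : dot (- u) w = - dot u w.
Proof.
have := dotZ (-1) u w; rewrite mulN1r => <-.
by congr (dot _ w); rewrite rmorphN rmorph1 scaleN1r.
Qed.

Lemma dotDr u v w : dot w (u + v) = dot w u + dot w v.
Proof. by rewrite dotC dotD !(dotC _ w). Qed.

Lemma dotZr r u w : dot w (r%:C%C *: u) = r * dot w u.
Proof. by rewrite dotC dotZ dotC. Qed.

Lemma dotNr u w : dot w (- u) = - dot w u.
Proof. by rewrite dotC dotNl dotC. Qed.

Definition dotE := (dotD, dotZ, dotDr, dotZr, dotNl, dotNr).

(** The form is only semidefinite, as [pos_CS] applies this to <T u, v> with T positive. When <v, v>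
    = 0 and <u, v> <> 0, the constant [k] gives <u + k v, u + k v> = -1. *)
Lemma dot_CS u v : (dot u v) ^+ 2 <= dot u u * dot v v.
Proof.
have [v0|vn] := eqVneq (dot v v) 0.
  have [->|x0] := eqVneq (dot u v) 0; first by rewrite expr0n /= v0 mulr0.
  pose k := - (dot u u + 1) / (2 * dot u v).
  have kE : k * dot u v = - (dot u u + 1) / 2 by rewrite /k; field.
  have := dot_ge0 (u + k%:C%C *: v).
  rewrite !dotE v0 (dotC v u); nra.
have vp : 0 < dot v v by rewrite lt_neqAle eq_sym vn dot_ge0.
pose k := - dot u v / dot v v.
have kE : k * dot v v = - dot u v by rewrite /k; field.
have := mulr_ge0 (dot_ge0 (u + k%:C%C *: v)) (ltW vp).
rewrite !dotE (dotC v u) => h; rewrite -subr_ge0; apply: le_trans h _.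
set x := dot u v in kE *; set V := dot v v in kE *; set U := dot u u.
rewrite (_ : (_ + _) * V = U * V + 2 * (k * V) * x + (k * V) ^+ 2); last by ring.
by rewrite kE; lra.
Qed.

Lemma dot_small v e : 0 < e ->
  exists2 d, 0 < d & forall z, dot z z < d -> `|dot z v| < e.
Proof.
move=> e0; have qv := dot_ge0 v.
have Q0 : 0 < dot v v + 1 by lra.
exists (e ^+ 2 / (dot v v + 1)); first by rewrite divr_gt0 // exprn_gt0.
move=> z; rewrite ltr_pdivlMr // => hz.
rewrite -(@ltr_pXn2r _ 2) ?nnegrE ?normr_ge0 ?(ltW e0) //.
rewrite real_normK ?num_real //; apply: le_lt_trans (dot_CS z v) _.
by apply: le_lt_trans hz; rewrite ler_wpM2l ?dot_ge0 //; lra.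
Qed.

(* [G] is the graph of a bounded functional on a subspace, not assumed closed;
   [w] is the limit of a sequence minimising [dot u u - 2 * a] over [G]. *)
Theorem riesz_graph (G : W -> R -> Prop) (C : R) :
  G 0 0 ->
  (forall u v a b, G u a -> G v b -> G (u + v) (a + b)) ->
  (forall r u a, G u a -> G (r%:C%C *: u) (r * a)) ->
  0 <= C ->
  (forall u a, G u a -> a ^+ 2 <= C * dot u u) ->
  exists w, (forall e, 0 < e -> exists u a, G u a /\ dot (u - w) (u - w) < e) /\
    forall u a, G u a -> a = dot u w.
Proof.
move=> G0 GD GZ C0 GC.
pose F (p : W * R) := q p.1 - 2 * p.2.
pose GG : set (W * R) := [set p | G p.1 p.2].
have Fge p : GG p -> - C <= F p.
  move=> /GC h; rewrite /F /q; have q0 := dot_ge0 p.1.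
  rewrite leNgt; apply/negP => lt; have {lt}lt : dot p.1 p.1 + C < 2 * p.2 by lra.
  have := sqr_ge0 (dot p.1 p.1 - C); nra.
have hinf : has_inf (F @` GG).
  split; first by exists (F (0, 0)); exists (0, 0).
  by exists (- C) => _ [p pG <-]; exact: Fge.
pose m := inf (F @` GG).
have mle p : GG p -> m <= F p.
  by move=> pG; apply: ge_inf; [exact: hinf.2 | exists p].
have happ e : 0 < e -> exists2 p, GG p & F p < m + e.
  by move=> e0; have [_ [p pG <-] h] := inf_adherent e0 hinf; exists p.
have sG (n : nat) : exists p, GG p /\ F p < m + n.+1%:R^-1.
  have [|p pG h] := happ (n.+1%:R^-1); first by rewrite invr_gt0 ltr0n.
  by exists p.
have [s sP] := choice sG.
(* Parallelogram identity: the midpoint of p and p' lies in [GG], so F is at least m there, and F p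
   + F p' - 2 F (midpoint) is half of q (p.1 - p'.1). *)
have par p p' : GG p -> GG p' ->
    q (p.1 - p'.1) <= 2 * (F p - m) + 2 * (F p' - m).
  move=> pG pG'.
  have /mle : GG ((2^-1)%:C%C *: (p.1 + p'.1), 2^-1 * (p.2 + p'.2)).
    by apply: GZ; apply: GD.
  rewrite /F /= /q !dotE (dotC p'.1 p.1) => h.
  lra.
have small e : 0 < e -> exists N : nat, forall n, (N <= n)%N -> n.+1%:R^-1 < e :> R.
  move=> e0; exists (Num.truncn e^-1) => n hn.
  have hN : e^-1 < n.+1%:R.
    apply: lt_le_trans (truncnS_gt _) _; by rewrite ler_nat.
  by rewrite invf_plt ?posrE ?ltr0n // invr_gt0.
have cau : forall e, 0 < e -> exists N, forall i j, (N <= i)%N -> (N <= j)%N ->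
     q ((s i).1 - (s j).1) < e.
  move=> e e0; have [|N hN] := small (e / 4); first by rewrite divr_gt0.
  exists N => i j hi hj.
  have := par _ _ (sP i).1 (sP j).1; have := (sP i).2; have := (sP j).2.
  have := hN _ hi; have := hN _ hj.
  move: (F (s i)) (F (s j)) (q _) i.+1%:R^-1 j.+1%:R^-1 => a b c x y; lra.
have [w hw] := dot_complete cau.
exists w; split.
  move=> e e0; have [N hN] := hw e e0; exists (s N).1, (s N).2; split.
    exact: (sP N).1.
  exact: hN.
(* Moving the minimising sequence by t v cannot bring F below m; in the limit this is the
   variational inequality. *)
have var v b t : G v b -> 0 <= 2 * t * (dot v w - b) + t ^+ 2 * q v.
  move=> Gv; rewrite leNgt; apply/negP => neg.
  set e := - (2 * t * (dot v w - b) + t ^+ 2 * q v).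
  have e0 : 0 < e by rewrite /e; lra.
  have d0 : 0 < e / 2 by rewrite divr_gt0.
  have [d dp hd] := dot_small (t%:C%C *: v) (divr_gt0 d0 (ltr0Sn R 1)).
  have [N1 hN1] := hw d dp.
  have [N2 hN2] := small _ d0.
  have hi : (N1 <= maxn N1 N2)%N by rewrite leq_maxl.
  have hj : (N2 <= maxn N1 N2)%N by rewrite leq_maxr.
  have := hd _ (hN1 _ hi); have := hN2 _ hj.
  set n := maxn N1 N2.
  have /mle : GG ((s n).1 + t%:C%C *: v, (s n).2 + t * b).
    by apply: GD; [exact: (sP n).1 | exact: GZ].
  have := (sP n).2; rewrite /F /= /e /q !dotE !(dotC _ v) ltr_norml.
  by move: (n.+1%:R^-1) => i h1 h2 h3 /andP[h4 h5]; lra.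
(* The optimal t is - x / q u with x = <u, w> - a. The denominator q u + 1 avoids the case q u = 0
   and still leads to - x^2 (q u + 2) >= 0. *)
move=> u a Gu; have := var u a (- (dot u w - a) / (q u + 1)) Gu.
have Q0 := dot_ge0 u; rewrite -/(q u) in Q0 *.
move: (q u) Q0 => Q Q0; set x := dot u w - a => h.
have Q1 : Q + 1 != 0 by rewrite gt_eqF //; lra.
have: 0 <= - (x ^+ 2) * (Q + 2).
  have -> : - (x ^+ 2) * (Q + 2) = (2 * (- x / (Q + 1)) * x + (- x / (Q + 1)) ^+ 2 * Q) * (Q + 1) ^+ 2.
    by field.
  by rewrite mulr_ge0 // sqr_ge0.
have x2 := sqr_ge0 x.
rewrite pmulr_lge0; last by lra.
rewrite oppr_ge0 => hx; apply/eqP; rewrite eq_sym -subr_eq0 -/x -sqrf_eq0 eq_le hx.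
exact: x2.
Qed.

End RealHilbert.

Local Notation Re := complex.Re.
Local Notation Im := complex.Im.

Section HilbertBasics.
Context {R : realType} {V : hilbertType R}.
Implicit Types (u v w : V) (a : R[i]) (S T : V -> V).

Lemma conjCE (z : R[i]) : z^* = (Re z +i* - Im z)%C.
Proof. by case: z. Qed.

Lemma hdotDl u v w : hdot (u + v) w = hdot u w + hdot v w.
Proof. by rewrite -{1}(scale1r u) hdotPl mul1r. Qed.

Lemma hdot0l w : hdot 0 w = 0.
Proof. by have := hdotPl (-1) w w w; rewrite scaleN1r addNr mulN1r addNr. Qed.

Lemma hdotZl a u w : hdot (a *: u) w = a * hdot u w.
Proof. by have := hdotPl a u 0 w; rewrite hdot0l !addr0. Qed.

Lemma hdotNl u w : hdot (- u) w = - hdot u w.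
Proof. by rewrite -scaleN1r hdotZl mulN1r. Qed.

Lemma hdotDr u v w : hdot w (u + v) = hdot w u + hdot w v.
Proof. by rewrite hdotC hdotDl rmorphD [hdot w u]hdotC [hdot w v]hdotC. Qed.

Lemma hdot0r w : hdot w 0 = 0.
Proof. by rewrite hdotC hdot0l rmorph0. Qed.

Lemma hdotZr a u w : hdot w (a *: u) = a^* * hdot w u.
Proof. by rewrite hdotC hdotZl rmorphM [hdot w u]hdotC. Qed.

Lemma hdotNr u w : hdot w (- u) = - hdot w u.
Proof. by rewrite hdotC hdotNl rmorphN [hdot w u]hdotC. Qed.

Definition rdot u v : R := Re (hdot u v).
Definition sqn u : R := rdot u u.

Lemma ReD (x y : R[i]) : Re (x + y) = Re x + Re y. Proof. by case: x y => ? ? []. Qed.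
Lemma ReN (x : R[i]) : Re (- x) = - Re x. Proof. by case: x. Qed.
Lemma ReM (x y : R[i]) : Re (x * y) = Re x * Re y - Im x * Im y.
Proof. by case: x y => ? ? []. Qed.
Lemma ReZ (r : R) (y : R[i]) : Re (r%:C%C * y) = r * Re y.
Proof. by rewrite ReM /= mul0r subr0. Qed.
Lemma Re_conj (x : R[i]) : Re x^* = Re x. Proof. by rewrite conjCE. Qed.
Lemma conj_realC (r : R) : (r%:C%C : R[i])^* = r%:C%C.
Proof. by rewrite conjCE /= oppr0. Qed.

Lemma rdotDl u v w : rdot (u + v) w = rdot u w + rdot v w.
Proof. by rewrite /rdot hdotDl ReD. Qed.

Lemma rdotZl (r : R) u w : rdot (r%:C%C *: u) w = r * rdot u w.
Proof. by rewrite /rdot hdotZl ReZ. Qed.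

Lemma rdotC u v : rdot u v = rdot v u.
Proof. by rewrite /rdot hdotC Re_conj. Qed.

Lemma hdot_sqn u : hdot u u = (sqn u)%:C%C.
Proof.
have: 0 <= hdot u u by rewrite hdot_norm exprn_ge0.
by rewrite lecE /= => /andP[/eqP h _]; apply/eqP; rewrite eq_complex /= h !eqxx.
Qed.

Lemma sqn_ge0 u : 0 <= rdot u u.
Proof. by rewrite -ler0c -/(sqn u) -hdot_sqn hdot_norm exprn_ge0. Qed.

Lemma normE u : `|u| = (Num.sqrt (sqn u))%:C%C.
Proof.
apply/eqP; rewrite -(@eqrXn2 _ 2) //; last by rewrite ler0c sqrtr_ge0.
by rewrite -hdot_norm hdot_sqn -rmorphXn /= sqr_sqrtr // sqn_ge0.
Qed.

Lemma norm_lt u e : 0 < e -> (`|u| < (e%:C)%C) = (sqn u < e ^+ 2).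
Proof.
move=> e0; rewrite normE ltcR -(@ltr_pXn2r _ 2) ?nnegrE ?sqrtr_ge0 ?(ltW e0) //.
by rewrite sqr_sqrtr // sqn_ge0.
Qed.

Lemma sqn_eq0 u : sqn u = 0 -> u = 0.
Proof. by move=> h; apply/normr0_eq0; rewrite normE h sqrtr0. Qed.

Lemma rdotNl u w : rdot (- u) w = - rdot u w.
Proof. by rewrite /rdot hdotNl ReN. Qed.
Lemma rdotNr u w : rdot w (- u) = - rdot w u.
Proof. by rewrite /rdot hdotNr ReN. Qed.
Lemma rdotDr u v w : rdot w (u + v) = rdot w u + rdot w v.
Proof. by rewrite /rdot hdotDr ReD. Qed.
Lemma rdotZr (r : R) u w : rdot w (r%:C%C *: u) = r * rdot w u.
Proof. by rewrite rdotC rdotZl rdotC. Qed.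
Lemma rdot0l w : rdot 0 w = 0. Proof. by rewrite /rdot hdot0l. Qed.
Lemma rdot0r w : rdot w 0 = 0. Proof. by rewrite /rdot hdot0r. Qed.
Lemma rdotBl u v w : rdot (u - v) w = rdot u w - rdot v w.
Proof. by rewrite rdotDl rdotNl. Qed.
Lemma rdotBr u v w : rdot w (u - v) = rdot w u - rdot w v.
Proof. by rewrite rdotDr rdotNr. Qed.

Lemma rdot_sqr_le u v : (rdot u v) ^+ 2 <= sqn u * sqn v.
Proof. exact: dot_CS rdotDl rdotZl rdotC sqn_ge0 _ _. Qed.

Lemma rdot_lt v e : 0 < e ->
  exists2 d, 0 < d & forall z, sqn z < d -> `|rdot z v| < e.
Proof. exact: dot_small rdotDl rdotZl rdotC sqn_ge0 _ _. Qed.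

Lemma sqnN u : sqn (- u) = sqn u.
Proof. by rewrite /sqn rdotNl rdotNr opprK. Qed.

Lemma sqnB u v : sqn (u - v) = sqn (v - u).
Proof. by rewrite -sqnN opprB. Qed.

Lemma sqnZ a u : sqn (a *: u) = ((Re a) ^+ 2 + (Im a) ^+ 2) * sqn u.
Proof.
rewrite /sqn /rdot hdotZl hdotZr hdot_sqn mulrA ReM /= mulr0 subr0 conjCE.
by case: a => x y /=; congr (_ * _); rewrite mulrN opprK -!expr2.
Qed.

Lemma sqnD_le u v : sqn (u + v) <= 2 * sqn u + 2 * sqn v.
Proof.
have := sqn_ge0 (u - v).
rewrite /sqn !rdotDl !rdotDr !rdotNl !rdotNr (rdotC v u); lra.
Qed.

Lemma hdot_Re u v : hdot u v = (rdot u v +i* rdot u ('i%C *: v))%C.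
Proof.
rewrite /rdot hdotZr ReM conjCE /= mul0r mulN1r opprK add0r.
by case: (hdot u v).
Qed.

Lemma rdot_inj u v : (forall w, rdot u w = rdot v w) -> u = v.
Proof.
move=> h; apply/eqP; rewrite -subr_eq0; apply/eqP/sqn_eq0.
by rewrite /sqn rdotBl h subrr.
Qed.

Lemma hdot_inj u v : (forall w, hdot u w = hdot v w) -> u = v.
Proof. by move=> h; apply: rdot_inj => w; rewrite /rdot h. Qed.

Lemma hdot_injr u v : (forall w, hdot w u = hdot w v) -> u = v.
Proof. by move=> h; apply: hdot_inj => w; rewrite hdotC h [RHS]hdotC. Qed.

Lemma hilbert_complete (u : nat -> V) :
  (forall e, 0 < e -> exists N, forall m n, (N <= m)%N -> (N <= n)%N ->
     sqn (u m - u n) < e) ->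
  exists l, forall e, 0 < e -> exists N, forall n, (N <= n)%N -> sqn (u n - l) < e.
Proof.
move=> cu.
have : cauchy (u @ \oo).
  apply: cauchy_exP => e; rewrite ltcE /= => /andP[/eqP i0 e0].
  have [N hN] := cu (Re e ^+ 2) (exprn_gt0 2 e0).
  exists (u N); exists N => // n /= hn; rewrite -ball_normE /=.
  have -> : e = (Re e)%:C%C by case: e i0 {e0 hN} => x y /= ->.
  by rewrite norm_lt //; exact: hN.
move=> /cauchy_cvg/cvg_ex[l /cvgrPdist_lt ul].
exists l => e e0.
have s0 : 0 < Num.sqrt e by rewrite sqrtr_gt0.
have [|N _ hN] := ul ((Num.sqrt e)%:C%C); first by rewrite ltcR.
exists N => n hn; have := hN n hn; rewrite norm_lt // sqr_sqrtr ?(ltW e0) //.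
by rewrite sqnB.
Qed.

Lemma closureE (A : set V) v :
  closure A v <-> forall e, 0 < e -> exists2 w, A w & sqn (v - w) < e.
Proof.
split=> [cA e e0|h B].
  have s0 : 0 < Num.sqrt e by rewrite sqrtr_gt0.
  have [|w [Aw]] := cA (ball v ((Num.sqrt e)%:C%C)).
    by apply: nbhsx_ballx; rewrite ltcR.
  rewrite -ball_normE /= norm_lt // sqr_sqrtr ?(ltW e0) // => ?.
  by exists w.
rewrite -nbhs_ballE => -[e /=]; rewrite ltcE /= => /andP[/eqP i0 e0] hB.
have [w Aw hw] := h _ (exprn_gt0 2 e0); exists w; split=> //; apply: hB.
rewrite -ball_normE /=.
have -> : e = (Re e)%:C%C by case: e i0 {e0 hw} => x y /= ->.
by rewrite norm_lt.
Qed.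

Section LinearFacts.
Variables (T : V -> V) (linT : linear T).
Lemma linD u v : T (u + v) = T u + T v.
Proof. by rewrite -{1}(scale1r u) linT scale1r. Qed.
Lemma lin0 : T 0 = 0.
Proof. by apply: (addrI (T 0)); rewrite -linD !addr0. Qed.
Lemma linZ a u : T (a *: u) = a *: T u.
Proof. by rewrite -{1}(addr0 (a *: u)) linT lin0 addr0. Qed.
Lemma linN u : T (- u) = - T u.
Proof. by rewrite -scaleN1r linZ scaleN1r. Qed.
Lemma linB u v : T (u - v) = T u - T v.
Proof. by rewrite linD linN. Qed.
End LinearFacts.

Lemma bounded_opP T : bounded_op T <->
  linear T /\ exists2 C, 0 <= C & forall v, sqn (T v) <= C * sqn v.
Proof.
split=> -[lT].
  pose f : {linear V -> V} := HB.pack T (GRing.isLinear.Build _ _ _ _ T lT).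
  move=> cT; split=> //.
  have /linear_boundedP : bounded_near f (nbhs 0) by apply/linear_bounded_continuous.
  move=> [M [Mr hM]].
  have [r [Mlr hr]] : exists r, M < r /\ 0 <= r.
    exists (`|M| + 1); split; last by rewrite addr_ge0.
    by apply: le_lt_trans (real_ler_norm Mr) _; rewrite ltrDl.
  exists (Re r ^+ 2); first by rewrite sqr_ge0.
  move=> v; have := hM r Mlr v; rewrite /= !normE.
  have rE : r = (Re r)%:C%C.
    by case: (r) hr => x y /=; rewrite lecE /= => /andP[/eqP -> _].
  have r0 : 0 <= Re r by move: hr; rewrite lecE => /andP[].
  rewrite rE -rmorphM /= lecR => h.
  have q1 : 0 <= sqn (T v) := sqn_ge0 _; have q2 : 0 <= sqn v := sqn_ge0 _.
  rewrite -(sqr_sqrtr q1) -(sqr_sqrtr q2) -exprMn.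
  by rewrite ler_pXn2r ?nnegrE ?sqrtr_ge0 ?mulr_ge0 ?sqrtr_ge0.
move=> [C C0 hC]; split=> //.
pose f : {linear V -> V} := HB.pack T (GRing.isLinear.Build _ _ _ _ T lT).
suff /linear_bounded_continuous : bounded_near f (nbhs 0) by [].
apply/linear_boundedP; exists (Num.sqrt C)%:C%C; split.
  by rewrite complex_real.
move=> r hr v; rewrite /= !normE.
apply: le_trans (_ : (Num.sqrt C)%:C%C * (Num.sqrt (sqn v))%:C%C <= _).
  by rewrite -rmorphM /= lecR -sqrtrM // ler_wsqrtr.
by rewrite ler_wpM2r ?ler0c ?sqrtr_ge0 // ltW.
Qed.

End HilbertBasics.

Section Operators.
Context {R : realType} {V : hilbertType R}.
Implicit Types (u v w : V) (a c : R[i]) (S T p : V -> V) (H : set V).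

Lemma rdot_scalei u v : rdot u ('i%C *: v) = - rdot ('i%C *: u) v.
Proof.
rewrite /rdot hdotZl hdotZr !ReM conjCE /= !mul0r mulN1r mul1r.
by case: (hdot u v) => x y /=; ring.
Qed.

Lemma sqnD u v : sqn (u + v) = sqn u + 2 * rdot u v + sqn v.
Proof. by rewrite /sqn !rdotDl !rdotDr (rdotC v u); ring. Qed.

Lemma sqnB_eq u v : sqn (u - v) = sqn u - 2 * rdot u v + sqn v.
Proof. by rewrite sqnD sqnN rdotNr; ring. Qed.

Lemma sqnn_ge0 u : 0 <= sqn u. Proof. exact: sqn_ge0. Qed.

(** [riesz_graph] represents the real part; the imaginary part follows by evaluating at i u. The
    functional is given by its graph, so that one defined on values such as eta y needs no prior
    proof of being well defined: the bound implies it. The bound on w holds because w is a limit of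
    vectors u of the domain, where the square of the real part of <u, w> is at most C |u|^2. *)
Lemma riesz_rel (D : V -> R[i] -> Prop) (C : R) :
  D 0 0 ->
  (forall c u v a b, D u a -> D v b -> D (c *: u + v) (c * a + b)) ->
  0 <= C ->
  (forall u a, D u a -> (Re a) ^+ 2 <= C * sqn u) ->
  exists w, [/\ closure [set u | exists a, D u a] w, sqn w <= C &
    forall u a, D u a -> a = hdot u w].
Proof.
move=> D0 DP C0 DC.
pose G u r := exists2 a, D u a & r = Re a.
have [|||||w [cw hw]] := riesz_graph rdotDl rdotZl rdotC sqn_ge0
    hilbert_complete (G := G) (C := C).
- by exists 0.
- move=> u v _ _ [a Da ->] [b Db ->]; exists (a + b); last by rewrite ReD.
  by have := DP 1 _ _ _ _ Da Db; rewrite scale1r mul1r.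
- move=> r u _ [a Da ->]; exists (r%:C%C * a); last by rewrite ReZ.
  by have := DP r%:C%C _ _ _ _ Da D0; rewrite !addr0.
- exact: C0.
- by move=> u _ [a Da ->]; exact: DC.
have DE u a : D u a -> a = hdot u w.
  move=> Da; rewrite hdot_Re.
  have -> : rdot u w = Re a by rewrite -(hw u (Re a)) //; exists a.
  have /hw : G ('i%C *: u) (Re ('i%C * a)).
    by exists ('i%C * a) => //; have := DP 'i%C _ _ _ _ Da D0; rewrite !addr0.
  rewrite rdot_scalei => <-; rewrite ReM /= mul0r mul1r sub0r opprK.
  by case: (a).
exists w; split=> //.
  apply/closureE => e /cw [u [_ [[a Da _] h]]]; exists u; first by exists a.
  by rewrite sqnB.
rewrite leNgt; apply/negP => Cs.
have [u [_ [[a Da _]]]] := cw ((sqn w - C) / 2) ltac:(lra).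
rewrite -/(sqn _) sqnB_eq; have := DC u a Da; rewrite (DE _ _ Da) -/(rdot u w).
have q := sqnn_ge0 u.
have [->|Cn] := eqVneq C 0.
  rewrite mul0r => h; have /eqP : rdot u w ^+ 2 = 0 by apply/eqP; rewrite eq_le h sqr_ge0.
  rewrite sqrf_eq0 => /eqP ->; have := sqnn_ge0 w; lra.
have Cp : 0 < C by rewrite lt_neqAle eq_sym Cn.
move: (rdot u w) (sqn u) (sqn w) q Cs => x U W q Cs h1 h2.
have h3 : C * (U - 2 * x + W) < C * ((W - C) / 2) by rewrite ltr_pM2l.
have h4 : 0 < C * (W - C) by rewrite mulr_gt0 // subr_gt0.
have := sqr_ge0 (x - C); nra.
Qed.

Lemma adjoint_exists T : bounded_op T ->
  exists S, forall u v, hdot (T u) v = hdot u (S v).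
Proof.
move=> /bounded_opP[lT [C C0 hC]].
suff /choice[S hS] : forall v, exists w, forall u, hdot (T u) v = hdot u w.
  by exists S.
move=> v; pose D u a := a = hdot (T u) v.
have [||||w [_ _ hw]] := riesz_rel (D := D) (C := C * sqn v).
- by rewrite /D lin0 // hdot0l.
- by move=> c u u' _ _ -> ->; rewrite /D lT hdotPl.
- by rewrite mulr_ge0 // sqnn_ge0.
- move=> u _ ->; apply: le_trans (rdot_sqr_le _ _) _.
  by rewrite mulrAC ler_wpM2r ?sqnn_ge0.
by exists w => u; exact: hw.
Qed.

Lemma adjP T u v : bounded_op T -> hdot (T u) v = hdot u (adjoint T v).
Proof.
by move=> /adjoint_exists[S hS]; rewrite /adjoint; case: xgetP => [S' _ ->|/(_ S)].
Qed.

Lemma adj_uniq T S : (forall u v, hdot (T u) v = hdot u (S v)) -> adjoint T = S.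
Proof.
move=> hS; rewrite /adjoint; case: xgetP => [S' _ hS'|/(_ S)//].
by apply: funext => v; apply: hdot_injr => w; rewrite -hS'.
Qed.

Lemma adjPl T u v : bounded_op T -> hdot (adjoint T u) v = hdot u (T v).
Proof. by move=> bT; rewrite hdotC -adjP // -hdotC. Qed.

Lemma radjP T u v : bounded_op T -> rdot (T u) v = rdot u (adjoint T v).
Proof. by move=> bT; rewrite /rdot adjP. Qed.

Lemma radjPl T u v : bounded_op T -> rdot (adjoint T u) v = rdot u (T v).
Proof. by move=> bT; rewrite /rdot adjPl. Qed.

Lemma bounded_lin T : bounded_op T -> linear T. Proof. by case. Qed.

Lemma bounded_adj T : bounded_op T -> bounded_op (adjoint T).
Proof.
move=> bT; apply/bounded_opP; split.
  move=> a u v; apply: hdot_injr => w.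
  by rewrite -adjP // !hdotDr !hdotZr -!adjP // !(hdotDr, hdotZr).
have /bounded_opP[_ [C C0 hC]] := bT.
exists C => // v.
have h := rdot_sqr_le (T (adjoint T v)) v.
rewrite radjP // -/(sqn _) in h.
have [-> |qn] := eqVneq (sqn (adjoint T v)) 0; first by rewrite mulr_ge0 ?sqnn_ge0.
have qp : 0 < sqn (adjoint T v) by rewrite lt_neqAle eq_sym qn sqnn_ge0.
rewrite -(ler_pM2l qp) -expr2 (le_trans h) //.
by rewrite mulrA (mulrC _ C) ler_wpM2r ?sqnn_ge0.
Qed.

Lemma adjK T : bounded_op T -> adjoint (adjoint T) = T.
Proof. by move=> bT; apply: adj_uniq => u v; rewrite adjPl. Qed.

Lemma bounded0 : bounded_op (0 : V -> V).
Proof.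
apply/bounded_opP; split; first by move=> a u v; rewrite /= scaler0 addr0.
by exists 0 => // v; rewrite mul0r /sqn rdot0l.
Qed.

Lemma bounded_id : bounded_op (idfun : V -> V).
Proof. by apply/bounded_opP; split=> //; exists 1 => // v; rewrite mul1r. Qed.

Lemma bounded_comp S T : bounded_op S -> bounded_op T -> bounded_op (S \o T).
Proof.
move=> /bounded_opP[lS [C C0 hC]] /bounded_opP[lT [D D0 hD]].
apply/bounded_opP; split; first by move=> a u v /=; rewrite lT lS.
exists (C * D); first exact: mulr_ge0.
by move=> v /=; apply: le_trans (hC _) _; rewrite -mulrA ler_wpM2l.
Qed.

Lemma bounded_lincomb a S T : bounded_op S -> bounded_op T -> bounded_op (a *: S + T).
Proof.
move=> /bounded_opP[lS [C C0 hC]] /bounded_opP[lT [D D0 hD]].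
apply/bounded_opP; split.
  move=> b u v; rewrite -[LHS]/(a *: S (b *: u + v) + T (b *: u + v)).
  rewrite -[in RHS]/(a *: S u + T u) -[in RHS]/(a *: S v + T v) lT lS.
  by rewrite !scalerDr !scalerA (mulrC b) -!addrA; congr (_ + _); rewrite addrCA.
set n := Re a ^+ 2 + Im a ^+ 2.
have n0 : 0 <= n by rewrite addr_ge0 ?sqr_ge0.
exists (2 * (n * C) + 2 * D); first by rewrite addr_ge0 ?mulr_ge0.
move=> v; rewrite -[X in sqn X <= _]/(a *: S v + T v); apply: le_trans (sqnD_le _ _) _.
rewrite sqnZ -/n [leRHS]mulrDl; apply: lerD; rewrite -(mulrA 2) ler_pM2l //.
by rewrite -mulrA ler_wpM2l.
Qed.

Lemma bounded_add S T : bounded_op S -> bounded_op T -> bounded_op (S + T).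
Proof. by move=> bS bT; rewrite -(scale1r S); exact: bounded_lincomb. Qed.

Lemma bounded_scale a S : bounded_op S -> bounded_op (a *: S).
Proof. by move=> bS; rewrite -(addr0 (a *: S)); exact: bounded_lincomb bounded0. Qed.

Lemma bounded_opp S : bounded_op S -> bounded_op (- S).
Proof. by move=> bS; rewrite -scaleN1r; exact: bounded_scale. Qed.

Lemma bounded_sub S T : bounded_op S -> bounded_op T -> bounded_op (S - T).
Proof. by move=> bS bT; apply: bounded_add => //; exact: bounded_opp. Qed.

Lemma adj_lincomb a S T : bounded_op S -> bounded_op T ->
  adjoint (a *: S + T) = a^* *: adjoint S + adjoint T.
Proof.
move=> bS bT; apply: adj_uniq => u v.
rewrite -[in LHS]/(a *: S u + T u) -[in RHS]/(a^* *: adjoint S v + adjoint T v).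
by rewrite hdotDl hdotDr hdotZl hdotZr !adjP // conjCK.
Qed.

Lemma adj0 : adjoint (0 : V -> V) = 0.
Proof. by apply: adj_uniq => u v; rewrite hdot0l hdot0r. Qed.

Lemma adj_scale a S : bounded_op S -> adjoint (a *: S) = a^* *: adjoint S.
Proof.
by move=> bS; rewrite -(addr0 (a *: S)) adj_lincomb //; [rewrite adj0 addr0|exact: bounded0].
Qed.

Lemma adj_add S T : bounded_op S -> bounded_op T ->
  adjoint (S + T) = adjoint S + adjoint T.
Proof. by move=> bS bT; rewrite -{1}(scale1r S) adj_lincomb // rmorph1 scale1r. Qed.

Lemma adj_sub S T : bounded_op S -> bounded_op T ->
  adjoint (S - T) = adjoint S - adjoint T.
Proof.
move=> bS bT; rewrite adj_add //; last exact: bounded_opp.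
by rewrite -(scaleN1r T) adj_scale // rmorphN rmorph1 scaleN1r.
Qed.

Lemma adj_comp S T : bounded_op S -> bounded_op T ->
  adjoint (S \o T) = adjoint T \o adjoint S.
Proof. by move=> bS bT; apply: adj_uniq => u v /=; rewrite !adjP. Qed.

Lemma adj_id : adjoint (idfun : V -> V) = idfun.
Proof. exact: adj_uniq. Qed.

Lemma bounded_small T v e : bounded_op T -> 0 < e -> exists2 d, 0 < d &
  forall w, sqn (v - w) < d -> sqn (T v - T w) < e.
Proof.
move=> /bounded_opP[lT [C C0 hC]] e0.
have C1 : 0 < C + 1 by lra.
exists (e / (C + 1)); first by rewrite divr_gt0.
move=> w; rewrite ltr_pdivlMr // => h; rewrite -linB //.
apply: le_lt_trans (hC _) _; have := sqnn_ge0 (v - w); nra.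
Qed.

Lemma closure_image T H H' v : bounded_op T -> (forall h, H h -> H' (T h)) ->
  closure H v -> closure H' (T v).
Proof.
move=> bT HT /closureE cH; apply/closureE => e e0.
have [d d0 hd] := bounded_small v bT e0.
by have [w Hw hw] := cH d d0; exists (T w); [exact: HT | exact: hd].
Qed.

Lemma orth_closure H w v : (forall h, H h -> hdot h w = 0) -> closure H v -> hdot v w = 0.
Proof.
move=> Hw /closureE cH.
have key z : (forall h, H h -> rdot h z = 0) -> rdot v z = 0.
  move=> hz; apply/eqP; rewrite -normr_le0 leNgt; apply/negP => e0.
  have [d d0 hd] := rdot_lt z e0.
  have [h Hh /hd] := cH d d0.
  by rewrite rdotBl (hz h Hh) subr0 ltxx.
have k1 : rdot v w = 0 by apply: key => h Hh; rewrite /rdot Hw.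
have k2 : rdot v ('i%C *: w) = 0 by apply: key => h Hh; rewrite /rdot hdotZr Hw // mulr0.
by rewrite hdot_Re k1 k2.
Qed.

(** No limits are taken: S v is the Riesz vector of u |-> <x, v> on the graph, density of the domain
    makes S linear, and the extension is the adjoint of S. *)
Lemma extend_op (D : V -> V -> Prop) (C : R) :
  D 0 0 ->
  (forall c u v (x y : V), D u x -> D v y -> D (c *: u + v) (c *: x + y)) ->
  0 <= C -> (forall u (x : V), D u x -> sqn x <= C * sqn u) ->
  (forall v, closure [set u | exists x : V, D u x] v) ->
  exists2 T, bounded_op T & forall u (x : V), D u x -> T u = x.
Proof.
move=> D0 DP C0 DC Dd.
have /choice[S hS] : forall v, exists w, sqn w <= C * sqn v /\
    forall u (a : V), D u a -> hdot a v = hdot u w.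
  move=> v; pose E u z := exists2 a, D u a & z = hdot a v.
  have [||||w [_ h1 h2]] := riesz_rel (D := E) (C := C * sqn v).
  - by exists 0 => //; rewrite hdot0l.
  - move=> c u u' _ _ [a Da ->] [b Db ->].
    by exists (c *: a + b); [exact: DP | rewrite hdotPl].
  - by rewrite mulr_ge0 // sqnn_ge0.
  - move=> u _ [a Da ->]; apply: le_trans (rdot_sqr_le _ _) _.
    by rewrite mulrAC ler_wpM2r ?sqnn_ge0 //; exact: DC.
  by exists w; split=> // u a Da; apply: h2; exists a.
have bS : bounded_op S.
  apply/bounded_opP; split; last by exists C => // v; have [] := hS v.
  move=> c u v; apply: hdot_injr => w; apply/eqP; rewrite -subr_eq0 -hdotNr -hdotDr; apply/eqP.
  apply: orth_closure (Dd w) => h [a Da].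
  have [_ h1] := hS (c *: u + v); have [_ h2] := hS u; have [_ h3] := hS v.
  rewrite hdotDr hdotNr !(hdotDr, hdotZr) -(h1 _ a) // -(h2 _ a) // -(h3 _ a) //.
  by rewrite !(hdotDr, hdotZr) subrr.
exists (adjoint S); first exact: bounded_adj.
move=> u a Da; apply: hdot_inj => v; rewrite adjPl //.
by have [_ h] := hS v; rewrite -(h u a).
Qed.

Definition subspace H := H 0 /\ forall c u v, H u -> H v -> H (c *: u + v).

Record proj_on H p : Prop := {
  proj_bounded : bounded_op p;
  proj_mem : forall v, closure H (p v);
  proj_orth : forall v h, H h -> hdot h (v - p v) = 0
}.

Lemma closure_sub H u v c : subspace H -> closure H u -> closure H v ->
  closure H (c *: u + v).
Proof.
move=> [H0 HP] /closureE cu /closureE cv; apply/closureE => e e0.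
set n := Re c ^+ 2 + Im c ^+ 2.
have n0 : 0 <= n by rewrite addr_ge0 ?sqr_ge0.
have n1 : 0 < 4 * n + 4 by lra.
have [u' Hu hu] := cu (e / (4 * n + 4)) (divr_gt0 e0 n1).
have [|v' Hv hv] := cv (e / 4); first by lra.
exists (c *: u' + v'); first exact: HP.
have -> : c *: u + v - (c *: u' + v') = c *: (u - u') + (v - v').
  by rewrite scalerBr opprD addrACA.
apply: le_lt_trans (sqnD_le _ _) _; rewrite sqnZ -/n.
move: hu; rewrite ltr_pdivlMr // => hu.
have := sqnn_ge0 (u - u'); nra.
Qed.

Lemma proj_uniq H v w w' : subspace H -> closure H w -> closure H w' ->
  (forall h, H h -> hdot h (v - w) = 0) -> (forall h, H h -> hdot h (v - w') = 0) ->
  w = w'.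
Proof.
move=> sH cw cw' hw hw'; apply/eqP; rewrite -subr_eq0; apply/eqP/hdot_inj => x.
rewrite hdot0l.
have cd : closure H (w - w').
  by rewrite addrC -scaleN1r; exact: closure_sub.
suff: hdot (w - w') (w - w') = 0.
  by rewrite hdot_sqn => -[/sqn_eq0 ->]; rewrite hdot0l.
apply: orth_closure cd => h Hh.
have -> : w - w' = (v - w') - (v - w) by rewrite opprB [RHS]addrC addrA subrK.
by rewrite hdotDr hdotNr hw // hw' // subrr.
Qed.

Lemma proj_exists H : subspace H -> exists p, proj_on H p.
Proof.
move=> sH; have [H0 HP] := sH.
have /choice[p hp] : forall v, exists w, [/\ closure H w, sqn w <= sqn v &
    forall h, H h -> hdot h v = hdot h w].
  move=> v; pose E u z := H u /\ z = hdot u v.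
  have [||||w [h0 h1 h2]] := riesz_rel (D := E) (C := sqn v).
  - by split=> //; rewrite hdot0l.
  - by move=> c u u' _ _ [Hu ->] [Hu' ->]; split; [exact: HP|rewrite hdotPl].
  - exact: sqnn_ge0.
  - by move=> u _ [_ ->]; rewrite (mulrC (sqn v)); exact: rdot_sqr_le.
  exists w; split=> //; last by move=> h Hh; exact: h2.
  by apply: closureS h0 => u /= [z []].
have po v h : H h -> hdot h (v - p v) = 0.
  by move=> Hh; have [_ _ hv] := hp v; rewrite hdotDr hdotNr hv // subrr.
exists p; split=> //; last by move=> v; have [] := hp v.
apply/bounded_opP; split; last by exists 1 => // v; rewrite mul1r; have [] := hp v.
move=> c u v; apply: (@proj_uniq H (c *: u + v)) => //.
- by have [] := hp (c *: u + v).
- by apply: closure_sub => //; [have [] := hp u|have [] := hp v].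
- by move=> h Hh; exact: po.
- move=> h Hh; rewrite opprD addrACA -scalerBr hdotDr hdotZr !po //.
  by rewrite mulr0 addr0.
Qed.

Section Proj.
Variables (H : set V) (p : V -> V) (sH : subspace H) (pH : proj_on H p).

Lemma proj_fix v : closure H v -> p v = v.
Proof.
move=> cv; apply: (@proj_uniq H v) => //; first exact: (proj_mem pH).
  by move=> h Hh; exact: (proj_orth pH).
by move=> h Hh; rewrite subrr hdot0r.
Qed.

Lemma proj_idem v : p (p v) = p v.
Proof. by apply: proj_fix; exact: (proj_mem pH). Qed.

Lemma proj_orthc v h : closure H h -> hdot h (v - p v) = 0.
Proof. by apply: orth_closure => h' Hh'; exact: (proj_orth pH). Qed.

Lemma proj_sym u v : hdot (p u) v = hdot u (p v).
Proof.
have h1 : hdot (p u) (v - p v) = 0 by apply: proj_orthc; exact: (proj_mem pH).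
have h2 : hdot (p v) (u - p u) = 0 by apply: proj_orthc; exact: (proj_mem pH).
move: h1 h2; rewrite !hdotDr !hdotNr => /eqP; rewrite subr_eq0 => /eqP -> /eqP.
by rewrite subr_eq0 => /eqP h; rewrite hdotC -h -hdotC.
Qed.

Lemma proj_adj : adjoint p = p.
Proof. by apply: adj_uniq => u v; exact: proj_sym. Qed.

(** T (p v) has the two properties that characterise p (T v); invariance of H under the adjoint
    gives the orthogonality. *)
Lemma proj_commute T : bounded_op T -> (forall h, H h -> H (T h)) ->
  (forall h, H h -> H (adjoint T h)) -> forall v, p (T v) = T (p v).
Proof.
move=> bT HT HT' v; apply: (@proj_uniq H (T v)) => //.
- exact: (proj_mem pH).
- by apply: (closure_image bT HT); exact: (proj_mem pH).
- by move=> h Hh; exact: (proj_orth pH).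
- move=> h Hh; rewrite -linB; last exact: bounded_lin.
  by rewrite -adjPl // (proj_orth pH) //; exact: HT'.
Qed.

End Proj.

(** Only real parts are compared; for linear T the full identity follows on replacing v by i v, see
    [symm_hdot]. *)
Definition symm T := forall u v, rdot (T u) v = rdot u (T v).

Lemma symm_hdot T u v : linear T -> symm T -> hdot (T u) v = hdot u (T v).
Proof. by move=> lT sT; rewrite !hdot_Re !sT linZ. Qed.

Lemma symm_adj T : linear T -> symm T -> adjoint T = T.
Proof. by move=> lT sT; apply: adj_uniq => u v; exact: symm_hdot. Qed.

Lemma adj_symm T : bounded_op T -> adjoint T = T -> symm T.
Proof. by move=> bT aT u v; rewrite radjP // aT. Qed.

(** The order on R[i] makes <T v, v> real for every v, and reality at u + i v, u and i v polarises
    to symmetry. *)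
Lemma pos_opP T : linear T -> pos_op T <-> symm T /\ forall v, 0 <= rdot (T v) v.
Proof.
move=> lT; split=> [pT|[sT pT] v].
  split; last by move=> v; have := pT v; rewrite lecE => /andP[].
  move=> u v; rewrite (rdotC u).
  have := pT (u + 'i%C *: v); have := pT u; have := pT ('i%C *: v).
  rewrite !lecE linD // linZ // !hdot_Re /= !(rdotDl, rdotDr, rdot_scalei, scalerDr).
  rewrite !scalerA -!expr2 sqr_i !scaleN1r !rdotNl !opprK.
  move=> /andP[/eqP h1 _] /andP[/eqP h2 _] /andP[/eqP h3 _].
  move: h1 h2 h3; rewrite ?rdotNl ?rdotNr ?opprK; lra.
rewrite hdot_Re lecE /= pT andbT.
have := sT v ('i%C *: v).
rewrite linZ // [RHS]rdot_scalei [in RHS]rdotC => h; apply/eqP => /=; lra.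
Qed.

Section Pos.
Variables (T : V -> V) (bT : bounded_op T) (pT : pos_op T).
Let lT := bounded_lin bT.

Lemma pos_symm : symm T. Proof. by have /(pos_opP lT)[] := pT. Qed.
Lemma pos_ge0 v : 0 <= rdot (T v) v. Proof. by have /(pos_opP lT)[_] := pT. Qed.
Lemma pos_adj : adjoint T = T. Proof. exact: symm_adj pos_symm. Qed.

Lemma pos_CS u v : (rdot (T u) v) ^+ 2 <= rdot (T u) u * rdot (T v) v.
Proof.
apply: (dot_CS (dot := fun x y => rdot (T x) y)).
- by move=> x y z; rewrite linD // rdotDl.
- by move=> r x z; rewrite linZ // rdotZl.
- by move=> x y; rewrite pos_symm rdotC.
- exact: pos_ge0.
Qed.

(** Cauchy-Schwarz for the form of T at u and T u: |T u|^4 <= <T u, u> <T T u, T u> <= <T u, u> C |T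
    u|^2. Small forms thus force small vectors, which turns convergence of forms along increasing
    nets into strong convergence. *)
Lemma pos_sqn_le C u : (forall v, rdot (T v) v <= C * sqn v) ->
  sqn (T u) <= C * rdot (T u) u.
Proof.
move=> hC; have h := pos_CS u (T u).
have [->|qn] := eqVneq (sqn (T u)) 0.
  have [u0|un] := eqVneq (sqn u) 0.
    by rewrite (sqn_eq0 u0) rdot0r mulr0.
  have up : 0 < sqn u by rewrite lt_neqAle eq_sym un sqnn_ge0.
  rewrite mulr_ge0 ?pos_ge0 // -(pmulr_lge0 _ up).
  by apply: le_trans (hC u); exact: pos_ge0.
have qp : 0 < sqn (T u) by rewrite lt_neqAle eq_sym qn sqnn_ge0.
rewrite -(ler_pM2r qp) -expr2 (le_trans h) //.
rewrite (mulrC C) -mulrA ler_wpM2l ?pos_ge0 //; exact: hC.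
Qed.

Lemma pos_eq0 : (forall v, rdot (T v) v <= 0) -> T = 0.
Proof.
move=> h; apply: funext => u; apply: sqn_eq0; apply/eqP; rewrite eq_le sqnn_ge0 andbT.
by have := @pos_sqn_le 0 u; rewrite mul0r; apply => v; rewrite mul0r.
Qed.

End Pos.

Lemma bounded_form T : bounded_op T ->
  exists2 C, 0 < C & forall v, rdot (T v) v <= C * sqn v.
Proof.
move=> /bounded_opP[_ [C C0 hC]]; exists (C + 1); first by lra.
move=> v; have := hC v; have := sqnn_ge0 (T v - v); rewrite sqnB_eq.
have := sqnn_ge0 v; have := sqnn_ge0 (T v); nra.
Qed.

Lemma le_opP S T : linear S -> linear T -> symm S -> symm T ->
  le_op S T <-> forall v, rdot (S v) v <= rdot (T v) v.
Proof.
move=> lS lT sS sT.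
have lTS : linear (T - S).
  move=> a u v; rewrite -[LHS]/(T _ - S _) lT lS -[in RHS]/(T u - S u) -[in RHS]/(T v - S v).
  by rewrite scalerBr opprD addrACA.
rewrite /le_op (pos_opP lTS); split=> [[_ h] v|h].
  by have := h v; rewrite rdotBl subr_ge0.
split=> [u v|v]; last by rewrite rdotBl subr_ge0.
by rewrite rdotBl rdotBr sS sT.
Qed.

End Operators.

(** * The double commutant theorem *)

Section DoubleCommutant.
Context {R : realType} {V : hilbertType R}.
Implicit Types (S T t : V -> V) (A : set (V -> V)).

Definition commutant A : set (V -> V) :=
  [set t | bounded_op t /\ forall s, A s -> forall v, s (t v) = t (s v)].

Definition nondegenerate A := forall v : V, (forall s, A s -> s v = 0) -> v = 0.

(** The factor 2 comes from bounding the real and imaginary parts separately. *)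
Lemma hdot_norm_lt (u v : V) e : 0 < e -> 2 * (sqn u * sqn v) < e ^+ 2 ->
  `|hdot u v| < e%:C%C.
Proof.
move=> e0 h; rewrite normc_def ltcR -(@ltr_pXn2r _ 2) ?nnegrE ?sqrtr_ge0 ?(ltW e0) //.
rewrite sqr_sqrtr ?addr_ge0 ?sqr_ge0 //; apply: le_lt_trans h.
have h1 := rdot_sqr_le u v; have := rdot_sqr_le u ('i%C *: v).
rewrite sqnZ /= expr0n expr1n add0r mul1r hdot_Re /=; lra.
Qed.

Section Tuples.
Variables (n : nat).
Implicit Types f g a b : 'I_n -> V.
(** On V^n, this real form and its completeness are all that [riesz_graph] asks for. *)
Definition tdot f g : R := \sum_i rdot (f i) (g i).

Lemma tdotDl f g a : tdot (f + g) a = tdot f a + tdot g a.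
Proof. by rewrite -big_split; apply: eq_bigr => i _; exact: rdotDl. Qed.
Lemma tdotZl r f a : tdot (r%:C%C *: f) a = r * tdot f a.
Proof. by rewrite mulr_sumr; apply: eq_bigr => i _; exact: rdotZl. Qed.
Lemma tdotC f g : tdot f g = tdot g f.
Proof. by apply: eq_bigr => i _; rewrite rdotC. Qed.
Lemma tdot_ge0 f : 0 <= tdot f f.
Proof. by apply: sumr_ge0 => i _; exact: sqn_ge0. Qed.
Lemma tdot_le f i : sqn (f i) <= tdot f f.
Proof.
rewrite /tdot (bigD1 i) //= lerDl; apply: sumr_ge0 => j _; exact: sqn_ge0.
Qed.
Lemma tdotZ c f g : tdot (c *: f) g = tdot f (c^* *: g).
Proof. apply: eq_bigr => i _; rewrite /rdot -[(c *: f) i]/(c *: f i) -[(_ *: g) i]/(c^* *: g i).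
by rewrite hdotZl hdotZr conjCK. Qed.

Lemma tdot_complete (u : nat -> 'I_n -> V) :
  (forall e, 0 < e -> exists N, forall i j, (N <= i)%N -> (N <= j)%N ->
     tdot (u i - u j) (u i - u j) < e) ->
  exists l, forall e, 0 < e -> exists N, forall i, (N <= i)%N ->
     tdot (u i - l) (u i - l) < e.
Proof.
move=> cu.
have /choice[l hl] : forall k : 'I_n, exists l, forall e, 0 < e ->
    exists N, forall i, (N <= i)%N -> sqn (u i k - l) < e.
  move=> k; apply: (hilbert_complete (u := fun i => u i k)) => e e0.
  have [N hN] := cu e e0; exists N => i j hi hj.
  by apply: le_lt_trans (hN _ _ hi hj); exact: (tdot_le (u i - u j) k).
exists l => e e0.
have e1 : 0 < e / n.+1%:R by rewrite divr_gt0 // ltr0n.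
have /choice[N hN] : forall k : 'I_n, exists N, forall i, (N <= i)%N ->
    sqn (u i k - l k) < e / n.+1%:R by move=> k; exact: hl.
exists (\max_k N k) => i hi.
apply: le_lt_trans (_ : \sum_(k < n) e / n.+1%:R < e).
  apply: ler_sum => k _; apply/ltW/hN.
  by apply: leq_trans hi; exact: leq_bigmax.
rewrite sumr_const card_ord -[ltLHS]mulr_natr mulrAC ltr_pdivrMr ?ltr0n //.
by rewrite ltr_pM2l // ltr_nat.
Qed.
End Tuples.

Lemma subop_bounded A : star_subalgebra A -> forall s, A s -> bounded_op s.
Proof. by case. Qed.

(* The projection [P] of [V^n] onto the closure of the vectors [(S u_i)_i], for [S]
   in [A], is a matrix of operators of the commutant of [A]. *)
Theorem double_commutant A T : star_subalgebra A -> wot_closed A ->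
  nondegenerate A -> bounded_op T ->
  (forall t, commutant A t -> forall v, T (t v) = t (T v)) -> A T.
Proof.
move=> sA cA nA bT hT; apply: cA => // l e e0.
have bA := subop_bounded sA.
pose n := size l; pose u (i : 'I_n) := (l`_i).1.
pose isP (a w : 'I_n -> V) := (forall e, 0 < e -> exists2 S, A S & tdot (S \o u - w) (S \o u - w) < e)
  /\ forall S, A S -> tdot (S \o u) (a - w) = 0.
have tCS := dot_CS (@tdotDl n) (@tdotZl n) (@tdotC n) (@tdot_ge0 n).
have tsm := dot_small (@tdotDl n) (@tdotZl n) (@tdotC n) (@tdot_ge0 n).
have tN (f g : 'I_n -> V) : tdot (- f) g = - tdot f g by exact: (dotNl (@tdotZl n)).
have tDr (f g h : 'I_n -> V) : tdot h (f + g) = tdot h f + tdot h g.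
  by rewrite tdotC tdotDl !(tdotC h).
have tNr (f g : 'I_n -> V) : tdot g (- f) = - tdot g f by rewrite tdotC tN tdotC.
have t0 (f : 'I_n -> V) : tdot f f = 0 -> f = 0.
  move=> f0; apply: funext => i; apply: sqn_eq0; apply/eqP.
  by rewrite eq_le sqnn_ge0 andbT -f0 tdot_le.
have tD_le (f g : 'I_n -> V) : tdot (f + g) (f + g) <= 2 * tdot f f + 2 * tdot g g.
  have := tdot_ge0 (f - g); rewrite !tdotDl !tDr !tN !tNr (tdotC g f); lra.
have exP a : exists w, isP a w.
  pose G f r := exists S, [/\ A S, f = S \o u & r = tdot f a].
  have [|||||w [h1 h2]] := riesz_graph (@tdotDl n) (@tdotZl n) (@tdotC n)
    (@tdot_ge0 n) (@tdot_complete n) (G := G) (C := tdot a a).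
  - exists 0; split => //; first exact: (star_subalgebra0 sA).
    by rewrite /tdot big1 // => i _; rewrite /= rdot0l.
  - move=> _ _ _ _ [S [AS -> ->]] [S' [AS' -> ->]]; exists (1 *: S + S').
    split; [exact: (star_subalgebraP sA) | by rewrite scale1r | by rewrite tdotDl].
  - move=> r _ _ [S [AS -> ->]]; exists (r%:C%C *: S + 0).
    split; [|by rewrite addr0|by rewrite tdotZl].
    by apply: (star_subalgebraP sA) => //; exact: (star_subalgebra0 sA).
  - exact: tdot_ge0.
  - by move=> _ _ [S [AS -> ->]]; rewrite (mulrC (tdot a a)); exact: tCS.
  exists w; split.
    by move=> d d0; have [_ [_ [[S [AS -> _]] h]]] := h1 d d0; exists S.
  move=> S AS; rewrite tDr tNr -(h2 (S \o u) (tdot (S \o u) a)) ?subrr //.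
  by exists S.
have uniqP a w w' : isP a w -> isP a w' -> w = w'.
  move=> [h1 h2] [h1' h2']; apply/eqP; rewrite -subr_eq0; apply/eqP/t0.
  have o S : A S -> tdot (S \o u) (w - w') = 0.
    move=> AS; have -> : w - w' = (a - w') - (a - w).
      by rewrite opprB [RHS]addrC addrA subrK.
    by rewrite tDr tNr h2 // h2' // subrr.
  have oo (x : 'I_n -> V) : (forall d, 0 < d -> exists2 S, A S & tdot (S \o u - x) (S \o u - x) < d) ->
      tdot x (w - w') = 0.
    move=> hx; apply/eqP; rewrite -normr_le0 leNgt; apply/negP => x0.
    have [d d0 hd] := tsm (w - w') _ x0.
    have [S AS /hd] := hx d d0.
    by rewrite tdotDl tN (o S AS) sub0r normrN ltxx.
  by rewrite tdotDl tN (oo w h1) (oo w' h1') subrr.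
have linP c a b w x : isP a w -> isP b x -> isP (c *: a + b) (c *: w + x).
  move=> [h1 h2] [h3 h4]; split.
    move=> d d0; set m := Re c ^+ 2 + Im c ^+ 2.
    have m0 : 0 <= m by rewrite addr_ge0 ?sqr_ge0.
    have m1 : 0 < 4 * m + 4 by lra.
    have [S AS hS] := h1 (d / (4 * m + 4)) (divr_gt0 d0 m1).
    have [|S' AS' hS'] := h3 (d / 4); first by lra.
    exists (c *: S + S'); first exact: (star_subalgebraP sA).
    have -> : (c *: S + S') \o u - (c *: w + x) = c *: (S \o u - w) + (S' \o u - x).
      by rewrite scalerBr opprD addrACA.
    apply: le_lt_trans (tD_le _ _) _.
    have -> : tdot (c *: (S \o u - w)) (c *: (S \o u - w)) = m * tdot (S \o u - w) (S \o u - w).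
      by rewrite mulr_sumr; apply: eq_bigr => i _; rewrite -[LHS]/(sqn _) sqnZ.
    move: hS; rewrite ltr_pdivlMr // => hS.
    have := tdot_ge0 (S \o u - w); nra.
  move=> S AS; have -> : c *: a + b - (c *: w + x) = c *: (a - w) + (b - x).
    by rewrite scalerBr opprD addrACA.
  rewrite tDr h4 // addr0 -[c]conjCK -tdotZ.
  apply: (h2 (c^* *: S)); rewrite -(addr0 (_ *: S)).
  by apply: (star_subalgebraP sA) => //; exact: (star_subalgebra0 sA).
have [P hP] := choice exP.
have P0 : P 0 = 0.
  apply: (uniqP 0) => //; split; last by move=> S AS; rewrite subrr /tdot big1 // => i _; rewrite rdot0r.
  move=> d d0; exists 0; first exact: (star_subalgebra0 sA).
  by rewrite /tdot big1 // => i _; rewrite /= subr0 rdot0l.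
have PL c a b : P (c *: a + b) = c *: P a + P b by apply: (uniqP _ _ _ (hP _)); exact: linP.
have PD a b : P (a + b) = P a + P b by rewrite -{1}(scale1r a) PL scale1r.
have Pfix S : A S -> P (S \o u) = S \o u.
  move=> AS; apply: (uniqP _ _ _ (hP _)); split; last first.
    by move=> S' _; rewrite subrr /tdot big1 // => i _; rewrite rdot0r.
  move=> d d0; exists S => //.
  by rewrite subrr /tdot big1 // => i _; rewrite rdot0l.
have Pcomm S a : A S -> P (S \o a) = S \o P a.
  move=> AS; apply: (uniqP _ _ _ (hP _)); have [h1 h2] := hP a; split.
    move=> d d0; have /bounded_opP[lS [C C0 hC]] := bA S AS.
    have C1 : 0 < C + 1 by lra.
    have [S' AS' hS'] := h1 (d / (C + 1)) (divr_gt0 d0 C1).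
    exists (S \o S'); first exact: (star_subalgebraM sA).
    move: hS'; rewrite ltr_pdivlMr // => hS'.
    apply: le_lt_trans hS'; rewrite mulr_suml; apply: ler_sum => i _.
    rewrite -[leLHS]/(sqn (S (S' (u i)) - S (P a i))) -linB //.
    apply: le_trans (hC _) _; rewrite -[(_ - _) i]/(S' (u i) - P a i) -/(sqn _).
    have := sqnn_ge0 (S' (u i) - P a i); nra.
  move=> S' AS'.
  have -> : tdot (S' \o u) (S \o a - (S \o P a)) = tdot ((adjoint S \o S') \o u) (a - P a).
    apply: eq_bigr => i _; rewrite [in RHS]/= radjPl; last exact: bA.
    by rewrite -[(a - _) i]/(a i - P a i) linB //; exact: bounded_lin (bA S AS).
  apply: h2; apply: (star_subalgebraM sA) => //.
  exact: (star_subalgebra_adjoint sA).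
have Pbd a : tdot (P a) (P a) <= tdot a a.
  have [h1 h2] := hP a.
  have o : tdot (P a) (a - P a) = 0.
    apply/eqP; rewrite -normr_le0 leNgt; apply/negP => x0.
    have [d d0 hd] := tsm (a - P a) _ x0.
    have [S AS /hd] := h1 d d0.
    by rewrite tdotDl tN (h2 S AS) sub0r normrN ltxx.
  have := tdot_ge0 (a - P a); rewrite !tdotDl !tDr !tN !tNr (tdotC a (P a)).
  move: o; rewrite tDr tNr; lra.
pose at_ (j : 'I_n) (v : V) : 'I_n -> V := fun i => if i == j then v else 0.
have at_sum a : a = \sum_j at_ j (a j).
  apply: funext => i; rewrite fct_sumE (bigD1 i) //= /at_ eqxx big1 ?addr0 //.
  by move=> j ji; rewrite eq_sym (negbTE ji).
have atL j c v w : at_ j (c *: v + w) = c *: at_ j v + at_ j w.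
  apply: funext => i; rewrite -[RHS]/(c *: at_ j v i + at_ j w i) /at_.
  by case: ifP => // _; rewrite scaler0 addr0.
have Pij i j : commutant A (fun v => P (at_ j v) i).
  split.
    apply/bounded_opP; split; first by move=> c v w; rewrite atL PL.
    exists 1 => // v; rewrite mul1r; apply: le_trans (tdot_le _ _) _.
    apply: le_trans (Pbd _) _; rewrite /tdot (bigD1 j) //= big1 ?addr0 /at_ ?eqxx //.
    by move=> k kj; rewrite (negbTE kj) rdot0l.
  move=> s As v; rewrite -[LHS]/((s \o P (at_ j v)) i) -Pcomm //; congr (P _ i).
  apply: funext => k /=; rewrite /at_; case: ifP => // _.
  exact: lin0 (bounded_lin (bA s As)).
have Psum (F : 'I_n -> 'I_n -> V) : P (\sum_j F j) = \sum_j P (F j).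
  by apply: (big_morph P PD P0).
have lT := bounded_lin bT.
(* T commutes with every matrix entry of P, hence T applied coordinatewise commutes with P. *)
have PT a : P (T \o a) = T \o P a.
  apply: funext => i; rewrite /= {2}(at_sum a) Psum fct_sumE.
  rewrite (big_morph T (linD lT) (lin0 lT)) (at_sum (T \o a)) Psum fct_sumE.
  by apply: eq_bigr => j _; rewrite (hT _ (Pij i j)).
(* Without a unit in A this is not immediate; but S applied to P u is P (S \o u) = S \o u for all S
   in A, and nondegeneracy gives P u = u. Then T \o u = P (T \o u) lies in the closure. *)
have Pu : P u = u.
  apply: funext => i; apply/eqP; rewrite -subr_eq0; apply/eqP/nA => s As.
  rewrite linB; last exact: bounded_lin (bA s As).
  apply/eqP; rewrite subr_eq0; apply/eqP.
  by rewrite -[LHS]/((s \o P u) i) -Pcomm // Pfix.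
have [h1 _] := hP (T \o u).
pose M := \sum_(i < n) sqn (l`_i).2.
have M0 : 0 <= M by apply: sumr_ge0 => i _; exact: sqnn_ge0.
have d0 : 0 < e ^+ 2 / (2 * M + 1).
  by rewrite divr_gt0 ?exprn_gt0 //; lra.
have [S AS hS] := h1 _ d0; exists S => // uv uvl.
have il : (index uv l < n)%N by rewrite index_mem.
have ul : l`_(Ordinal il) = uv by rewrite /= nth_index.
apply: hdot_norm_lt => //.
have q1 : sqn (T uv.1 - S uv.1) < e ^+ 2 / (2 * M + 1).
  apply: le_lt_trans hS; rewrite PT Pu sqnB.
  by have := tdot_le (S \o u - (T \o u)) (Ordinal il); rewrite -[(_ - _) _]/(S (l`_(Ordinal il)).1 - T (l`_(Ordinal il)).1) ul.
have q2 : sqn uv.2 <= M.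
  rewrite -ul /M (bigD1 (Ordinal il)) //= lerDl.
  by apply: sumr_ge0 => j _; exact: sqnn_ge0.
move: q1; rewrite ltr_pdivlMr; last by lra.
move=> q1; apply: le_lt_trans q1; rewrite mulrCA.
have := sqnn_ge0 (T uv.1 - S uv.1); nra.
Qed.

End DoubleCommutant.

(** * Normal functionals and uniqueness of the trace *)

Section MonotoneLimits.
Context {R : realType} {V : hilbertType R}.
Implicit Types (u v w : V) (x y S T t : V -> V) (A D Z : set (V -> V)).

Definition rle S T := forall v, rdot (S v) v <= rdot (T v) v.

Definition rdirected D := forall x y, D x -> D y -> exists2 z, D z & rle x z /\ rle y z.

(** The directed set D serves as its own index set: this is strong convergence of the net of its
    elements. *)
Definition sot_limit D x := forall v e, 0 < e ->
  exists2 d0, D d0 & forall d, D d -> rle d0 d -> sqn (d v - x v) < e.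

Lemma rle_refl S : rle S S. Proof. by move=> v. Qed.

Lemma rle_trans S T x : rle S T -> rle T x -> rle S x.
Proof. by move=> h1 h2 v; exact: le_trans (h1 v) (h2 v). Qed.

Lemma pos_sub S T : bounded_op S -> bounded_op T -> symm S -> symm T ->
  rle S T -> pos_op (T - S).
Proof.
move=> bS bT sS sT h; have [lS lT] := (bounded_lin bS, bounded_lin bT).
by have /(_ h) := (le_opP lS lT sS sT).2.
Qed.

Lemma sub_app S T v : (S - T) v = S v - T v. Proof. by []. Qed.
Lemma add_app S T v : (S + T) v = S v + T v. Proof. by []. Qed.
Lemma scale_app (a : R[i]) S v : (a *: S) v = a *: S v. Proof. by []. Qed.

Lemma rle_antisym S T : bounded_op S -> bounded_op T -> symm S -> symm T ->
  rle S T -> rle T S -> S = T.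
Proof.
move=> bS bT sS sT h1 h2; apply/esym/eqP; rewrite -subr_eq0; apply/eqP.
apply: pos_eq0; [exact: bounded_sub|exact: pos_sub|].
by move=> v; rewrite rdotBl subr_le0.
Qed.

Lemma sot_seq D x (s : seq V) e : D !=set0 -> rdirected D -> sot_limit D x -> 0 < e ->
  exists2 d0, D d0 & forall d, D d -> rle d0 d -> forall u, u \in s -> sqn (d u - x u) < e.
Proof.
move=> [d1 Dd1] dirD lim e0; elim: s => [|u s [d Dd hd]]; first by exists d1.
have [d' Dd' hd'] := lim u e e0.
have [z Dz [h h']] := dirD _ _ Dd Dd'.
exists z => // y Dy zy v; rewrite inE => /predU1P[->|vs].
  by apply: hd' => //; exact: rle_trans zy.
by apply: hd => //; exact: rle_trans zy.
Qed.

Lemma sot_rdot D x v w e : D !=set0 -> rdirected D -> sot_limit D x -> 0 < e ->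
  exists2 d0, D d0 & forall d, D d -> rle d0 d -> `|rdot (d v) w - rdot (x v) w| < e.
Proof.
move=> D0 dirD lim e0; have [r r0 hr] := rdot_lt w e0.
have [d Dd hd] := lim v r r0; exists d => // y Dy dy.
by rewrite -rdotBl; apply: hr; exact: hd.
Qed.

Section Limit.
Variables (D : set (V -> V)) (C : R).
Hypotheses (D0 : D !=set0) (bD : forall d, D d -> bounded_op d)
  (pD : forall d, D d -> pos_op d) (dirD : rdirected D)
  (hC : forall d, D d -> forall v, rdot (d v) v <= C * sqn v).

Let sD d : D d -> symm d. Proof. by move=> Dd; apply: pos_symm; [exact: bD|exact: pD]. Qed.

(** The forms of a bounded increasing net converge, and [pos_sqn_le] for d' - d makes the vectors
    Cauchy: |(d' - d) v|^2 <= C <(d' - d) v, v>. *)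
Lemma monotone_limit : exists2 x, sot_limit D x &
  [/\ bounded_op x, pos_op x & forall d, D d -> rle d x].
Proof.
have C0 v : 0 <= C * sqn v.
  by have [d Dd] := D0; apply: le_trans (hC Dd v); apply: pos_ge0; [exact: bD|exact: pD].
have key v e : 0 < e -> exists2 d0, D d0 & forall d, D d -> rle d0 d -> sqn (d v - d0 v) < e.
  move=> e0; pose Q := [set rdot (d v) v | d in D].
  have hQ : has_sup Q.
    split; first by have [d Dd] := D0; exists (rdot (d v) v), d.
    by exists (C * sqn v) => _ [d Dd <-]; exact: hC.
  have [Cn|Cp] := leP C 0.
    have z d : D d -> d v = 0.
      move=> Dd; apply: sqn_eq0; apply/eqP; rewrite eq_le sqnn_ge0 andbT.
      apply: le_trans (pos_sqn_le (bD Dd) (pD Dd) v (hC Dd)) _.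
      by rewrite mulr_le0_ge0 // pos_ge0 //; [exact: bD|exact: pD].
    have [d Dd] := D0; exists d => // d' Dd' _; rewrite !z // subrr.
    by rewrite /sqn rdot0l.
  have e1 : 0 < e / C by rewrite divr_gt0.
  have [_ [d Dd <-] h] := sup_adherent e1 hQ; exists d => // d' Dd' dd'.
  have bdd : bounded_op (d' - d) by apply: bounded_sub; exact: bD.
  have pdd : pos_op (d' - d).
    by apply: pos_sub => //; [exact: bD|exact: bD|exact: sD|exact: sD].
  have := pos_sqn_le (C := C) bdd pdd v.
  rewrite sub_app => h'; apply: le_lt_trans (h' _) _.
    move=> w; rewrite sub_app rdotBl; have := hC Dd' w.
    by have := pos_ge0 (bD Dd) (pD Dd) w; lra.
  rewrite -ltr_pdivlMl // mulrC rdotBl.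
  have := sup_upper_bound hQ; move=> /(_ (rdot (d' v) v)) => /(_ ltac:(by exists d')).
  lra.
have /choice[x hx] : forall v, exists l, forall e, 0 < e ->
    exists2 d0, D d0 & forall d, D d -> rle d0 d -> sqn (d v - l) < e.
  move=> v.
  (* Passage from the net to a sequence: beyond d n the net moves v by less than 1 / (n + 1) in
     squared norm. The d n need not increase; two of them are compared through a common upper
     bound. *)
  have inv0 (n : nat) : 0 < n.+1%:R^-1 :> R by rewrite invr_gt0 ltr0n.
  have /choice[d hd] : forall n : nat, exists d, D d /\
      forall d', D d' -> rle d d' -> sqn (d' v - d v) < n.+1%:R^-1.
    by move=> n; have [d Dd hd] := key v _ (inv0 n); exists d.
  have small e : 0 < e -> exists N : nat, forall n, (N <= n)%N -> n.+1%:R^-1 < e :> R.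
    move=> e0; exists (Num.truncn e^-1) => n hn.
    have hN : e^-1 < n.+1%:R by apply: lt_le_trans (truncnS_gt _) _; rewrite ler_nat.
    by rewrite invf_plt ?posrE ?ltr0n // invr_gt0.
  have [|l hl] := hilbert_complete (u := fun n => d n v).
    move=> e e0; have [|N hN] := small (e / 4); first by lra.
    exists N => m n hm hn.
    have [z Dz [h1 h2]] := dirD (hd m).1 (hd n).1.
    have -> : d m v - d n v = (z v - d n v) - (z v - d m v).
      by rewrite opprB [RHS]addrC addrA subrK.
    apply: le_lt_trans (sqnD_le _ _) _; rewrite sqnN.
    have := (hd m).2 z Dz h1; have := (hd n).2 z Dz h2.
    have := hN _ hm; have := hN _ hn.
    by move: (m.+1%:R^-1) (n.+1%:R^-1) => a b; lra.
  exists l => e e0.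
  have [|N1 hN1] := small (e / 4); first by lra.
  have [|N2 hN2] := hl (e / 4); first by lra.
  pose n := maxn N1 N2; exists (d n); first exact: (hd n).1.
  move=> z Dz dz; have -> : z v - l = (z v - d n v) + (d n v - l) by rewrite addrA subrK.
  apply: le_lt_trans (sqnD_le _ _) _.
  have := (hd n).2 z Dz dz; have := hN1 n (leq_maxl _ _); have := hN2 n (leq_maxr _ _).
  by move: (n.+1%:R^-1) => a; lra.
have lim : sot_limit D x by move=> v e e0; exact: hx.
have bx : bounded_op x.
  apply/bounded_opP; split.
    move=> c u v; apply/eqP; rewrite -subr_eq0; apply/eqP/sqn_eq0/eqP.
    rewrite eq_le sqnn_ge0 andbT leNgt; apply/negP => q0.
    set q := sqn _ in q0; pose n := Re c ^+ 2 + Im c ^+ 2.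
    have n0 : 0 <= n by rewrite addr_ge0 ?sqr_ge0.
    have n1 : 0 < 4 * n + 8 by lra.
    have [d Dd hd] := sot_seq [:: c *: u + v; u; v] D0 dirD lim (divr_gt0 q0 n1).
    have h1 := hd d Dd (rle_refl d) (c *: u + v) ltac:(by rewrite !inE eqxx).
    have h2 := hd d Dd (rle_refl d) u ltac:(by rewrite !inE eqxx orbT).
    have h3 := hd d Dd (rle_refl d) v ltac:(by rewrite !inE eqxx !orbT).
    have ld := bounded_lin (bD Dd).
    have E : x (c *: u + v) - (c *: x u + x v) =
       (c *: (d u - x u) + (d v - x v)) - (d (c *: u + v) - x (c *: u + v)).
      by rewrite ld scalerBr opprB [RHS]addrC (addrACA (c *: d u)) -opprD addrA subrK.
    have := sqnD_le (c *: (d u - x u) + (d v - x v)) (- (d (c *: u + v) - x (c *: u + v))).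
    rewrite -E -/q sqnN.
    have := sqnD_le (c *: (d u - x u)) (d v - x v); rewrite sqnZ -/n.
    move: h1 h2 h3; rewrite !ltr_pdivlMr //.
    move: (sqn (d u - x u)) (sqnn_ge0 (d u - x u)) (sqn (d v - x v)) (sqnn_ge0 (d v - x v)).
    move=> a a0 b b0; move: (sqn (d _ - _)) (sqnn_ge0 (d (c *: u + v) - x (c *: u + v))).
    move=> f f0 h1 h2 h3 h4 h5.
    have := mulr_ge0 n0 b0; have := mulr_ge0 n0 f0; have := mulr_ge0 n0 a0.
    nra.
  exists (2 * C ^+ 2); first by rewrite mulr_ge0 ?sqr_ge0.
  move=> v; rewrite leNgt; apply/negP => lt.
  have [|d Dd hd] := lim v ((sqn (x v) - 2 * C ^+ 2 * sqn v) / 2); first by lra.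
  have := hd d Dd (rle_refl d); rewrite sqnB => h1.
  have := sqnD_le (x v - d v) (d v); rewrite subrK.
  have h2 := pos_sqn_le (bD Dd) (pD Dd) v (hC Dd).
  have h3 := hC Dd v; have h4 := C0 v.
  have [C0'|C0'] := leP 0 C.
    have := ler_wpM2l C0' h3; nra.
  have := pos_ge0 (bD Dd) (pD Dd) v; have := sqnn_ge0 v; have := sqnn_ge0 (d v); nra.
have lx := bounded_lin bx.
have up d : D d -> rle d x.
  move=> Dd v; rewrite leNgt; apply/negP => lt.
  have e0 : 0 < rdot (d v) v - rdot (x v) v by lra.
  have [d' Dd' hd'] := sot_rdot v v D0 dirD lim e0.
  have [z Dz [h1 h2]] := dirD Dd Dd'.
  have := hd' z Dz h2; have := h1 v; rewrite ltr_norml => ? /andP[_]; lra.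
exists x => //; split=> //.
apply/pos_opP => //; split.
  move=> u v; apply/eqP; rewrite -subr_eq0 -normr_le0 leNgt; apply/negP => e0.
  have e1 : 0 < `|rdot (x u) v - rdot u (x v)| / 2 by rewrite divr_gt0.
  have [d1 Dd1 hd1] := sot_rdot u v D0 dirD lim e1.
  have [d2 Dd2 hd2] := sot_rdot v u D0 dirD lim e1.
  have [z Dz [h1 h2]] := dirD Dd1 Dd2.
  have := hd1 z Dz h1; have := hd2 z Dz h2; rewrite (sD Dz u) (rdotC (z v)) (rdotC (x v)).
  have := ler_distD (rdot u (z v)) (rdot (x u) v) (rdot u (x v)).
  rewrite (distrC (rdot (x u) v) (rdot u (z v))); lra.
have [d Dd] := D0 => v; apply: le_trans (up d Dd v); apply: pos_ge0; [exact: bD|exact: pD].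
Qed.

End Limit.

Lemma sot_limit_mem A D x : wot_closed A -> D `<=` A -> D !=set0 -> rdirected D ->
  bounded_op x -> sot_limit D x -> A x.
Proof.
move=> cA DA D0 dirD bx lim; apply: cA => // s e e0.
pose M := \sum_(uv <- s) sqn uv.2.
have M0 : 0 <= M by apply: sumr_ge0 => i _; exact: sqnn_ge0.
have d0 : 0 < e ^+ 2 / (2 * M + 1) by rewrite divr_gt0 ?exprn_gt0 //; lra.
have [d Dd hd] := sot_seq [seq uv.1 | uv <- s] D0 dirD lim d0.
exists d; first exact: DA.
move=> uv uvs; apply: hdot_norm_lt => //; rewrite sqnB.
have := hd d Dd (rle_refl d) uv.1 (map_f _ uvs).
rewrite ltr_pdivlMr; last by lra.
move=> h; apply: le_lt_trans h.
have : sqn uv.2 <= M.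
  rewrite /M; elim: (s) uvs => // a l ih; rewrite inE big_cons => /predU1P[->|/ih h].
    by rewrite lerDl; apply: sumr_ge0 => i _; exact: sqnn_ge0.
  by apply: le_trans h _; rewrite lerDr sqnn_ge0.
have := sqnn_ge0 (d uv.1 - x uv.1); have := sqnn_ge0 uv.2; nra.
Qed.

End MonotoneLimits.

Section StarAlgebra.
Context {R : realType} {V : hilbertType R}.
Variables (A : set (V -> V)) (sA : star_subalgebra A).
Implicit Types (x y : V -> V) (a : R[i]).

Lemma star_bounded x : A x -> bounded_op x. Proof. exact: (star_subalgebra_bounded sA). Qed.
Lemma star_linear x : A x -> linear x. Proof. by move/star_bounded/bounded_lin. Qed.
Lemma star0 : A 0. Proof. exact: (star_subalgebra0 sA). Qed.
Lemma star_lincomb a x y : A x -> A y -> A (a *: x + y).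
Proof. exact: (star_subalgebraP sA). Qed.
Lemma star_add x y : A x -> A y -> A (x + y).
Proof. by move=> Ax Ay; rewrite -(scale1r x); exact: star_lincomb. Qed.
Lemma star_scale a x : A x -> A (a *: x).
Proof. by move=> Ax; rewrite -(addr0 (a *: x)); exact: star_lincomb star0. Qed.
Lemma star_opp x : A x -> A (- x).
Proof. by move=> Ax; rewrite -scaleN1r; exact: star_scale. Qed.
Lemma star_sub x y : A x -> A y -> A (x - y).
Proof. by move=> Ax Ay; apply: star_add => //; exact: star_opp. Qed.
Lemma star_comp x y : A x -> A y -> A (x \o y).
Proof. exact: (star_subalgebraM sA). Qed.
Lemma star_adj x : A x -> A (adjoint x).
Proof. exact: (star_subalgebra_adjoint sA). Qed.

Lemma commutant_adj t : commutant A t -> commutant A (adjoint t).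
Proof.
move=> [bt ct]; split; first exact: bounded_adj.
move=> s As v; have bs := star_bounded As; apply: hdot_inj => w.
rewrite adjP // adjPl // -ct; last exact: star_adj.
by rewrite -adjP // adjPl.
Qed.
End StarAlgebra.

Section PositiveOps.
Context {R : realType} {V : hilbertType R}.
Implicit Types (x y b c : V -> V).

Lemma pos_scale (r : R) x : 0 <= r -> pos_op x -> pos_op (r%:C%C *: x).
Proof. by move=> r0 px v; rewrite /= hdotZl mulr_ge0 // ler0c. Qed.

Lemma pos_add x y : pos_op x -> pos_op y -> pos_op (x + y).
Proof. by move=> px py v; rewrite /= hdotDl addr_ge0. Qed.

Lemma pos_conj b x : bounded_op b -> pos_op x -> pos_op (adjoint b \o x \o b).
Proof. by move=> bb px v; rewrite /= adjPl. Qed.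

Lemma pos_id : pos_op (idfun : V -> V).
Proof. by move=> v; rewrite hdot_sqn ler0c sqnn_ge0. Qed.

Lemma pos0 : pos_op (0 : V -> V). Proof. by move=> v; rewrite hdot0l. Qed.

Lemma square_eq0 b : bounded_op b -> adjoint b \o b = 0 -> b = 0.
Proof.
move=> bb h; apply: funext => v; apply: sqn_eq0.
rewrite /sqn -radjPl //.
by have /(congr1 (fun f => f v)) /= -> := h; rewrite rdot0l.
Qed.
End PositiveOps.

Section VNA.
Context {R : realType} {V : hilbertType R}.
Variables (A : set (V -> V)) (vA : von_neumann_algebra A).
Implicit Types (u v w : V) (x y b c g S T t : V -> V) (D Z : set (V -> V)) (F : (V -> V) -> R).
Let sA := vna_star vA.
Let bA := star_bounded sA.
Let lA := star_linear sA.

Definition posA x : Prop := A x /\ pos_op x.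

Lemma posA_symm x : posA x -> symm x.
Proof. by case=> Ax px; apply: pos_symm => //; exact: bA. Qed.

Lemma vna_nondegenerate : nondegenerate A.
Proof. by move=> v h; rewrite -(h idfun) //; exact: (vna_unital vA). Qed.

Lemma posA_antisym x y : posA x -> posA y -> rle x y -> rle y x -> x = y.
Proof.
move=> px py; apply: rle_antisym; [exact: bA px.1|exact: bA py.1|exact: posA_symm|exact: posA_symm].
Qed.

Lemma posA_sub x y : posA x -> posA y -> rle x y -> posA (y - x).
Proof.
move=> px py h; split; first by apply: (star_sub sA); [exact: py.1|exact: px.1].
apply: pos_sub h; [exact: bA px.1|exact: bA py.1|exact: posA_symm|exact: posA_symm].
Qed.

(** By Zorn: a chain in Z is directed and bounded by C, so it converges strongly to an upper bound
    in A. Closure of Z under such limits is all that remains to be checked in each use. *)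
Lemma vna_maximal Z (C : R) : Z !=set0 -> Z `<=` posA ->
  (forall z, Z z -> forall v, rdot (z v) v <= C * sqn v) ->
  (forall D x, D !=set0 -> D `<=` Z -> rdirected D -> posA x ->
     (forall d, D d -> rle d x) -> sot_limit D x -> Z x) ->
  exists2 m, Z m & forall z, Z z -> rle m z -> z = m.
Proof.
move=> [z0 Zz0] ZA ZC Zlim.
pose T := {x : V -> V | Z x}.
pose r (x y : T) : bool := `[< rle (sval x) (sval y) >].
have [|x y z /asboolP h1 /asboolP h2|x y /asboolP h1 /asboolP h2|B tB|[m Zm] hm] := @Zorn T r.
- by move=> x; apply/asboolP; exact: rle_refl.
- by apply/asboolP; exact: rle_trans h2.
- case: x y h1 h2 => [x Zx] [y Zy] /= h1 h2.
  have E : x = y by apply: posA_antisym => //; exact: ZA.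
  by subst y; congr exist; exact: Prop_irrelevance.
- have [B0|Bn] := pselect (B = set0).
    by exists (exist _ z0 Zz0) => s; rewrite B0.
  have [b0 Bb0] : B !=set0 by apply/set0P/eqP.
  pose D := [set sval b | b in B].
  have D0 : D !=set0 by exists (sval b0), b0.
  have DZ : D `<=` Z by move=> _ [[x Zx] _ <-].
  have dirD : rdirected D.
    move=> _ _ [x Bx <-] [y By <-].
    have [/asboolP h|/asboolP h] := tB x y Bx By.
      by exists (sval y); [exists y|split=> //; exact: rle_refl].
    by exists (sval x); [exists x|split=> //; exact: rle_refl].
  have [x lim [bx px ub]] := monotone_limit D0 (fun d Dd => bA (ZA _ (DZ d Dd)).1)
    (fun d Dd => (ZA _ (DZ d Dd)).2) dirD (fun d Dd => ZC _ (DZ d Dd)).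
  have Ax : A x.
    by apply: sot_limit_mem D0 dirD bx lim; [exact: (vna_closed vA)|move=> d /DZ/ZA[]].
  have Zx : Z x by exact: Zlim lim.
  by exists (exist _ x Zx) => s Bs; apply/asboolP => /=; apply: ub; exists s.
exists m => // z Zz mz.
by have /(congr1 sval) := hm (exist _ z Zz) ltac:(by apply/asboolP).
Qed.

(** Normality is asked along strong limits, which makes it immediate for vector functionals;
    [trace_functional] derives it for traces from least upper bounds. One inequality is enough, the
    other being monotonicity. *)
Record normal_functional F : Prop := {
  nf_add : forall x y, A x -> A y -> F (x + y) = F x + F y;
  nf_scale : forall (r : R) x, A x -> F (r%:C%C *: x) = r * F x;
  nf_ge0 : forall x, posA x -> 0 <= F x;
  nf_sup : forall D x, D !=set0 -> D `<=` posA -> rdirected D -> posA x ->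
    (forall d, D d -> rle d x) -> sot_limit D x ->
    forall e, 0 < e -> exists2 d, D d & F x - e < F d
}.

Section NF.
Variables (F : (V -> V) -> R) (nF : normal_functional F).
Lemma nf0 : F 0 = 0.
Proof.
by have := nf_scale nF 0 (star0 sA); rewrite scaler0 mul0r.
Qed.
Lemma nf_sub x y : A x -> A y -> F (x - y) = F x - F y.
Proof.
move=> Ax Ay; rewrite (nf_add nF) //; last exact: star_opp.
by congr (_ + _); have := nf_scale nF (-1) Ay; rewrite mulN1r rmorphN rmorph1 scaleN1r.
Qed.
Lemma nf_mono x y : posA x -> posA y -> rle x y -> F x <= F y.
Proof.
move=> px py h; rewrite -subr_ge0 -nf_sub; [|exact: py.1|exact: px.1].
by apply: (nf_ge0 nF); exact: posA_sub.
Qed.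
End NF.

Lemma vector_functional v : normal_functional (fun x => rdot (x v) v).
Proof.
split.
- by move=> x y Ax Ay; rewrite rdotDl.
- by move=> r x Ax; rewrite rdotZl.
- by move=> x [Ax px]; apply: pos_ge0 => //; exact: bA.
- move=> D x D0 DA dirD px ub lim e e0.
  have [d Dd hd] := sot_rdot v v D0 dirD lim e0.
  exists d => //; have := hd d Dd (rle_refl d); rewrite ltr_norml => /andP[]; lra.
Qed.

Lemma nf_sup_le F G x D : normal_functional F -> normal_functional G ->
  D !=set0 -> D `<=` posA -> rdirected D -> posA x ->
  (forall d, D d -> rle d x) -> sot_limit D x ->
  (forall d, D d -> F d <= G d) -> F x <= G x.
Proof.
move=> nF nG D0 DA dirD px ub lim h; rewrite leNgt; apply/negP => lt.
have [|d Dd hd] := nf_sup nF D0 DA dirD px ub lim (e := F x - G x); first by lra.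
have := h d Dd; have := nf_mono nG (DA _ Dd) px (ub d Dd); lra.
Qed.

Lemma posA_id : posA idfun. Proof. by split; [exact: (vna_unital vA)|exact: pos_id]. Qed.
Lemma posA_add x y : posA x -> posA y -> posA (x + y).
Proof. by move=> [Ax px] [Ay py]; split; [exact: star_add|exact: pos_add]. Qed.
Lemma posA_scale (r : R) x : 0 <= r -> posA x -> posA (r%:C%C *: x).
Proof. by move=> r0 [Ax px]; split; [exact: star_scale|exact: pos_scale]. Qed.
Lemma posA_conj b x : A b -> posA x -> posA (adjoint b \o x \o b).
Proof.
move=> Ab [Ax px]; split; last by apply: pos_conj => //; exact: bA.
by apply: star_comp => //; apply: star_comp => //; exact: star_adj.
Qed.
Lemma posA_square b : A b -> posA (adjoint b \o b).
Proof. by move=> Ab; exact: (posA_conj Ab posA_id). Qed.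

Lemma posA_adj c : posA c -> adjoint c = c.
Proof. by case=> Ac pc; apply: pos_adj => //; exact: bA. Qed.

(* [c] is the gap between [1] and a maximal [a <= 1] with [F2 a <= F1 a]. *)
Lemma functional_compare F1 F2 : normal_functional F1 -> normal_functional F2 ->
  F1 idfun < F2 idfun ->
  exists c, [/\ posA c, c <> 0 & forall y, posA y -> F1 (c \o y \o c) <= F2 (c \o y \o c)].
Proof.
move=> n1 n2 lt.
pose Z := [set a | [/\ posA a, rle a idfun & F2 a <= F1 a]].
have [||||a [pa a1 ha] amax] := vna_maximal (Z := Z) (C := 1).
- exists 0; split; first by split; [exact: star0|exact: pos0].
    by move=> v; rewrite rdot0l sqn_ge0.
  by rewrite (nf0 n1) (nf0 n2).
- by move=> z [].
- by move=> z [_ h _] v; rewrite mul1r; exact: h.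
- move=> D x D0 DZ dirD px ub lim; have DA : D `<=` posA by move=> d /DZ[].
  split=> //.
    move=> v; rewrite leNgt; apply/negP => lt'.
    have [|d Dd hd] := nf_sup (vector_functional v) D0 DA dirD px ub lim
       (e := rdot (x v) v - rdot v v); first by lra.
    by have [_ /(_ v) h _] := DZ d Dd; lra.
  apply: (nf_sup_le n2 n1 D0 DA dirD px ub lim).
  by move=> d /DZ[].
pose c := idfun - a.
have pc : posA c by exact: posA_sub pa posA_id a1.
have c1 : rle c idfun.
  by move=> v; rewrite /c sub_app rdotBl gerBl; apply: pos_ge0 pa.2 _; exact: bA pa.1.
exists c; split=> //.
  by move=> c0; move: lt; rewrite (_ : idfun = a) ?ltNge ?ha //; apply/eqP; rewrite -subr_eq0 -/c c0.
move=> y py; rewrite leNgt; apply/negP => lt'.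
have pcyc : posA (c \o y \o c).
  by have := posA_conj pc.1 py; rewrite (posA_adj pc).
(* Since y <= C, the operator C^-1 c y c lies below c^2 <= c = 1 - a, so it can be added to a. *)
have [C C0 hC] := bounded_form (bA py.1).
have r0 : 0 < C^-1 by rewrite invr_gt0.
have pz : posA ((C^-1)%:C%C *: (c \o y \o c)) by apply: posA_scale => //; exact: ltW.
have : a + (C^-1)%:C%C *: (c \o y \o c) = a.
  apply: amax.
    split; first exact: posA_add.
      move=> v; rewrite add_app rdotDl scale_app rdotZl /=.
      have h1 : C^-1 * rdot (c (y (c v))) v <= rdot (c v) v.
        rewrite (posA_symm pc) ler_pdivrMl //; apply: le_trans (hC _) _.
        rewrite ler_pM2l //.
        have := pos_sqn_le (bA pc.1) pc.2 v (C := 1); rewrite mul1r; apply.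
        by move=> w; rewrite mul1r; exact: c1.
      have cE : rdot (c v) v = rdot v v - rdot (a v) v by rewrite /c sub_app rdotBl.
      by move: h1; rewrite cE; lra.
    rewrite (nf_add n1) ?(nf_add n2) ?(nf_scale n1) ?(nf_scale n2) //;
      try exact: pcyc.1; try exact: pz.1; try exact: pa.1.
    by apply: lerD => //; rewrite ler_pM2l // ltW.
  by move=> v; rewrite add_app rdotDl lerDl; apply: pos_ge0 pz.2 _; exact: bA pz.1.
move=> /eqP; rewrite -subr_eq0 addrC addKr => /eqP z0.
have E (F : (V -> V) -> R) : normal_functional F -> F (c \o y \o c) = 0.
  move=> nF; have := nf_scale nF C^-1 pcyc.1; rewrite z0 (nf0 nF) => /esym/eqP.
  by rewrite mulf_eq0 gt_eqF //= => /eqP.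
by move: lt'; rewrite !E // ltxx.
Qed.

Lemma ker_closure T (H : set V) v : bounded_op T -> (forall h, H h -> T h = 0) ->
  closure H v -> T v = 0.
Proof.
move=> bT HT cv; have := closure_image (H' := [set 0]) bT HT cv.
move=> /closureE h; apply: sqn_eq0; apply/eqP; rewrite eq_le sqnn_ge0 andbT leNgt.
by apply/negP => /h[_ /= ->]; rewrite subr0 ltxx.
Qed.

(** The commutant is closed under adjoints, so invariance of H makes p commute with it. *)
Lemma proj_in_vna (H : set V) p : subspace H -> proj_on H p ->
  (forall t, commutant A t -> forall v, H v -> H (t v)) -> A p.
Proof.
move=> sH pH inv; apply: double_commutant => //.
- exact: (vna_closed vA).
- exact: vna_nondegenerate.
- exact: proj_bounded pH.
move=> t ct v; apply: (proj_commute sH pH ct.1).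
  by move=> h; exact: inv.
by move=> h; apply: inv; exact: commutant_adj.
Qed.

(** The vectors v with c m v = 0 for all m in A form a closed subspace invariant under A and under
    its commutant, so its projection p is central, hence a scalar a. If a = 1 then c = 0. Otherwise,
    if c b g = 0 for every b, the range of g lies in the subspace, so g = p g = a g and g = 0. *)
Lemma factor_prime c g : is_factor A -> A c -> A g -> c <> 0 -> g <> 0 ->
  exists2 b, A b & c \o b \o g <> 0.
Proof.
move=> [_ fA] Ac Ag c0 g0; apply: contrapT => no; apply: g0.
have z b : A b -> c \o b \o g = 0.
  by move=> Au; apply: contrapT => h; apply: no; exists b.
pose H := [set v : V | forall m, A m -> c (m v) = 0].
have sH : subspace H.
  split; first by move=> m Am; rewrite lin0 ?lin0 //; exact: lA.
  move=> a u v Hu Hv m Am; rewrite lA // lA // Hu // Hv // addr0 scaler0 //.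
have [p pH] := proj_exists sH.
have Hp v : H (p v).
  move=> m Am; have bcm : bounded_op (c \o m) by apply: bounded_comp; exact: bA.
  by apply: (ker_closure bcm _ (@proj_mem _ _ _ _ pH v)) => h Hh /=; exact: Hh.
have Ap : A p.
  apply: proj_in_vna sH pH _ => t [bt ct] v Hv m Am.
  by rewrite ct // ct // Hv // lin0 //; exact: bounded_lin.
have [y Ay|a pa] := fA p Ap.
  apply: funext => v /=; apply: (proj_commute sH pH) => //; first exact: bA.
    by move=> h Hh m Am; apply: (Hh (m \o y)); exact: star_comp.
  by move=> h Hh m Am; apply: (Hh (m \o adjoint y)); apply: star_comp => //; exact: star_adj.
have pg v : p (g v) = g v.
  apply: (proj_fix sH pH); apply: subset_closure => m Am.
  by have /(congr1 (fun f => f v)) := z m Am.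
apply: funext => v; have [a1|a1] := eqVneq a 1.
  exfalso; apply: c0; apply: funext => w.
  by have := Hp w idfun (vna_unital vA); rewrite pa a1 scale1r.
have := pg v; rewrite pa -[LHS]/(a *: g v) => /eqP.
by rewrite -subr_eq0 -{2}(scale1r (g v)) -scalerBl scaler_eq0 subr_eq0 (negbTE a1) => /eqP.
Qed.

Definition tracial F := forall x y, A x -> A y -> F (x \o y) = F (y \o x).

(* If [g = y - z <> 0] for a maximal [z <= y] with [F1 z <= F2 z], then [b = c u g <> 0]
   for some [u], and a multiple of [b^* b] could be added to [z]. *)
Lemma functional_spread F1 F2 c : is_factor A ->
  normal_functional F1 -> normal_functional F2 -> tracial F1 -> tracial F2 ->
  posA c -> c <> 0 -> (forall y, posA y -> F1 (c \o y \o c) <= F2 (c \o y \o c)) ->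
  forall y, posA y -> F1 y <= F2 y.
Proof.
move=> fA n1 n2 t1 t2 pc c0 hc y py.
have [Cy Cy0 hCy] := bounded_form (bA py.1).
pose Z := [set z | [/\ posA z, rle z y & F1 z <= F2 z]].
have [||||z [pz zy hz] zmax] := vna_maximal (Z := Z) (C := Cy).
- exists 0; split; first by split; [exact: star0|exact: pos0].
    by move=> v; rewrite rdot0l; apply: pos_ge0 py.2 _; exact: bA py.1.
  by rewrite (nf0 n1) (nf0 n2).
- by move=> z [].
- by move=> z [_ h _] v; apply: le_trans (h v) _.
- move=> D x D0 DZ dirD px ub lim; have DA : D `<=` posA by move=> d /DZ[].
  split=> //.
    move=> v; rewrite leNgt; apply/negP => lt'.
    have [|d Dd hd] := nf_sup (vector_functional v) D0 DA dirD px ub lim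
       (e := rdot (x v) v - rdot (y v) v); first by rewrite subr_gt0.
    by have [_ /(_ v) h _] := DZ d Dd; move: hd; rewrite subKr => /(le_lt_trans h); rewrite ltxx.
  apply: (nf_sup_le n1 n2 D0 DA dirD px ub lim).
  by move=> d /DZ[].
suff -> : y = z by [].
apply/eqP; rewrite -subr_eq0; apply/eqP; set g := y - z; apply: contrapT => g0.
have pg : posA g by exact: posA_sub.
have [u Au cug] := factor_prime fA pc.1 pg.1 c0 g0.
pose b := c \o u \o g.
have Ab : A b by apply: star_comp pg.1; [|apply: star_comp pc.1 Au].
pose h := adjoint b \o b.
have ph : posA h by exact: posA_square.
(* The trace property replaces b^* b by b b^* = c y0 c with y0 = u g g u^*, to which the hypothesis
   on c applies. *)
have Fh : F1 h <= F2 h.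
  have [bu bc bg] : [/\ bounded_op u, bounded_op c & bounded_op g].
    by split; apply: bA => //; [exact: pc.1|exact: pg.1].
  rewrite /h (t1 _ _ (star_adj sA Ab) Ab) (t2 _ _ (star_adj sA Ab) Ab).
  have bE : adjoint b = g \o (adjoint u \o c).
    rewrite /b adj_comp //; last exact: bounded_comp.
    by rewrite adj_comp // (posA_adj pc) (posA_adj pg).
  pose y0 := u \o g \o (g \o adjoint u).
  have -> : b \o adjoint b = c \o y0 \o c by rewrite bE.
  apply: hc; split.
    apply: star_comp => //; apply: star_comp => //; [exact: pg.1|exact: pg.1|exact: star_adj].
  move=> v; rewrite /y0 /= adjP // adjP // (posA_adj pg) hdot_sqn ler0c.
  exact: sqnn_ge0.
(* As |c u g v|^2 <= K |g v|^2 <= K G <g v, v>, a multiple of h fits below g = y - z. *)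
have [C C0 hC] : exists2 C, 0 < C & forall v, rdot (h v) v <= C * rdot (g v) v.
  have /bounded_opP[_ [K K0 hK]] := bA (star_comp sA pc.1 Au).
  have [G G0 hG] := bounded_form (bA pg.1).
  exists ((K + 1) * G); first by rewrite mulr_gt0 //; lra.
  move=> v; rewrite /h /= radjPl; last exact: bA.
  have h1 := hK (g v); have h2 := pos_sqn_le (bA pg.1) pg.2 v hG.
  have h3 := sqnn_ge0 (g v); apply: le_trans h1 _; rewrite -mulrA.
  by apply: ler_pM => //; lra.
have r0 : 0 < C^-1 by rewrite invr_gt0.
have prh : posA ((C^-1)%:C%C *: h) by apply: posA_scale => //; exact: ltW.
have : z + (C^-1)%:C%C *: h = z.
  apply: zmax.
    split; first exact: posA_add.
      move=> v; rewrite add_app rdotDl scale_app rdotZl /=.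
      have : C^-1 * rdot (h v) v <= rdot (g v) v by rewrite ler_pdivrMl.
      have gE : rdot (g v) v = rdot (y v) v - rdot (z v) v by rewrite /g sub_app rdotBl.
      by rewrite gE; lra.
    rewrite (nf_add n1) ?(nf_add n2) ?(nf_scale n1) ?(nf_scale n2) //;
      try exact: ph.1; try exact: prh.1; try exact: pz.1.
    by apply: lerD => //; rewrite ler_pM2l // ltW.
  by move=> v; rewrite add_app rdotDl lerDl; apply: pos_ge0 prh.2 _; exact: bA prh.1.
move=> /eqP; rewrite -subr_eq0 addrC addKr scaler_eq0 => /orP[|/eqP h0].
  by rewrite -(rmorph0 (real_complex R)) => /eqP/complexI/eqP; rewrite gt_eqF.
by apply: cug; apply: square_eq0 h0; exact: bA.
Qed.

Theorem trace_compare F1 F2 : is_factor A ->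
  normal_functional F1 -> normal_functional F2 -> tracial F1 -> tracial F2 ->
  F1 idfun < F2 idfun -> forall y, posA y -> F1 y <= F2 y.
Proof.
move=> fA n1 n2 t1 t2 lt; have [c [pc c0 hc]] := functional_compare n1 n2 lt.
exact: functional_spread hc.
Qed.

End VNA.

Section Traces.
Context {R : realType} {V : hilbertType R}.
Variables (A : set (V -> V)) (vA : von_neumann_algebra A).
Implicit Types (u v w : V) (x y b c g S T t : V -> V) (D Z : set (V -> V)) (F : (V -> V) -> R).
Let sA := vna_star vA.

(** The strong limit of an increasing net is its least upper bound in A, so [trace_normal] applies.
    An upper bound y for [le_op] is symmetric, because y - d is positive and d symmetric, so it can
    be compared with x through forms. *)
Lemma trace_functional tau : finite_trace A tau ->
  normal_functional A (fun x => Re (tau x)).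
Proof.
move=> ft.
have t0 : tau 0 = 0.
  by have := trace_linear ft (-1) (star0 sA) (star0 sA); rewrite scaler0 addr0 mulN1r addNr.
have tD x y : A x -> A y -> tau (x + y) = tau x + tau y.
  by move=> Ax Ay; have := trace_linear ft 1 Ax Ay; rewrite scale1r mul1r.
have tZ a x : A x -> tau (a *: x) = a * tau x.
  by move=> Ax; have := trace_linear ft a Ax (star0 sA); rewrite t0 !addr0.
split.
- by move=> x y Ax Ay; rewrite tD // ReD.
- by move=> r x Ax; rewrite tZ // ReZ.
- by move=> x [Ax px]; have := trace_ge0 ft Ax px; rewrite lecE => /andP[].
move=> D x D0 DA dirD px ub lim e e0.
have le d d' : posA A d -> posA A d' -> rle d d' -> le_op d d'.
  by move=> pd pd' h; have [] := posA_sub vA pd pd' h.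
have Dup d : D d -> Re (tau d) <= Re (tau x).
  move=> Dd; have [Axd pxd] := posA_sub vA (DA d Dd) px (ub d Dd).
  have := trace_ge0 ft Axd pxd; rewrite lecE => /andP[_].
  have -> : tau x = tau (x - d) + tau d by rewrite -tD ?subrK //; exact: (DA d Dd).1.
  by rewrite ReD lerDr.
have -> : Re (tau x) = sup [set Re (tau d) | d in D].
  apply: (trace_normal ft D0).
  - by move=> d /DA[].
  - by move=> d /DA[].
  - move=> a b Da Db; have [z Dz [az bz]] := dirD a b Da Db.
    by exists z => //; split; apply: le => //; exact: DA.
  - split; first exact: px.1.
      by move=> d Dd; apply: le => //; [exact: DA|exact: ub].
    move=> y Ay hy; have [d Dd] := D0.
    have bd := star_bounded sA (DA d Dd).1; have bY := star_bounded sA Ay.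
    have sy : symm y.
      have syd : symm (y - d) by apply: pos_symm (hy d Dd); exact: bounded_sub.
      have sd := posA_symm vA (DA d Dd).
      move=> u v; have := syd u v; rewrite !sub_app rdotBl rdotBr sd; lra.
    have bx := star_bounded sA px.1.
    apply: pos_sub => //; first exact: (posA_symm vA px).
    move=> v; rewrite leNgt; apply/negP => lt.
    have [|z Dz hz] := sot_rdot v v D0 dirD lim (e := rdot (x v) v - rdot (y v) v).
      by rewrite subr_gt0.
    have bz := star_bounded sA (DA z Dz).1.
    have := hz z Dz (rle_refl z); have := pos_ge0 (bounded_sub bY bz) (hy z Dz) v.
    rewrite sub_app rdotBl ltr_norml => h /andP[h1 _]; move: lt h h1.
    move: (rdot _ _) (rdot _ _) (rdot _ _) => p q r; lra.
have hs : has_sup [set Re (tau d) | d in D].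
  split; first by have [d Dd] := D0; exists (Re (tau d)), d.
  by exists (Re (tau x)) => _ [d Dd <-]; exact: Dup.
by have [_ [d Dd <-] h] := sup_adherent e0 hs; exists d.
Qed.

Lemma normal_functional_scale F (r : R) : 0 < r -> normal_functional A F ->
  normal_functional A (fun x => r * F x).
Proof.
move=> r0 nF; split.
- by move=> x y Ax Ay; rewrite (nf_add nF) // mulrDr.
- by move=> s x Ax; rewrite (nf_scale nF) // mulrCA.
- by move=> x px; rewrite mulr_ge0 ?(ltW r0) //; exact: (nf_ge0 nF).
- move=> D x D0 DA dirD px ub lim e e0.
  have e1 : 0 < e / r by rewrite divr_gt0.
  have [d Dd h] := nf_sup nF D0 DA dirD px ub lim e1; exists d => //.
  by move: h; rewrite -(ltr_pM2l r0) mulrBr mulrCA divff ?gt_eqF // mulr1.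
Qed.

(** Any factor s + e with e > 0 satisfies the strict inequality at 1 that [trace_compare] asks for,
    so F1 <= (s + e) F2; this also covers s = 0. The resulting F1 <= s F2, applied to C - x, gives
    the reverse inequality. *)
Lemma trace_unique F1 F2 (s : R) : is_factor A ->
  normal_functional A F1 -> normal_functional A F2 -> tracial A F1 -> tracial A F2 ->
  0 < F2 idfun -> 0 <= s -> F1 idfun = s * F2 idfun ->
  forall y, posA A y -> F1 y = s * F2 y.
Proof.
move=> fA n1 n2 t1 t2 F0 s0 s1.
have le x : posA A x -> F1 x <= s * F2 x.
  move=> px; have x0 := nf_ge0 n2 px; rewrite leNgt; apply/negP => lt.
  have T1 : 0 < F2 x + 1 by lra.
  (* e (F2 x + 1) is half of the gap, so (s + e) F2 x stays below F1 x. *)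
  pose e := (F1 x - s * F2 x) / (F2 x + 1) / 2.
  have e0 : 0 < e by rewrite !divr_gt0 // subr_gt0.
  have se : 0 < s + e by lra.
  have lt1 : F1 idfun < (s + e) * F2 idfun by rewrite s1 ltr_pM2r // ltrDl.
  have t2' : tracial A (fun x => (s + e) * F2 x).
    by move=> a b Aa Ab; congr (_ * _); exact: t2.
  have := trace_compare vA fA n1 (normal_functional_scale se n2) t1 t2' lt1 px.
  have : e * (F2 x + 1) * 2 = F1 x - s * F2 x by rewrite /e; field; rewrite gt_eqF.
  by clearbody e; move: (F1 x) (F2 x) lt x0 => a t lt t0; nra.
move=> x px; apply/eqP; rewrite eq_le le //=.
have A1 := vna_unital vA.
have [C C0 hC] := bounded_form (star_bounded sA px.1).
have pC : posA A (C%:C%C *: idfun) by apply: posA_scale (ltW C0) (posA_id vA).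
have pCx : posA A (C%:C%C *: idfun - x).
  by apply: posA_sub => // v; rewrite scale_app rdotZl; exact: hC.
have := le _ pCx; rewrite (nf_sub vA n1 pC.1 px.1) (nf_sub vA n2 pC.1 px.1).
rewrite (nf_scale n1 C A1) (nf_scale n2 C A1) s1.
by move: (F1 x) (F2 x) (F2 idfun) => a t i; lra.
Qed.

Lemma form_sot_limit D x : D `<=` posA A -> posA A x -> (forall d, D d -> rle d x) ->
  (forall v e, 0 < e -> exists2 d, D d & rdot (x v) v - e < rdot (d v) v) ->
  sot_limit D x.
Proof.
move=> DA px ub h v e e0.
have [C C0 hC] := bounded_form (star_bounded sA px.1).
have [d Dd hd] := h v (e / C) (divr_gt0 e0 C0).
exists d => // z Dz dz; rewrite sqnB.
have [Axz pxz] := posA_sub vA (DA z Dz) px (ub z Dz).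
have := pos_sqn_le (C := C) (star_bounded sA Axz) pxz v.
rewrite sub_app => h'; apply: le_lt_trans (h' _) _.
  move=> w; rewrite sub_app rdotBl.
  have := pos_ge0 (star_bounded sA (DA z Dz).1) (DA z Dz).2 w; have := hC w.
  by move: (rdot _ _) (rdot _ _) (sqn _) => p q r; lra.
rewrite -ltr_pdivlMl // mulrC rdotBl; have := dz v; move: hd.
by move: (rdot _ _) (rdot _ _) (rdot _ _) (e / C) => p q r s; lra.
Qed.

(** A symmetric y is (y + C) - C with both terms positive, so G y = 0. For general x apply this to x
    + x^* and i x - i x^*, and solve for G x. *)
Lemma linear_posA_eq0 (G : (V -> V) -> R[i]) :
  (forall a x y, A x -> A y -> G (a *: x + y) = a * G x + G y) ->
  (forall x, posA A x -> G x = 0) -> forall x, A x -> G x = 0.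
Proof.
move=> GP G0 x Ax.
have A1 := vna_unital vA.
have Gs y : A y -> symm y -> G y = 0.
  move=> Ay sy; have bY := star_bounded sA Ay.
  have [C C0 hC] := bounded_form (bounded_opp bY).
  have pC : posA A (C%:C%C *: idfun) by apply: posA_scale (ltW C0) (posA_id vA).
  have : posA A (1 *: y + C%:C%C *: idfun).
    split; first by apply: star_lincomb => //; exact: pC.1.
    apply/pos_opP; first by apply: star_linear sA _ _; apply: star_lincomb => //; exact: pC.1.
    rewrite scale1r; split=> [u v|v].
      by rewrite !add_app !scale_app rdotDl rdotDr sy rdotZl rdotZr.
    rewrite add_app scale_app rdotDl rdotZl; have := hC v.
    by rewrite rdotNl -/(sqn v); move: (rdot _ _) (C * _) => p q; lra.
  by move/G0; rewrite GP //; [rewrite (G0 _ pC) addr0 mul1r|exact: pC.1].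
have G00 : G 0 = 0 by apply: G0; split; [exact: star0|exact: pos0].
have GZ (z : R[i]) y : A y -> G (z *: y) = z * G y.
  by move=> Ay; have := GP z y 0 Ay (star0 sA); rewrite G00 !addr0.
have Gadj y : A y -> G y + G (adjoint y) = 0.
  move=> Ay; have bY := star_bounded sA Ay; have Ay' := star_adj sA Ay.
  rewrite -[G y]mul1r -GP //; apply: Gs; first exact: star_lincomb.
  by move=> u v; rewrite scale1r !add_app rdotDl rdotDr radjP // radjPl // addrC.
have h1 := Gadj x Ax; have := Gadj ('i%C *: x) (star_scale sA _ Ax).
rewrite adj_scale; last exact: (star_bounded sA Ax).
rewrite !GZ //; last exact: (star_adj sA Ax).
rewrite -(addr0_eq h1) => /eqP.
have -> : 'i%C * G x + ('i%C)^* * - G x = (2 * 'i%C) * G x.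
  rewrite (_ : ('i%C)^* = - 'i%C); last by rewrite conjCE; apply/eqP; rewrite eq_complex /= oppr0 !eqxx.
  by rewrite mulrNN -mulrA mulr_natl mulr2n.
by rewrite !mulf_eq0 pnatr_eq0 eq_complex /= oner_eq0 andbF => /eqP.
Qed.

End Traces.

(** * The standard form *)

Section StandardForm.
Context {R : realType} {K L : hilbertType R}.
Variables (M : set (K -> K)) (tau : (K -> K) -> R[i]) (eta : (K -> K) -> L).
Hypotheses (vM : von_neumann_algebra M) (ft : finite_trace M tau)
  (hL : is_L2 M tau eta).
Implicit Types (x y z : K -> K) (S T : L -> L) (u v w : L).
Let sM := vna_star vM.
Let bM := star_bounded sM.

Lemma trace0 : tau 0 = 0.
Proof.
by have := trace_linear ft (-1) (star0 sM) (star0 sM); rewrite scaler0 addr0 mulN1r addNr.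
Qed.

Lemma eta_lincomb a x y : M x -> M y -> eta (a *: x + y) = a *: eta x + eta y.
Proof. exact: (L2_linear hL). Qed.

Lemma eta0 : eta 0 = 0.
Proof.
by have := eta_lincomb (-1) (star0 sM) (star0 sM); rewrite scaler0 addr0 scaleN1r addNr.
Qed.

Lemma eta_scale a x : M x -> eta (a *: x) = a *: eta x.
Proof. by move=> Mx; have := eta_lincomb a Mx (star0 sM); rewrite eta0 !addr0. Qed.

Lemma eta_subspace N : star_subalgebra N -> N `<=` M -> subspace (eta @` N).
Proof.
move=> sN NM; split; first by exists 0; [exact: star0|exact: eta0].
move=> c _ _ [x Nx <-] [y Ny <-]; exists (c *: x + y); first exact: star_lincomb.
by rewrite eta_lincomb //; exact: NM.
Qed.

Lemma eta_sqn x : M x -> sqn (eta x) = Re (tau (adjoint x \o x)).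
Proof. by move=> Mx; rewrite /sqn /rdot (L2_hdot hL). Qed.

Lemma eta_dense u : closure (eta @` M) u.
Proof. by rewrite (L2_dense hL). Qed.

Lemma dense_injl u v : (forall x, M x -> hdot u (eta x) = hdot v (eta x)) -> u = v.
Proof.
move=> h; apply: hdot_injr => w; apply/eqP; rewrite -subr_eq0 -hdotNr -hdotDr; apply/eqP.
apply: orth_closure (@eta_dense w) => _ [x Mx <-].
by rewrite hdotC hdotDl hdotNl h // subrr rmorph0.
Qed.

Lemma dense_ext S T : bounded_op S -> bounded_op T ->
  (forall x, M x -> S (eta x) = T (eta x)) -> S = T.
Proof.
move=> bS bT h; apply: funext => u; apply/eqP; rewrite -subr_eq0; apply/eqP.
have := ker_closure (bounded_sub bS bT) _ (@eta_dense u); apply.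
by move=> _ [x Mx <-]; rewrite sub_app h // subrr.
Qed.

Lemma dense_form_ge0 S : bounded_op S ->
  (forall x, M x -> 0 <= rdot (S (eta x)) (eta x)) -> forall v, 0 <= rdot (S v) v.
Proof.
move=> bS h v; rewrite leNgt; apply/negP => lt.
have lS := bounded_lin bS; have /bounded_opP[_ [C C0 hC]] := bS.
pose e := - rdot (S v) v / 4.
have e0 : 0 < e by rewrite /e; lra.
have [d1 d10 hd1] := rdot_lt (S v) e0.
have [d2 d20 hd2] := rdot_lt (adjoint S v) e0.
have C2 : 0 < C + 1 + 1 by lra.
have d30 : 0 < e / (C + 1 + 1) by rewrite divr_gt0.
have m0 : 0 < Num.min d1 (Num.min d2 (e / (C + 1 + 1))) by rewrite !lt_min d10 d20.
have [_ [x Mx <-]] := (closureE _ _).1 (@eta_dense v) _ m0.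
set z := v - eta x; rewrite !lt_min => /and3P[z1 z2 z3].
have xE : eta x = v - z by rewrite /z subKr.
clearbody z.
have := h x Mx; rewrite xE linB // !rdotBl !rdotBr.
have := hd1 z z1; have := hd2 z z2; rewrite (rdotC z (S v)) -radjP // !ltr_norml.
move=> /andP[a1 a2] /andP[b1 b2].
have : rdot (S z) z <= (C + 1) * sqn z.
  have := hC z; have := sqnn_ge0 (S z - z); rewrite sqnB_eq; have := sqnn_ge0 z.
  have := sqnn_ge0 (S z).
  move: (sqn (S z)) (sqn z) (rdot (S z) z) => p q r; lra.
have : (C + 1) * sqn z <= e.
  move: z3; rewrite ltr_pdivlMr //; have := sqnn_ge0 z; move: (sqn z) => q q0 z3.
  by lra.
have : rdot (S v) v = - 4 * e by rewrite /e; field.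
move: a1 a2 b1 b2; clearbody e.
move: (rdot (S v) v) (rdot (S v) z) (rdot (S z) v) (rdot (S z) z) (_ * sqn z).
by move=> p q r s t; lra.
Qed.

Lemma dense_pos S : bounded_op S -> (forall x, M x -> 0 <= hdot (S (eta x)) (eta x)) ->
  pos_op S.
Proof.
move=> bS h v.
(* Used for c = i and c = -i, where the real part of the form of c S vanishes on the dense subspace:
   the two inequalities make <S v, v> real. *)
have im0 (c : R[i]) : Re c = 0 -> forall u, 0 <= rdot ((c *: S) u) u.
  move=> c0; apply: dense_form_ge0; first exact: bounded_scale.
  move=> x Mx; rewrite scale_app /rdot hdotZl ReM c0 mul0r.
  by have := h x Mx; rewrite lecE => /andP[/eqP -> _]; rewrite mulr0 subr0.
rewrite lecE; apply/andP; split.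
  have := im0 'i%C erefl v; have := im0 (- 'i%C) (oppr0 R) v.
  rewrite /rdot !scale_app !hdotZl !ReM /= => h1 h2; apply/eqP; move: h1 h2.
  move: (Re _) (Im _) => p q; rewrite !oppr0 !mul0r !mul1r !mulN1r; lra.
apply: dense_form_ge0 => // x Mx; have := h x Mx; by rewrite lecE => /andP[].
Qed.

Lemma left_bound x : M x -> exists2 C, 0 <= C & forall y, M y ->
  Re (tau (adjoint (x \o y) \o (x \o y))) <= C * Re (tau (adjoint y \o y)).
Proof.
move=> Mx; have /bounded_opP[_ [C C0 hC]] := bM Mx; exists C => // y My.
have nF := trace_functional vM ft.
have pY := posA_square vM My.
have Mxy := star_comp sM Mx My.
rewrite -(nf_scale nF); last exact: pY.1.
apply: (nf_mono vM nF); [exact: posA_square|exact: posA_scale|].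
move=> v; rewrite scale_app rdotZl /= !radjPl //; [exact: hC|exact: bM|exact: bM Mxy].
Qed.

Lemma lam_exists x : M x -> exists T, bounded_op T /\ forall y, M y -> T (eta y) = eta (x \o y).
Proof.
move=> Mx; have [C C0 hC] := left_bound Mx.
pose D u w := exists y, [/\ M y, u = eta y & w = eta (x \o y)].
have [|||||T bT hT] := extend_op (D := D) (C := C).
- exists 0; split; [exact: star0|by rewrite eta0|].
  rewrite -eta0; congr eta; apply: funext => v /=; rewrite lin0 //; exact: bounded_lin (bM Mx).
- move=> c _ _ _ _ [y [My -> ->]] [z [Mz -> ->]]; exists (c *: y + z); split.
  + exact: star_lincomb.
  + by rewrite eta_lincomb.
  + rewrite -eta_lincomb; [|exact: star_comp|exact: star_comp].
    congr eta; apply: funext => v; exact/esym/(bounded_lin (bM Mx)).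
- exact: C0.
- move=> _ _ [y [My -> ->]]; rewrite !eta_sqn //; last exact: star_comp.
  exact: hC.
- move=> v; apply: closureS (@eta_dense v) => _ [y My <-].
  by exists (eta (x \o y)), y.
exists T; split=> // y My; apply: hT; by exists y.
Qed.

(** Right multiplication is bounded because tau is a trace: the L^2 norm of y x is that of its
    adjoint, the product of x^* and y^*, to which [left_bound] applies. *)
Lemma rho_exists x : M x -> exists T, bounded_op T /\ forall y, M y -> T (eta y) = eta (y \o x).
Proof.
move=> Mx; have [C C0 hC] := left_bound (star_adj sM Mx).
pose D u w := exists y, [/\ M y, u = eta y & w = eta (y \o x)].
have [|||||T bT hT] := extend_op (D := D) (C := C).
- exists 0; split; [exact: star0|by rewrite eta0|].
  by rewrite -eta0; congr eta; apply: funext => v.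
- move=> c _ _ _ _ [y [My -> ->]] [z [Mz -> ->]]; exists (c *: y + z); split.
  + exact: star_lincomb.
  + by rewrite eta_lincomb.
  + rewrite -eta_lincomb; [|exact: star_comp|exact: star_comp].
    by congr eta.
- exact: C0.
- move=> _ _ [y [My -> ->]]; rewrite !eta_sqn //; last exact: star_comp.
  have My' := star_adj sM My; have Mx' := star_adj sM Mx; have := hC _ My'.
  have [bx bY] := (bM Mx, bM My).
  rewrite adj_comp ?adjK //; try exact: bounded_adj.
  rewrite adj_comp // (trace_comm ft My My').
  by rewrite (trace_comm ft (star_comp sM My Mx) (star_comp sM Mx' My')).
- move=> v; apply: closureS (@eta_dense v) => _ [y My <-].
  by exists (eta (y \o x)), y.
exists T; split=> // y My; apply: hT; by exists y.
Qed.

(** [lam] is the standard representation of M on L^2(M), and [rho] the right action commuting with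
    it. For x in M the default 0 is never taken. *)
Definition lam x : L -> L :=
  xget 0 [set T | bounded_op T /\ forall y, M y -> T (eta y) = eta (x \o y)].
Definition rho x : L -> L :=
  xget 0 [set T | bounded_op T /\ forall y, M y -> T (eta y) = eta (y \o x)].

Lemma lamP x : M x -> bounded_op (lam x) /\ forall y, M y -> lam x (eta y) = eta (x \o y).
Proof.
by move=> /lam_exists[T hT]; rewrite /lam; case: xgetP => [T' _ hT'|/(_ T)].
Qed.
Lemma rhoP x : M x -> bounded_op (rho x) /\ forall y, M y -> rho x (eta y) = eta (y \o x).
Proof.
by move=> /rho_exists[T hT]; rewrite /rho; case: xgetP => [T' _ hT'|/(_ T)].
Qed.
Lemma lam_bounded x : M x -> bounded_op (lam x). Proof. by case/lamP. Qed.
Lemma rho_bounded x : M x -> bounded_op (rho x). Proof. by case/rhoP. Qed.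
Lemma lamE x y : M x -> M y -> lam x (eta y) = eta (x \o y).
Proof. by case/lamP => _; apply. Qed.
Lemma rhoE x y : M x -> M y -> rho x (eta y) = eta (y \o x).
Proof. by case/rhoP => _; apply. Qed.

Lemma left_multP T : left_mult M eta T <-> exists2 x, M x & T = lam x.
Proof.
split=> [[bT [x Mx h]]|[x Mx ->]].
  exists x => //; apply: dense_ext => //; first exact: lam_bounded.
  by move=> y My; rewrite h // lamE.
by split; [exact: lam_bounded|exists x => // y My; rewrite lamE].
Qed.

Lemma lam_lincomb a x y : M x -> M y -> lam (a *: x + y) = a *: lam x + lam y.
Proof.
move=> Mx My; have Mxy := star_lincomb sM a Mx My.
apply: dense_ext; first exact: lam_bounded.
  by apply: bounded_lincomb; exact: lam_bounded.
move=> z Mz; rewrite add_app scale_app !lamE // -eta_lincomb //; exact: star_comp.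
Qed.

Lemma lam0 : lam 0 = 0.
Proof.
have := lam_lincomb (-1) (star0 sM) (star0 sM).
by rewrite scaler0 addr0 scaleN1r addNr => ->.
Qed.

Lemma lam_comp x y : M x -> M y -> lam (x \o y) = lam x \o lam y.
Proof.
move=> Mx My; have Mxy := star_comp sM Mx My.
apply: dense_ext; first exact: lam_bounded.
  by apply: bounded_comp; exact: lam_bounded.
by move=> z Mz /=; rewrite !lamE //; exact: star_comp.
Qed.

Lemma lam_id : lam idfun = idfun.
Proof.
have M1 := vna_unital vM.
apply: dense_ext; [exact: lam_bounded|exact: bounded_id|].
by move=> z Mz; rewrite lamE.
Qed.

Lemma lam_adj x : M x -> adjoint (lam x) = lam (adjoint x).
Proof.
move=> Mx; have Mx' := star_adj sM Mx.
apply: dense_ext; [exact: bounded_adj (lam_bounded Mx)|exact: lam_bounded|].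
move=> y My; apply: dense_injl => z Mz; rewrite adjPl; last exact: lam_bounded.
rewrite !lamE // !(L2_hdot hL) //; try exact: star_comp.
rewrite adj_comp //; exact: bM.
Qed.

Lemma rho_adj x : M x -> adjoint (rho x) = rho (adjoint x).
Proof.
move=> Mx; have Mx' := star_adj sM Mx.
apply: dense_ext; [exact: bounded_adj (rho_bounded Mx)|exact: rho_bounded|].
move=> y My; apply: dense_injl => z Mz; rewrite adjPl; last exact: rho_bounded.
rewrite !rhoE // !(L2_hdot hL) //; try exact: star_comp.
rewrite adj_comp; [|exact: bM|exact: bM].
have Mzy := star_comp sM (star_adj sM Mz) My.
by rewrite -[LHS]/(tau (adjoint x \o (adjoint z \o y))) (trace_comm ft Mx' Mzy).
Qed.

Lemma lam_rho x y u : M x -> M y -> lam x (rho y u) = rho y (lam x u).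
Proof.
move=> Mx My.
have E : lam x \o rho y = rho y \o lam x.
  apply: dense_ext; try (apply: bounded_comp; [exact: lam_bounded|exact: rho_bounded]).
    by apply: bounded_comp; [exact: rho_bounded|exact: lam_bounded].
  by move=> z Mz /=; rewrite rhoE // !lamE // ?rhoE //; exact: star_comp.
by have /(congr1 (fun f => f u)) := E.
Qed.

(** The trace vector: tau x = <x xi, xi>, and eta x is obtained from xi by the left as well as by
    the right action of x. *)
Definition xi : L := eta idfun.
Let M1 := vna_unital vM.

Lemma lam_xi x : M x -> lam x xi = eta x. Proof. by move=> Mx; rewrite lamE. Qed.
Lemma rho_xi x : M x -> rho x xi = eta x. Proof. by move=> Mx; rewrite rhoE. Qed.

Lemma tau_xi x : M x -> tau x = hdot (eta x) xi.
Proof. by move=> Mx; rewrite (L2_hdot hL) // adj_id. Qed.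

Lemma lam_inj x : M x -> lam x = 0 -> x = 0.
Proof.
move=> Mx h; have bx := bM Mx; apply: square_eq0 => //.
have [Ms ps] := posA_square vM Mx.
apply: (trace_faithful ft) => //.
by rewrite -(L2_hdot hL) // -lam_xi // h hdot0l.
Qed.

Lemma lam_inj2 x y : M x -> M y -> lam x = lam y -> x = y.
Proof.
move=> Mx My h; apply/eqP; rewrite -subr_eq0; apply/eqP.
have E : x - y = (-1) *: y + x by rewrite scaleN1r addrC.
rewrite E; apply: lam_inj; first exact: star_lincomb.
by rewrite lam_lincomb // h scaleN1r addNr.
Qed.

Lemma lam_form x y : M x -> M y -> hdot (lam x (eta y)) (eta y) = tau (adjoint y \o x \o y).
Proof. by move=> Mx My; rewrite lamE // (L2_hdot hL) //; exact: star_comp. Qed.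

Lemma lam_pos x : posA M x -> pos_op (lam x).
Proof.
move=> px; have Mx := px.1; apply: dense_pos; first exact: lam_bounded.
move=> y My; rewrite lam_form //; have [M2 p2] := posA_conj vM My px.
exact: (trace_ge0 ft).
Qed.

Lemma lam_sub x y : M x -> M y -> lam (x - y) = lam x - lam y.
Proof.
move=> Mx My; have E : x - y = (-1) *: y + x by rewrite scaleN1r addrC.
by rewrite E lam_lincomb // scaleN1r addrC.
Qed.

Lemma lam_rle x y : posA M x -> posA M y -> rle x y -> rle (lam x) (lam y).
Proof.
move=> px py h v; have pyx := posA_sub vM px py h.
have := pos_ge0 (lam_bounded pyx.1) (lam_pos pyx) v.
by rewrite lam_sub; [rewrite sub_app rdotBl subr_ge0|exact: py.1|exact: px.1].
Qed.

(** At a vector eta m the forms are tau (m^* d m), so this is normality of tau along the net m^* d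
    m. For general v take eta m close to v; the remainder is controlled by 0 <= x - d <= x. *)
Lemma lam_limit (D : set (K -> K)) x : D !=set0 -> D `<=` posA M -> rdirected D ->
  posA M x -> (forall d, D d -> rle d x) -> sot_limit D x ->
  forall v e, 0 < e -> exists2 d, D d & rdot (lam x v) v - e < rdot (lam d v) v.
Proof.
move=> D0 DA dirD px ub lim v e e0; have Mx := px.1.
have [C C0 hC] := bounded_form (lam_bounded Mx).
have e1 : 0 < e / (4 * C) by rewrite divr_gt0 // mulr_gt0.
have [_ [m Mm <-] hm] := (closureE _ _).1 (@eta_dense v) _ e1.
have e2 : 0 < e / 4 by rewrite divr_gt0.
have nF := trace_functional vM ft.
have bm := bM Mm.
pose D' := [set adjoint m \o d \o m | d in D].
have dirD' : rdirected D'.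
  move=> _ _ [a Da <-] [b Db <-]; have [z Dz [az bz]] := dirD a b Da Db.
  exists (adjoint m \o z \o m); first by exists z.
  by split=> w; rewrite /= !radjPl.
have DA' : D' `<=` posA M by move=> _ [d /DA Dd <-]; exact: posA_conj.
have px' := posA_conj vM Mm px.
have ub' d : D' d -> rle d (adjoint m \o x \o m).
  by move=> [a Da <-] w; rewrite /= !radjPl //; exact: ub.
have lim' : sot_limit D' (adjoint m \o x \o m).
  apply: (form_sot_limit vM DA' px' ub') => w r r0.
  have [d Dd hd] := sot_rdot (m w) (m w) D0 dirD lim r0.
  exists (adjoint m \o d \o m); first by exists d.
  rewrite /= !radjPl //; have := hd d Dd (rle_refl d); rewrite ltr_norml => /andP[+ _].
  by move: (rdot (d _) _) (rdot (x _) _) => p q; lra.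
have D0' : D' !=set0 by have [d Dd] := D0; exists (adjoint m \o d \o m), d.
have [_ [d Dd <-]] := nf_sup nF D0' DA' dirD' px' ub' lim' e2.
have Md := (DA d Dd).1.
rewrite -!lam_form // -/(rdot _ _) -/(rdot _ _) => hd.
exists d => //.
pose S := lam (x - d).
have pxd := posA_sub vM (DA d Dd) px (ub d Dd).
have SE : S = lam x - lam d by rewrite /S lam_sub.
have bS : bounded_op S by exact: lam_bounded pxd.1.
have pS : pos_op S by exact: lam_pos.
have S1 : rdot (S (eta m)) (eta m) < e / 4 by rewrite SE sub_app rdotBl; lra.
have S2 : rdot (S (v - eta m)) (v - eta m) < e / 4.
  apply: le_lt_trans (_ : C * sqn (v - eta m) < _).
    apply: le_trans (hC _); rewrite SE sub_app rdotBl gerBl.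
    by apply: pos_ge0; [exact: lam_bounded|exact: lam_pos (DA d Dd)].
  by rewrite -ltr_pdivlMl // mulrC -mulrA -invfM mulrC mulrC.
(* Positivity of S at w - eta m, with w = v - eta m, gives <S v, v> <= 2 <S w, w> + 2 <S (eta m),
   eta m> < e. *)
have lS := bounded_lin bS; have := pos_ge0 bS pS (v - eta m - eta m).
have vE : v = (v - eta m) + eta m by rewrite subrK.
have : rdot (S v) v = rdot (lam x v) v - rdot (lam d v) v by rewrite SE sub_app rdotBl.
rewrite {1 2}vE; move: (v - eta m) S1 S2 => w S1 S2.
rewrite (linB lS w) (linD lS w) !rdotBl !rdotBr !rdotDl !rdotDr; clear -S1 S2.
move: (rdot (S w) w) (rdot (S w) _) (rdot (S (eta m)) w) (rdot (S (eta m)) (eta m)) S1 S2.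
by move=> p q r s; lra.
Qed.

End StandardForm.

Section FactorStandardForm.
Context {R : realType} {K L : hilbertType R}.
Variables (M : set (K -> K)) (tau : (K -> K) -> R[i]) (eta : (K -> K) -> L).
Hypotheses (vM : von_neumann_algebra M) (ft : finite_trace M tau)
  (tau1 : tau idfun = 1) (hL : is_L2 M tau eta).
Implicit Types (x y z : K -> K) (S T : L -> L) (u v w : L).
Let sM := vna_star vM.
Local Notation lam := (lam M eta).
Local Notation rho := (rho M eta).
Local Notation xi := (xi eta).
Let lamB := lam_bounded vM ft hL.
Let rhoB := rho_bounded vM ft hL.
Let lamEe := lamE vM ft hL.
Let rhoEe := rhoE vM ft hL.
Let lamX := lam_xi vM ft hL.
Let tauX := tau_xi vM hL.
Let M1 := vna_unital vM.

(* [x |-> <p x xi, xi>] is a trace dominated by [tau], hence a multiple of it. *)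
Lemma bimodule_projection N p : is_factor N -> N `<=` M -> bounded_op p ->
  (forall u v, hdot (p u) v = hdot u (p v)) -> (forall u, p (p u) = p u) ->
  (forall x, N x -> forall u, p (lam x u) = lam x (p u)) ->
  (forall x, N x -> forall u, p (rho x u) = rho x (p u)) ->
  closure (eta @` N) (p xi) ->
  (forall x, N x -> p (eta x) = 0) \/ (forall x, N x -> p (eta x) = eta x).
Proof.
move=> fN NM bp ps pp pl pr pc; have [vN _] := fN; have sN := vna_star vN.
have lp := bounded_lin bp.
have N1 := vna_unital vN.
have pNM x : posA N x -> posA M x by move=> [Nx px]; split=> //; exact: NM.
pose psi x := rdot (p (eta x)) xi.
have psiE x : N x -> hdot (p (eta x)) xi = hdot (lam x (p xi)) (p xi).
  move=> Nx; have Mx := NM x Nx.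
  by rewrite -(lamX Mx) -pp pl // ps pl.
have nT : normal_functional N (fun x => Re (tau x)).
  have nM := trace_functional vM ft; split.
  - by move=> x y Nx Ny; apply: (nf_add nM); exact: NM.
  - by move=> r x Nx; apply: (nf_scale nM); exact: NM.
  - by move=> x px; apply: (nf_ge0 nM); exact: pNM.
  - move=> D x D0 DN dirD px ub lim e e0; apply: (nf_sup nM) ub lim e e0 => //.
      by move=> d /DN/pNM.
    exact: pNM.
have psi_pos x : posA N x -> 0 <= hdot (p (eta x)) xi.
  by move=> px; rewrite psiE; [exact: (lam_pos vM ft hL (pNM x px))|exact: px.1].
(* Expand <x (xi - p xi), xi - p xi> >= 0: each of the three terms containing p equals psi x up to
   sign. *)
have psi_le x : posA N x -> psi x <= Re (tau x).
  move=> px; have Nx := px.1; have Mx := NM x Nx.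
  have := pos_ge0 (lamB Mx) (lam_pos vM ft hL (pNM x px)) (xi - p xi).
  rewrite (linB (bounded_lin (lamB Mx))) !rdotBl !rdotBr.
  have h1 : rdot (lam x xi) (p xi) = psi x.
    by rewrite /psi /rdot -ps lamX.
  have h2 : rdot (lam x (p xi)) xi = psi x by rewrite /psi -pl // lamX.
  have h3 : rdot (lam x (p xi)) (p xi) = psi x by rewrite /psi /rdot psiE.
  rewrite h1 h2 h3 lamX // /rdot -tauX //; lra.
have psiD x y : N x -> N y -> psi (x + y) = psi x + psi y.
  move=> Nx Ny; have Mx := NM x Nx; have My := NM y Ny.
  have := eta_lincomb hL 1 Mx My; rewrite !scale1r /psi => ->.
  by rewrite (linD lp) rdotDl.
have psiZ (r : R) x : N x -> psi (r%:C%C *: x) = r * psi x.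
  move=> Nx; have Mx := NM x Nx.
  by rewrite /psi (eta_scale vM hL) // (linZ lp) rdotZl.
(* psi inherits normality from tau, since psi (x - d) <= tau (x - d). *)
have npsi : normal_functional N psi.
  split=> //.
  - by move=> x px; have := psi_pos x px; rewrite lecE => /andP[].
  - move=> D x D0 DN dirD px ub lim e e0.
    have [d Dd hd] := nf_sup nT D0 DN dirD px ub lim e0; exists d => //.
    have pxd := posA_sub vN (DN d Dd) px (ub d Dd).
    have := psi_le _ pxd; rewrite (nf_sub vN nT px.1 (DN d Dd).1).
    have -> : psi (x - d) = psi x - psi d.
      rewrite psiD; [|exact: px.1|apply: star_opp => //; exact: (DN d Dd).1].
      congr (_ + _); have := psiZ (-1) d (DN d Dd).1.
      by rewrite mulN1r rmorphN rmorph1 scaleN1r.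
    by move: hd; move: (Re (tau x)) (Re (tau d)) (psi x) (psi d) => a b f g; lra.
(* Move the right action of y through p and over to xi, read y^* on xi as a left action, and move it
   back through p. *)
have tpsi : tracial N psi.
  move=> x y Nx Ny; have Mx := NM x Nx; have My := NM y Ny.
  have My' := star_adj sM My; have Ny' := star_adj sN Ny.
  rewrite /psi -(rhoEe My Mx) pr // radjP; last exact: rhoB.
  rewrite (rho_adj vM ft hL My) (rho_xi vM ft hL My') -(lamX My').
  rewrite -(lam_adj vM ft hL My) -radjP; last exact: lamB.
  by rewrite -pl // lamEe.
have tT : tracial N (fun x => Re (tau x)).
  by move=> x y Nx Ny; rewrite (trace_comm ft (NM x Nx) (NM y Ny)).
pose s := psi idfun.
have s0 : 0 <= s by have := psi_pos _ (posA_id vN); rewrite lecE => /andP[].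
have T1 : 0 < Re (tau idfun) by rewrite tau1.
have psi1 : psi idfun = s * Re (tau idfun) by rewrite tau1 /= mulr1.
have eqp := trace_unique vN fN npsi nT tpsi tT T1 s0 psi1.
have sub := eta_subspace vM hL sN NM.
(* On N the functional psi is s tau, so p xi - s xi is orthogonal to eta (N); it also lies in the
   closure of eta (N), hence vanishes. *)
pose G x := hdot (eta x) (p xi - s%:C%C *: xi).
have G0 x : N x -> G x = 0.
  move=> Nx; apply: (linear_posA_eq0 vN (G := G)) Nx => {x}.
    by move=> a x y Nx Ny; rewrite /G (eta_lincomb hL) ?hdotPl //; exact: NM.
  move=> x px; rewrite /G hdotDr hdotNr hdotZr -ps -tauX //; last exact: NM px.1.
  have re (z : R[i]) : 0 <= z -> z = (Re z)%:C%C.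
    by case: z => a b; rewrite lecE /= => /andP[/eqP ->].
  rewrite (re _ (psi_pos _ px)) (re (tau x)); last by apply: (trace_ge0 ft); [exact: NM px.1|exact: px.2].
  by rewrite -[Re (hdot _ _)]/(psi x) eqp // conj_realC -rmorphM subrr.
have pxi : p xi = s%:C%C *: xi.
  apply/eqP; rewrite -subr_eq0; apply/eqP/sqn_eq0; rewrite /sqn /rdot.
  rewrite (orth_closure (H := eta @` N)) //; first by move=> _ [x Nx <-]; exact: G0.
  rewrite addrC -scaleNr; apply: closure_sub => //.
  by apply: subset_closure; exists idfun.
have pE x : N x -> p (eta x) = s%:C%C *: eta x.
  move=> Nx; have Mx := NM x Nx.
  by rewrite -(lamX Mx) pl // pxi (linZ (bounded_lin (lamB Mx))).
have sq : s = 0 \/ s = 1.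
  have := pp xi; rewrite pxi (linZ lp) pxi scalerA => /eqP.
  rewrite -subr_eq0 -scalerBl scaler_eq0 => /orP[|/eqP xi0]; last first.
    by have := tauX M1; rewrite -/(xi) xi0 hdot0l tau1 => /eqP; rewrite oner_eq0.
  rewrite -rmorphM -rmorphB /= -(rmorph0 (real_complex R)) => /eqP/complexI/eqP.
  rewrite -{3}(mulr1 s) -mulrBr mulf_eq0 subr_eq0 => /orP[] /eqP; by [left|right].
case: sq => s01; [left|right] => x Nx; rewrite pE // s01.
  by rewrite rmorph0 scale0r.
by rewrite rmorph1 scale1r.
Qed.

End FactorStandardForm.

(** * Normality of the standard representation *)

Section NormalRepresentation.
Context {R : realType} {K L : hilbertType R}.
Variables (M : set (K -> K)) (tau : (K -> K) -> R[i]) (eta : (K -> K) -> L).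
Hypotheses (fM : is_factor M) (ft : finite_trace M tau)
  (tau1 : tau idfun = 1) (hL : is_L2 M tau eta).
Implicit Types (x y z : K -> K) (S T : L -> L) (u v w : L).
Let vM : von_neumann_algebra M := fM.1.
Let sM := vna_star vM.
Let bM := star_bounded sM.
Local Notation lam := (lam M eta).
Local Notation rho := (rho M eta).
Let lamB := lam_bounded vM ft hL.
Let rhoB := rho_bounded vM ft hL.
Let lamEe := lamE vM ft hL.
Let rhoEe := rhoE vM ft hL.
Let M1 := vna_unital vM.

Lemma trace_below_vector : exists c (w : K), [/\ posA M c, c <> 0 &
  forall y, posA M y -> Re (tau (c \o y \o c)) <= rdot (y w) w].
Proof.
have [v v0] : exists v : K, 1 < sqn v.
  have [v hv] : exists v : K, v <> 0.
    apply: contrapT => no; have z : (idfun : K -> K) = 0.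
      by apply: funext => v; apply: contrapT => h; apply: no; exists v.
    by have /eqP := tau1; rewrite z (trace0 vM ft) eq_sym oner_eq0.
  have qp : 0 < sqn v.
    rewrite lt_neqAle sqnn_ge0 andbT eq_sym; apply/eqP => q0; apply: hv; exact: sqn_eq0.
  (* With this factor the squared norm becomes |v|^2 + 2 + 1 / |v|^2, which exceeds 1. *)
  exists ((1 + (sqn v)^-1)%:C%C *: v); rewrite sqnZ /= expr0n addr0.
  have -> : (1 + (sqn v)^-1) ^+ 2 * sqn v = 2 + sqn v + (sqn v)^-1 by field; rewrite gt_eqF.
  have : 0 < (sqn v)^-1 by rewrite invr_gt0.
  by move: (_^-1) => a; lra.
have nF := trace_functional vM ft.
have [|c [pc c0 hc]] := functional_compare vM nF (vector_functional vM v).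
  by rewrite tau1.
exists c, (c v); split=> // y py; apply: le_trans (hc y py) _.
by rewrite /= (posA_symm vM pc).
Qed.

(** The orthogonal complement of the ideal M c M in L^2(M) is an M-M-bimodule, so by
    [bimodule_projection] with N = M it is 0 or everything; in the second case eta c would be
    orthogonal to itself. *)
Lemma ideal_dense c v : posA M c -> c <> 0 ->
  (forall x y, M x -> M y -> hdot (eta (x \o c \o y)) v = 0) -> v = 0.
Proof.
move=> pc c0 hv; have Mc := pc.1.
pose H := [set w | forall x y, M x -> M y -> hdot (eta (x \o c \o y)) w = 0].
have sH : subspace H.
  split; first by move=> x y _ _; rewrite hdot0r.
  by move=> a w w' Hw Hw' x y Mx My; rewrite hdotDr hdotZr Hw // Hw' // mulr0 addr0.
have cH w : closure H w -> H w.
  move=> cw x y Mx My; rewrite hdotC (orth_closure _ cw) ?rmorph0 // => h Hh.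
  by rewrite hdotC Hh // rmorph0.
have lH x w : M x -> H w -> H (lam x w).
  move=> Mx Hw y z My Mz; have Mx' := star_adj sM Mx.
  rewrite -adjPl; last exact: lamB.
  rewrite (lam_adj vM ft hL) // lamEe //; last by do !apply: star_comp => //.
  by apply: (Hw (adjoint x \o y) z) => //; exact: star_comp.
have rH x w : M x -> H w -> H (rho x w).
  move=> Mx Hw y z My Mz; have Mx' := star_adj sM Mx.
  rewrite -adjPl; last exact: rhoB.
  rewrite (rho_adj vM ft hL) // rhoEe //; last by do !apply: star_comp => //.
  by apply: (Hw y (z \o adjoint x)) => //; exact: star_comp.
have [p pH] := proj_exists sH.
have pl x : M x -> forall u, p (lam x u) = lam x (p u).
  move=> Mx; apply: (proj_commute sH pH); first exact: lamB.
    by move=> h; exact: lH.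
  by move=> h; rewrite (lam_adj vM ft hL) //; apply: lH; exact: star_adj.
have pr x : M x -> forall u, p (rho x u) = rho x (p u).
  move=> Mx; apply: (proj_commute sH pH); first exact: rhoB.
    by move=> h; exact: rH.
  by move=> h; rewrite (rho_adj vM ft hL) //; apply: rH; exact: star_adj.
have [|h|h] := bimodule_projection vM ft tau1 hL fM (@subset_refl _ M) (proj_bounded pH)
    (proj_sym pH) (proj_idem sH pH) pl pr.
- exact: (eta_dense hL).
- have p0 : p = 0.
    apply: (dense_ext hL) => //; [exact: proj_bounded pH|exact: bounded0].
  have : p v = v by apply: (proj_fix sH pH); apply: subset_closure.
  by rewrite p0.
- exfalso; have Hc : H (eta c) by rewrite -h //; apply: cH; exact: (proj_mem pH).
  apply: c0; apply: (lam_inj vM ft hL) => //.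
  have := Hc idfun idfun M1 M1; rewrite hdot_sqn => -[/sqn_eq0 e0].
  apply: (dense_ext hL); [exact: lamB|exact: bounded0|].
  move=> x Mx; rewrite lamEe // -(rhoEe Mx Mc) e0.
  by rewrite lin0 //; exact: bounded_lin (rhoB Mx).
Qed.

Section Vectors.
Variables (c : K -> K) (w0 : K).
Hypotheses (pc : posA M c) (c0 : c <> 0)
  (hc : forall y, posA M y -> Re (tau (c \o y \o c)) <= rdot (y w0) w0).

(* The coefficients of [lam] at the vectors [eta (x \o c \o y)], which span a dense
   subspace, are weakly continuous on [M]; so [Wstar X = M] can be used on [L]. *)
Lemma lam_vector x y v : M x -> M y -> exists a b : K,
  forall z, M z -> hdot (lam z (eta (x \o c \o y))) v = hdot (z a) b.
Proof.
move=> Mx My; have Mc := pc.1; set v' := adjoint (rho y) v.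
(* The functional z w0 |-> <eta (z c), v'> is bounded by [hc], as |eta (z c)|^2 = tau (c z^* z c) <=
   |z w0|^2; its Riesz vector is b. *)
pose D (k : K) s := exists z, [/\ M z, k = z w0 & s = hdot (eta (z \o c)) v'].
have [||||b [_ _ hb]] := riesz_rel (D := D) (C := sqn v').
- by exists 0; split; [exact: star0| |rewrite [_ \o _](_ : _ = 0) // (eta0 vM hL) hdot0l].
- move=> a _ _ _ _ [z [Mz -> ->]] [z' [Mz' -> ->]]; exists (a *: z + z'); split.
  + exact: star_lincomb.
  + by [].
  + by rewrite -hdotPl -(eta_lincomb hL); [|exact: star_comp|exact: star_comp].
- exact: sqnn_ge0.
- move=> _ _ [z [Mz -> ->]]; apply: le_trans (rdot_sqr_le _ _) _.
  rewrite mulrC ler_wpM2l ?sqnn_ge0 // (eta_sqn hL); last exact: star_comp.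
  have bz := bM Mz; have bc := bM Mc.
  have := hc (posA_square vM Mz); rewrite /= radjPl // -/(sqn (z w0)).
  by rewrite adj_comp // (posA_adj vM pc).
exists (x w0), b => z Mz.
have Mzx := star_comp sM Mz Mx.
rewrite lamEe //; last by do !apply: star_comp => //.
have Mzxc := star_comp sM Mzx Mc.
rewrite -[eta _]/(eta ((z \o x \o c) \o y)) -(rhoEe My Mzxc) adjP; last exact: rhoB.
by apply: hb; exists (z \o x).
Qed.
End Vectors.

Lemma norm_small_eq0 (z : R[i]) : (forall e, 0 < e -> `|z| < e%:C%C) -> z = 0.
Proof.
move=> h; apply/eqP; rewrite -normr_eq0 normc_def; apply/eqP; congr (_%:C%C).
apply/eqP; rewrite eq_le sqrtr_ge0 andbT leNgt; apply/negP => /h.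
by rewrite normc_def ltcR ltxx.
Qed.

(** Two operators cover both uses: b = a for commutation and b = 0 for annihilation. Between vectors
    of the dense ideal, the coefficients of a x - x b are differences of coefficients of x on K, so
    they are limits of the zero coefficients for y in E. *)
Lemma wot_intertwine (a b : L -> L) (E : set (K -> K)) x :
  bounded_op a -> bounded_op b -> M x ->
  (forall y, E y -> M y /\ forall u, a (lam y u) = lam y (b u)) ->
  (forall (s : seq (K * K)) (e : R), 0 < e -> exists2 S, E S &
     forall uv : K * K, uv \in s -> `|hdot (x uv.1 - S uv.1) uv.2| < e%:C%C) ->
  forall u, a (lam x u) = lam x (b u).
Proof.
move=> ba bb Mx hE lim.
have [c [w0 [pc c0 hc]]] := trace_below_vector.
have vec := lam_vector pc hc.
pose D := a \o lam x - (lam x \o b).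
have bx := lamB Mx.
have bD : bounded_op D by apply: bounded_sub; exact: bounded_comp.
have key k k' l l' : M k -> M k' -> M l -> M l' ->
    hdot (D (eta (k \o c \o k'))) (eta (l \o c \o l')) = 0.
  move=> Mk Mk' Ml Ml'; set g := eta (k \o c \o k'); set h := eta (l \o c \o l').
  have [v1 [v1' h1]] := vec k k' (adjoint a h) Mk Mk'.
  have [v2 [v2' h2]] := vec l l' (b g) Ml Ml'.
  have diff y : M y -> hdot (a (lam y g)) h - hdot (lam y (b g)) h =
      hdot (y v1) v1' - hdot (y v2') v2.
    move=> My; have By := bM My; have bly := lamB My.
    rewrite adjP // h1 //; congr (_ - _).
    rewrite adjP // (lam_adj vM ft hL) // hdotC h2; last exact: star_adj.
    by rewrite -hdotC -adjP.
  rewrite -[D g]/(a (lam x g) - lam x (b g)) hdotDl hdotNl diff //.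
  apply: norm_small_eq0 => e e0.
  have e2 : 0 < e / 2 by rewrite divr_gt0.
  have [y Ey hy] := lim [:: (v1, v1'); (v2', v2)] _ e2.
  have [My cy] := hE y Ey.
  have z0 : hdot (y v1) v1' - hdot (y v2') v2 = 0 by rewrite -diff // cy subrr.
  have i1 := hy (v1, v1') (mem_head _ _).
  have i2 := hy (v2', v2) ltac:(by rewrite !inE eqxx orbT).
  rewrite /= !hdotDl !hdotNl in i1 i2.
  rewrite -[X in `|X|]subr0 -z0.
  set p := hdot (x v1) v1' in i1 *; set q := hdot (x v2') v2 in i2 *.
  set p' := hdot (y v1) v1' in i1 z0 *; set q' := hdot (y v2') v2 in i2 z0 *.
  have -> : p - q - (p' - q') = (p - p') - (q - q') by ring.
  apply: le_lt_trans (ler_normB _ _) _.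
  have -> : e%:C%C = (e / 2)%:C%C + (e / 2)%:C%C :> R[i] by rewrite -rmorphD /= -splitr.
  exact: ltrD.
have Dk k k' : M k -> M k' -> D (eta (k \o c \o k')) = 0.
  move=> Mk Mk'; apply: (ideal_dense pc c0) => l l' Ml Ml'.
  by rewrite hdotC key // rmorph0.
have D0 v : adjoint D v = 0.
  by apply: (ideal_dense pc c0) => k k' Mk Mk'; rewrite -adjP // Dk // hdot0l.
move=> u; apply/eqP; rewrite -subr_eq0; apply/eqP.
by apply: hdot_inj => v; rewrite -[LHS]/(hdot (D u) v) adjP // D0 hdot0r hdot0l.
Qed.

(** The condition on [adjoint x] is part of the set because a and b are arbitrary and the set has to
    be closed under adjoints; weak approximation passes to adjoints by exchanging the two
    vectors. *)
Lemma wot_intertwiners_closed (a b : L -> L) : bounded_op a -> bounded_op b ->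
  wot_closed [set x | [/\ M x, forall u, a (lam x u) = lam x (b u) &
    forall u, a (lam (adjoint x) u) = lam (adjoint x) (b u)]].
Proof.
move=> ba bb T bT lim.
have MT : M T.
  by apply: (vna_closed vM) => // s e e0; have [S [MS _ _] hS] := lim s e e0; exists S.
split=> //; first by apply: wot_intertwine lim => // y [].
have MT' := star_adj sM MT.
apply: (wot_intertwine (E := [set x | M x /\ forall u, a (lam x u) = lam x (b u)])) => //.
move=> s e e0; have [S [MS h1 h2] hS] := lim [seq (uv.2, uv.1) | uv <- s] e e0.
exists (adjoint S); first by split=> //; exact: star_adj.
move=> uv uvs; have := hS (uv.2, uv.1) (map_f (fun uv => (uv.2, uv.1)) uvs).
have bS := bM MS; rewrite /= !hdotDl !hdotNl !adjPl //.
by rewrite (hdotC uv.1) (hdotC uv.1 (S _)) -rmorphB norm_conjC.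
Qed.

Lemma generated_commutant (X : set (K -> K)) (t : L -> L) :
  X `<=` M -> Wstar X = M -> bounded_op t ->
  (forall x, X x -> forall u, t (lam x u) = lam x (t u)) ->
  (forall x, X x -> forall u, t (lam (adjoint x) u) = lam (adjoint x) (t u)) ->
  forall x, M x -> forall u, t (lam x u) = lam x (t u).
Proof.
move=> XM XW bt h1 h2 x Mx; have Wx : Wstar X x by rewrite XW.
have lt := bounded_lin bt.
have [|||_ h _] := Wx [set x | [/\ M x, forall u, t (lam x u) = lam x (t u) &
    forall u, t (lam (adjoint x) u) = lam (adjoint x) (t u)]].
- split.
  + by move=> y [My _ _]; exact: bM.
  + by split; [exact: star0|..]; rewrite ?adj0 => u; rewrite (lam0 vM ft hL) lin0.
  + move=> a y z [My y1 y2] [Mz z1 z2].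
    have [My' Mz'] := (star_adj sM My, star_adj sM Mz).
    have [bY bz] := (bM My, bM Mz).
    split; first exact: star_lincomb.
      by move=> u; rewrite (lam_lincomb vM ft hL) // !add_app !scale_app lt y1 z1.
    by move=> u; rewrite adj_lincomb // (lam_lincomb vM ft hL) // !add_app !scale_app lt y2 z2.
  + move=> y z [My y1 y2] [Mz z1 z2].
    have [My' Mz'] := (star_adj sM My, star_adj sM Mz).
    have [bY bz] := (bM My, bM Mz).
    split; first exact: star_comp.
      by move=> u; rewrite (lam_comp vM ft hL) //= y1 z1.
    by move=> u; rewrite adj_comp // (lam_comp vM ft hL) //= z2 y2.
  + move=> y [My y1 y2]; split=> //; first exact: star_adj.
    by rewrite adjK //; exact: bM.
- exact: wot_intertwiners_closed.
- by move=> y Xy; split; [exact: XM|exact: h1|exact: h2].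
exact: h.
Qed.

(** The x in M with f x = 0 and f x^* = 0 on L form a weakly closed star-subalgebra containing X, so
    it contains the identity, which lies in [Wstar X]. *)
Lemma generated_nondegenerate (X : set (K -> K)) (f : L -> L) :
  X `<=` M -> Wstar X = M -> bounded_op f ->
  (forall x, X x -> forall u, f (lam x u) = 0) ->
  (forall x, X x -> forall u, f (lam (adjoint x) u) = 0) ->
  f = 0.
Proof.
move=> XM XW bf h1 h2; have lf := bounded_lin bf.
have lamx0 x : M x -> lam x 0 = 0.
  by move=> Mx; apply: lin0; exact: bounded_lin (lamB Mx).
have : Wstar X idfun by rewrite XW.
move=> /(_ [set x | [/\ M x, forall u, f (lam x u) = lam x ((0 : L -> L) u) &
    forall u, f (lam (adjoint x) u) = lam (adjoint x) ((0 : L -> L) u)]]).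
move=> W; have [|||_ h _] := W.
- split.
  + by move=> y [My _ _]; exact: bM.
  + by split; [exact: star0|..]; rewrite ?adj0 => u; rewrite (lam0 vM ft hL) lin0.
  + move=> a y z [My y1 y2] [Mz z1 z2].
    have [My' Mz'] := (star_adj sM My, star_adj sM Mz).
    have [bY bz] := (bM My, bM Mz).
    split; first exact: star_lincomb.
      by move=> u; rewrite (lam_lincomb vM ft hL) // !add_app !scale_app lf y1 z1.
    by move=> u; rewrite adj_lincomb // (lam_lincomb vM ft hL) // !add_app !scale_app lf y2 z2.
  + move=> y z [My y1 y2] [Mz z1 z2].
    have [My' Mz'] := (star_adj sM My, star_adj sM Mz).
    have [bY bz] := (bM My, bM Mz).
    split; first exact: star_comp.
      by move=> u; rewrite (lam_comp vM ft hL) //= y1 !lamx0.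
    by move=> u; rewrite adj_comp // (lam_comp vM ft hL) //= z2 !lamx0.
  + move=> y [My y1 y2]; split=> //; first exact: star_adj.
    by rewrite adjK //; exact: bM.
- exact: wot_intertwiners_closed bounded0.
- move=> y Xy; have My := XM y Xy; split=> // u; first by rewrite h1 // lamx0.
  by rewrite h2 // lamx0 //; exact: star_adj.
apply: funext => u; have := h u.
by rewrite (lam_id vM ft hL).
Qed.

End NormalRepresentation.

(** * Small projections *)

Section SquareRoot.
Context {R : realType} {V : hilbertType R}.
Variables (A : set (V -> V)) (vA : von_neumann_algebra A).
Implicit Types (u v w : V) (x y b c g S T t : V -> V).
Let sA := vna_star vA.
Let bA := star_bounded sA.

Section Iteration.
Variables (b : V -> V) (pb : posA A b) (b1 : rle b idfun).
Let bb := bA pb.1.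
Let lb := bounded_lin bb.

(* Polynomials in [b] with nonnegative coefficients. *)
Inductive poly_cone : (V -> V) -> Prop :=
| poly_cone0 : poly_cone 0
| poly_coneS (r : R) n T : 0 <= r -> poly_cone T -> poly_cone (r%:C%C *: iter n b + T).

Lemma poly_coneD S T : poly_cone S -> poly_cone T -> poly_cone (S + T).
Proof.
move=> cS cT; elim: cS => [|r n S' r0 _ ih]; first by rewrite add0r.
by rewrite -addrA; exact: poly_coneS.
Qed.

Lemma poly_coneZ (r : R) T : 0 <= r -> poly_cone T -> poly_cone (r%:C%C *: T).
Proof.
move=> r0; elim=> [|s n S' s0 _ ih]; first by rewrite scaler0; exact: poly_cone0.
by rewrite scalerDr scalerA -rmorphM; apply: poly_coneS => //; exact: mulr_ge0.
Qed.

Lemma iter_lin n : linear (iter n b).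
Proof. by elim: n => [//|n ih] a u v; rewrite !iterS ih lb. Qed.

Lemma poly_cone_iter n T : poly_cone T -> poly_cone (iter n b \o T).
Proof.
elim=> [|r m S' r0 _ ih].
  rewrite (_ : _ \o _ = 0); first exact: poly_cone0.
  by apply: funext => v; rewrite /= (lin0 (iter_lin n)).
have -> : iter n b \o (r%:C%C *: iter m b + S') = r%:C%C *: iter (n + m) b + (iter n b \o S').
  apply: funext => v; rewrite add_app scale_app /= -[LHS]/(iter n b (r%:C%C *: iter m b v + S' v)).
  by rewrite iter_lin iterD.
exact: poly_coneS.
Qed.

Lemma poly_coneM S T : poly_cone S -> poly_cone T -> poly_cone (S \o T).
Proof.
move=> cS cT; elim: cS => [|r n S' r0 _ ih].
  by rewrite (_ : _ \o _ = 0) //; exact: poly_cone0.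
have -> : (r%:C%C *: iter n b + S') \o T = r%:C%C *: (iter n b \o T) + (S' \o T) by [].
by apply: poly_coneD => //; apply: poly_coneZ => //; exact: poly_cone_iter.
Qed.

(** Even powers have the form |b^k v|^2 and odd ones <b b^k v, b^k v>. *)
Lemma iter_posA n : posA A (iter n b).
Proof.
have symmi m : symm (iter m b).
  elim: m => [|m ih] u v //; rewrite iterS -/(iter m.+1 b v) iterSr.
  by rewrite (posA_symm vA pb) ih.
have A1 := vna_unital vA.
have Ai m : A (iter m b).
  by elim: m => [//|m ih]; apply: (star_comp sA pb.1 ih).
split=> //; apply/pos_opP; first exact: iter_lin.
split=> // v.
have [k [->|->]] : exists k, n = k.*2 \/ n = k.*2.+1.
  exists n./2; have := odd_double_half n.
  by case: (odd n) => h; [right|left]; rewrite -[LHS]h.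
- by rewrite -addnn iterD symmi; exact: sqnn_ge0.
- rewrite -addnn -addnS iterD symmi iterS; apply: pos_ge0 pb.2 _; exact: bb.
Qed.

Lemma poly_cone_posA T : poly_cone T -> posA A T.
Proof.
elim=> [|r n S r0 _ ih]; first by split; [exact: star0|exact: pos0].
by apply: posA_add => //; apply: posA_scale => //; exact: iter_posA.
Qed.

(* The limit [s] of the iteration satisfies [(1 - s)^2 = 1 - b]. *)
Definition half_step x : V -> V := (2^-1)%:C%C *: (b + (x \o x)).
Definition sqrt_seq n := iter n half_step 0.

Lemma half_ge0 : 0 <= 2^-1 :> R. Proof. by rewrite invr_ge0. Qed.

Lemma poly_cone_b : poly_cone b.
Proof.
by have := poly_coneS 1 ler01 poly_cone0; rewrite rmorph1 scale1r addr0.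
Qed.

Lemma sqrt_seq_cone n : poly_cone (sqrt_seq n).
Proof.
elim: n => [|n ih]; first exact: poly_cone0.
rewrite /sqrt_seq iterS; apply: poly_coneZ half_ge0 _; apply: poly_coneD; first exact: poly_cone_b.
exact: poly_coneM.
Qed.

(** With s and s + d consecutive terms, the next difference is (s d + d s + d^2) / 2, again with
    nonnegative coefficients. Powers of b being positive, the sequence increases. *)
Lemma sqrt_seqB_cone n : poly_cone (sqrt_seq n.+1 - sqrt_seq n).
Proof.
elim: n => [|n ih]; first by rewrite subr0; exact: sqrt_seq_cone.
set d := sqrt_seq n.+1 - sqrt_seq n in ih; set s := sqrt_seq n in d ih *.
have sE : sqrt_seq n.+1 = s + d by rewrite /d addrC subrK.
have ls : linear s := star_linear sA (poly_cone_posA (sqrt_seq_cone n)).1.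
have ld : linear d := star_linear sA (poly_cone_posA ih).1.
have -> : sqrt_seq n.+2 - sqrt_seq n.+1 =
    (2^-1)%:C%C *: ((s \o d) + ((d \o s) + (d \o d))).
  rewrite {1}/sqrt_seq iterS -/(sqrt_seq n.+1) {2}/sqrt_seq iterS -/(sqrt_seq n) -/s sE.
  rewrite /half_step -scalerBr; congr (_ *: _); apply: funext => v.
  rewrite -[LHS]/(b v + (s (s v + d v) + d (s v + d v)) - (b v + s (s v))).
  rewrite -[RHS]/(s (d v) + (d (s v) + d (d v))) (linD ls) (linD ld).
  by rewrite opprD addrACA subrr add0r -(addrA (s (s v))) (addrC (s (s v))) addrK.
have cs := sqrt_seq_cone n.
apply: poly_coneZ half_ge0 _; apply: poly_coneD; first exact: poly_coneM.
by apply: poly_coneD; exact: poly_coneM.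
Qed.

Lemma sqrt_seq_norm n v : sqn (sqrt_seq n v) <= sqn v.
Proof.
elim: n v => [|n ih] v; first by rewrite /sqn rdot0l sqn_ge0.
rewrite /sqrt_seq iterS -/(sqrt_seq n) /half_step scale_app sqnZ /= expr0n addr0 add_app.
have h1 : sqn (b v) <= sqn v.
  apply: le_trans (_ : 1 * rdot (b v) v <= _); last by rewrite mul1r; exact: b1.
  by apply: (pos_sqn_le bb pb.2) => w; rewrite mul1r; exact: b1.
have h2 : sqn (sqrt_seq n (sqrt_seq n v)) <= sqn v by apply: le_trans (ih _) (ih _).
have := sqnD_le (b v) (sqrt_seq n (sqrt_seq n v)); rewrite /=; move: h1 h2.
move: (sqn _) (sqn _) (sqn _) (sqn _) => p q r s; lra.
Qed.

Lemma sqrt_seq_le n v : rdot (sqrt_seq n v) v <= 1 * sqn v.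
Proof.
have := sqrt_seq_norm n v; have := sqnn_ge0 (sqrt_seq n v - v); rewrite sqnB_eq.
move: (sqn (sqrt_seq n v)) (sqn v) (rdot _ _) => p q r; lra.
Qed.

Lemma sqrt_seq_mono m n : (m <= n)%N -> rle (sqrt_seq m) (sqrt_seq n).
Proof.
move=> /subnK <-; elim: (n - m)%N => [|k ih]; first exact: rle_refl.
apply: rle_trans ih _ => v; rewrite addSn -subr_ge0 -rdotBl -sub_app.
have [Ad pd] := poly_cone_posA (sqrt_seqB_cone (k + m)).
by apply: pos_ge0 => //; exact: bA.
Qed.

Lemma sqrt_fixpoint : exists s, [/\ posA A s, rle s idfun,
  s = half_step s & forall x, bounded_op x -> (forall v, x (b v) = b (x v)) ->
    forall v, x (s v) = s (x v)].
Proof.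
pose D := [set sqrt_seq n | n in [set: nat]].
have pD d : D d -> posA A d by move=> [n _ <-]; exact: poly_cone_posA (sqrt_seq_cone n).
have D0 : D !=set0 by exists (sqrt_seq 0), 0%N.
have dirD : rdirected D.
  move=> _ _ [m _ <-] [n _ <-]; exists (sqrt_seq (maxn m n)); first by exists (maxn m n).
  by split; apply: sqrt_seq_mono; rewrite ?leq_maxl ?leq_maxr.
have D1 d : D d -> forall v, rdot (d v) v <= 1 * sqn v by move=> [n _ <-]; exact: sqrt_seq_le.
have [s lim [bs ps ub]] := monotone_limit D0 (fun d Dd => bA (pD d Dd).1)
    (fun d Dd => (pD d Dd).2) dirD D1.
have As : A s.
  by apply: sot_limit_mem D0 dirD bs lim; [exact: (vna_closed vA)|move=> d /pD[]].
have near (l : seq V) e : 0 < e -> exists N : nat, forall n, (N <= n)%N ->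
    forall u, u \in l -> sqn (sqrt_seq n u - s u) < e.
  move=> e0; have [_ [N _ <-] hN] := sot_seq l D0 dirD lim e0; exists N => n Nn.
  by apply: hN; [exists n|exact: sqrt_seq_mono].
exists s; split=> //.
- move=> v; rewrite leNgt; apply/negP => lt.
  have [|_ [n _ <-] hn] := sot_rdot v v D0 dirD lim (e := rdot (s v) v - rdot v v).
    by rewrite subr_gt0.
  have := hn (sqrt_seq n) ltac:(by exists n) (rle_refl _); have := sqrt_seq_le n v.
  rewrite mul1r /sqn ltr_norml => h /andP[+ _]; move: lt h => /=.
  move: (rdot _ _) (rdot _ _) (rdot _ _) => p q r; lra.
- apply: funext => v; apply/eqP; rewrite -subr_eq0; apply/eqP/sqn_eq0/eqP.
  rewrite eq_le sqnn_ge0 andbT leNgt; apply/negP => q0.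
  set q := sqn _ in q0; have q1 : 0 < q / 12 by rewrite divr_gt0.
  have [n hn] := near [:: v; s v] _ q1.
  have i1 := hn n (leqnn n) v (mem_head _ _).
  have i2 := hn n (leqnn n) (s v) ltac:(by rewrite !inE eqxx orbT).
  have i3 := hn n.+1 (leqnSn n) v (mem_head _ _).
  set a := sqrt_seq n in i1 i2.
  have la : linear a := star_linear sA (poly_cone_posA (sqrt_seq_cone n)).1.
  have E : s v - half_step s v = (2^-1)%:C%C *: (a (a v - s v) + (a (s v) - s (s v)))
      - (sqrt_seq n.+1 v - s v).
    rewrite /sqrt_seq iterS -/(sqrt_seq n) -/a /half_step !scale_app !add_app /=.
    rewrite (linB la) addrA subrK opprB [RHS]addrC -addrA; congr (_ + _).
    by rewrite -!scalerN -scalerDr !opprD -addrA addKr.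
  have := sqnD_le ((2^-1)%:C%C *: (a (a v - s v) + (a (s v) - s (s v)))) (- (sqrt_seq n.+1 v - s v)).
  rewrite -E -/q sqnN sqnZ /= expr0n addr0.
  have := sqnD_le (a (a v - s v)) (a (s v) - s (s v)).
  have := sqrt_seq_norm n (a v - s v); rewrite -/a; move: i1 i2 i3.
  move: (sqn (a (a v - s v))) (sqn (a v - s v)) (sqn (a (s v) - _)) (sqn (sqrt_seq _ _ - _)) (sqn (_ + _)).
  clearbody q; move=> e f g h k; lra.
- move=> x bx xb v.
  have xs n w : x (sqrt_seq n w) = sqrt_seq n (x w).
    have lx := bounded_lin bx.
    elim: n w => [|n ih] w; first by rewrite /= lin0.
    rewrite /sqrt_seq iterS -/(sqrt_seq n) /half_step !scale_app !add_app /=.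
    by rewrite (linZ lx) (linD lx) xb !ih.
  apply/eqP; rewrite -subr_eq0; apply/eqP/sqn_eq0/eqP.
  rewrite eq_le sqnn_ge0 andbT leNgt; apply/negP => q0.
  set q := sqn _ in q0; have q1 : 0 < q / 4 by rewrite divr_gt0.
  have [d d0 hd] := bounded_small (s v) bx q1.
  have m0 : 0 < Num.min d (q / 4) by rewrite lt_min d0.
  have [n hn] := near [:: v; x v] _ m0.
  have := hn n (leqnn n) v (mem_head _ _).
  have := hn n (leqnn n) (x v) ltac:(by rewrite !inE eqxx orbT).
  rewrite !lt_min => /andP[_ i1] /andP[i2 _].
  have := hd (sqrt_seq n v) ltac:(by rewrite sqnB).
  have := sqnD_le (x (s v) - x (sqrt_seq n v)) (sqrt_seq n (x v) - s (x v)).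
  rewrite xs addrA subrK -/q; clearbody q; move: i1.
  move: (sqn _) (sqn _) => e f; lra.
Qed.

End Iteration.

Lemma pos_sqrt a : posA A a -> exists s, [/\ posA A s, s \o s = a &
  forall x, bounded_op x -> (forall v, x (a v) = a (x v)) -> forall v, x (s v) = s (x v)].
Proof.
move=> pa; have ba := bA pa.1; have [C C0 hC] := bounded_form ba.
have r0 : 0 <= C^-1 by rewrite invr_ge0 ltW.
pose z := (C^-1)%:C%C *: a.
have pz : posA A z by exact: posA_scale.
have z1 : rle z idfun.
  by move=> v; rewrite /z scale_app rdotZl ler_pdivrMl; [exact: hC|].
(* b = 1 - a / C; the fixpoint u satisfies (1 - u)^2 = a / C, so the root of a is sqrt C (1 - u). *)
have pb := posA_sub vA pz (posA_id vA) z1.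
have [|u [pu u1 uE uc]] := sqrt_fixpoint pb.
  by move=> v; rewrite sub_app rdotBl gerBl; apply: pos_ge0 pz.2 _; exact: bA pz.1.
have ps0 := posA_sub vA pu (posA_id vA) u1.
have lu := star_linear sA pu.1.
exists ((Num.sqrt C)%:C%C *: (idfun - u)); split.
- by apply: posA_scale => //; exact: sqrtr_ge0.
- have ls := star_linear sA ps0.1.
  apply: funext => v; rewrite /= !scale_app (linZ ls) scalerA -rmorphM /= -expr2 sqr_sqrtr ?(ltW C0) //.
  rewrite !sub_app (linB lu).
  have : (2 : R)%:C%C *: u v = v - z v + u (u v).
    rewrite {1}uE /half_step scale_app scalerA -rmorphM /= divff // rmorph1 scale1r.
    by rewrite add_app sub_app.
  rewrite rmorph_nat scaler_nat mulr2n /= => h.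
  have -> : v - u v - (u v - u (u v)) = z v.
    by rewrite opprB addrACA -opprD h [v - z v + _]addrAC subKr.
  by rewrite /z scale_app scalerA -rmorphM divff ?gt_eqF // rmorph1 scale1r.
- move=> x bx xa v; have lx := bounded_lin bx.
  rewrite !scale_app (linZ lx) !sub_app (linB lx) uc // => w.
  by rewrite !sub_app (linB lx) /z !scale_app (linZ lx) xa.
Qed.

End SquareRoot.

Section SmallProjections.
Context {R : realType} {V : hilbertType R}.
Variables (A : set (V -> V)) (fA : is_factor A) (tau : (V -> V) -> R[i])
  (ft : finite_trace A tau) (infA : ~ finite_dimensional A).
Implicit Types (u v w : V) (x y b c g h p q r S T t : V -> V).
Let vA : von_neumann_algebra A := fA.1.
Let sA := vna_star vA.
Let bA := star_bounded sA.
Let lA := star_linear sA.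
Let A1 := vna_unital vA.

Lemma projection_pos p : projection p -> pos_op p.
Proof.
by move=> [bp pp ap] v; rewrite -{1}pp /= adjP // ap hdot_sqn ler0c sqnn_ge0.
Qed.

Lemma projection_comp p v : projection p -> p (p v) = p v.
Proof. by move=> [_ pp _]; rewrite -{3}pp. Qed.

Lemma projection_symm p : projection p -> symm p.
Proof. by move=> [bp _ ap]; exact: adj_symm. Qed.

Lemma projection_sub p q : projection p -> projection q -> p \o q = q ->
  projection (p - q).
Proof.
move=> hp hq pq; have [bp pp ap] := hp; have [bq qq aq] := hq.
have qp : q \o p = q by rewrite -{1}aq -{1}ap -adj_comp // pq aq.
split; [exact: bounded_sub| |by rewrite adj_sub // ap aq].
apply: funext => v; have [lp lq] := (bounded_lin bp, bounded_lin bq).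
rewrite /= !sub_app (linB lp) (linB lq) (projection_comp v hp) (projection_comp v hq).
rewrite -[p (q v)]/((p \o q) v) -[q (p v)]/((q \o p) v) pq qp.
by rewrite subrr subr0.
Qed.

Lemma projection_trace_gt0 p : A p -> projection p -> p <> 0 -> 0 < Re (tau p).
Proof.
move=> Ap hp p0; have := trace_ge0 ft Ap (projection_pos hp).
rewrite lecE => /andP[/eqP im re]; rewrite lt_neqAle re andbT eq_sym; apply/eqP => r0.
apply: p0; apply: (trace_faithful ft) => //; first exact: projection_pos.
by apply/eqP; rewrite eq_complex r0 im !eqxx.
Qed.

(** Let a be the square root of x^2. The vectors of the range of q with a v = - x v form a subspace
    whose projection lies in A below q, so by minimality it is 0 or q. If it is q, then x = - a. If
    it is 0, then x = a, because a - x maps into this subspace: (a + x) (a - x) = 0. *)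
Lemma real_dichotomy q x : A q -> projection q ->
  (forall r, A r -> projection r -> q \o r = r -> r = 0 \/ r = q) ->
  A x -> symm x -> (forall v, x (q v) = x v) ->
  rle x 0 \/ rle 0 x.
Proof.
move=> Aq hq minq Ax sx xq; have [bq _ aq] := hq.
have bx := bA Ax; have lx := bounded_lin bx; have lq := bounded_lin bq.
have pa : posA A (x \o x).
  by have := posA_square vA Ax; rewrite (symm_adj lx sx).
have [a [pa0 aE ac]] := pos_sqrt vA pa.
have ba := bA pa0.1; have la := bounded_lin ba.
have sa := posA_symm vA pa0.
have xa v : x (a v) = a (x v) by apply: ac.
have aa v : a (a v) = x (x v) by have /(congr1 (fun f => f v)) := aE.
have aq0 v : a (q v) = a v.
  apply/eqP; rewrite -subr_eq0 -linB //; apply/eqP/sqn_eq0.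
  by rewrite /sqn sa aa -sx linB // xq subrr rdot0l.
have qa v : q (a v) = a v.
  by apply: rdot_inj => w; rewrite (projection_symm hq) !sa aq0.
have qx v : q (x v) = x v.
  by apply: rdot_inj => w; rewrite (projection_symm hq) !sx xq.
pose H := [set v | a v + x v = 0 /\ q v = v].
have sH : subspace H.
  split; first by split; [rewrite (lin0 la) (lin0 lx) addr0|exact: lin0].
  move=> z u v [u1 u2] [v1 v2]; split; last by rewrite lq u2 v2.
  by rewrite la lx addrACA -scalerDr u1 v1 scaler0 addr0.
have cH v : closure H v -> H v.
  move=> cv; split.
    by apply: (ker_closure (bounded_add ba bx) _ cv) => h [].
  apply/eqP; rewrite -subr_eq0; apply/eqP.
  apply: (ker_closure (bounded_sub bq bounded_id) _ cv) => h [_ /= hh].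
  by rewrite sub_app hh subrr.
have [r rH] := proj_exists sH.
have Ar : A r.
  apply: (proj_in_vna vA sH rH) => t [bt ct] v [v1 v2]; split; last by rewrite ct // v2.
  by rewrite (ct a pa0.1) (ct x Ax) -(linD (bounded_lin bt)) v1 lin0 //; exact: bounded_lin.
have hr : projection r.
  split; [exact: proj_bounded rH| |exact: proj_adj rH].
  by apply: funext => v; exact: (proj_idem sH rH).
have Hr v : H (r v) by apply: cH; exact: (proj_mem rH).
have qr : q \o r = r by apply: funext => v; have [] := Hr v.
have [r0|rq] := minq r Ar hr qr.
  right => v; rewrite rdot0l.
  have ax : a v - x v = 0.
    have Hm : H (a v - x v).
      split; last by rewrite linB // qa qx.
      by rewrite (linB la) (linB lx) aa xa addrC addrA subrK subrr.
    by have := proj_fix sH rH (subset_closure Hm); rewrite r0 => <-.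
  move/eqP: ax; rewrite subr_eq0 => /eqP <-.
  by apply: pos_ge0 pa0.2 _.
left => v; rewrite rdot0l.
have ax : a v + x v = 0.
  by have [+ _] := Hr v; rewrite rq aq0 xq.
move/eqP: ax; rewrite addrC addr_eq0 => /eqP ->.
by rewrite rdotNl oppr_le0; apply: pos_ge0 pa0.2 _.
Qed.

(** By the dichotomy for x - s q, the operator x = q h q is comparable with s q for every real s;
    the supremum of the s with s q <= x is the scalar. *)
Lemma minimal_corner_symm q h : A q -> projection q -> q <> 0 ->
  (forall r, A r -> projection r -> q \o r = r -> r = 0 \/ r = q) ->
  A h -> symm h -> exists s : R, q \o h \o q = s%:C%C *: q.
Proof.
move=> Aq hq q0 minq Ah sh; have [bq qq aq] := hq.
pose x := q \o h \o q.
have sq := projection_symm hq.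
have Ax : A x by apply: star_comp => //; exact: star_comp.
have sx : symm x by move=> u v; rewrite /x /= sq sh sq.
have [v0 hv0] : exists v, q v <> 0.
  apply: contrapT => no; apply: q0; apply: funext => v; apply: contrapT => h0.
  by apply: no; exists v.
have qv0 : 0 < rdot (q v0) v0.
  rewrite -(projection_comp v0 hq) sq lt_neqAle sqn_ge0 andbT eq_sym.
  by apply/eqP => /sqn_eq0.
have dich (s : R) : rle x (s%:C%C *: q) \/ rle (s%:C%C *: q) x.
  have [|||h1|h1] := real_dichotomy (x := x - s%:C%C *: q) Aq hq minq.
  - by apply: star_sub => //; exact: star_scale.
  - by move=> u v; rewrite !sub_app !scale_app rdotBl rdotBr sx rdotZl rdotZr sq.
  - by move=> v; rewrite !sub_app !scale_app /x /= (projection_comp v hq).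
  - by left => v; have := h1 v; rewrite rdot0l sub_app rdotBl subr_le0.
  - by right => v; have := h1 v; rewrite rdot0l sub_app rdotBl subr_ge0.
pose Z := [set s : R | rle (s%:C%C *: q) x].
have ubZ s : Z s -> s <= rdot (x v0) v0 / rdot (q v0) v0.
  by move=> /(_ v0); rewrite scale_app rdotZl ler_pdivlMr.
have qge v : 0 <= rdot (q v) v by apply: pos_ge0 => //; exact: projection_pos.
have hsup : has_sup Z.
  split; last by exists (rdot (x v0) v0 / rdot (q v0) v0).
  have [C C0 hC] := bounded_form (bounded_opp (bA Ah)).
  exists (- C) => v; rewrite scale_app rdotZl /x /= (sq (h (q v))).
  have := hC (q v); rewrite rdotNl /sqn -(sq (q v)) (projection_comp v hq).
  by move: (rdot (q v) v) (rdot _ _) => a b; lra.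
pose s0 := sup Z; exists s0.
have le1 v : s0 * rdot (q v) v <= rdot (x v) v.
  have [qv|qv] := eqVneq (rdot (q v) v) 0.
    rewrite qv mulr0; have [s Zs] := hsup.1.
    by have := Zs v; rewrite scale_app rdotZl qv mulr0.
  have qp : 0 < rdot (q v) v by rewrite lt_neqAle eq_sym qv qge.
  rewrite -ler_pdivlMr //; apply: ge_sup; first exact: hsup.1.
  by move=> s Zs; rewrite ler_pdivlMr //; have := Zs v; rewrite scale_app rdotZl.
have le2 v : rdot (x v) v <= s0 * rdot (q v) v.
  rewrite leNgt; apply/negP => lt.
  have [qv|qv] := eqVneq (rdot (q v) v) 0.
    have := dich (s0 + 1); case=> [/(_ v)|Zs].
      by rewrite scale_app rdotZl qv mulr0 leNgt; move: lt; rewrite qv mulr0 => ->.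
    by have := sup_upper_bound hsup Zs; rewrite -/s0; lra.
  have qp : 0 < rdot (q v) v by rewrite lt_neqAle eq_sym qv qge.
  pose e := (rdot (x v) v - s0 * rdot (q v) v) / rdot (q v) v / 2.
  have e0 : 0 < e by rewrite !divr_gt0 // subr_gt0.
  have [/(_ v)|Zs] := dich (s0 + e).
    rewrite scale_app rdotZl.
    have : e * rdot (q v) v * 2 = rdot (x v) v - s0 * rdot (q v) v by rewrite /e; field.
    have := mulr_gt0 e0 qp; clearbody e; clear -lt; clearbody s0.
    by move: (rdot (x v) v) (rdot (q v) v) => a b; lra.
  by have := sup_upper_bound hsup Zs; rewrite -/s0; lra.
have Asq : A (s0%:C%C *: q) by exact: star_scale.
apply: rle_antisym; [exact: bA|exact: bA|exact: sx| | |].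
- by move=> u v; rewrite !scale_app rdotZl rdotZr sq.
- by move=> v; rewrite scale_app rdotZl; exact: le2.
- by move=> v; rewrite scale_app rdotZl; exact: le1.
Qed.

Lemma minimal_corner q h : A q -> projection q -> q <> 0 ->
  (forall r, A r -> projection r -> q \o r = r -> r = 0 \/ r = q) ->
  A h -> exists s : R[i], q \o h \o q = s *: q.
Proof.
move=> Aq hq q0 minq Ah; have bh := bA Ah; have Ah' := star_adj sA Ah.
have [bq _ _] := hq; have lq := bounded_lin bq.
have key y : A y -> exists s : R, q \o (1 *: y + adjoint y) \o q = s%:C%C *: q.
  move=> Ay; have bY := bA Ay; apply: minimal_corner_symm => //.
    by apply: star_lincomb => //; exact: star_adj.
  by move=> u v; rewrite scale1r !add_app rdotDl rdotDr radjP // radjPl // addrC.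
have [s1 h1] := key h Ah; have [s2 h2] := key _ (star_scale sA 'i%C Ah).
rewrite adj_scale // in h2.
(* Solves q h q + q h^* q = s1 q and i q h q - i q h^* q = s2 q for q h q. *)
exists (2^-1 * (s1%:C%C - 'i%C * s2%:C%C)); apply: funext => v.
have := congr1 (fun f => f v) h1; have := congr1 (fun f => f v) h2.
rewrite /= !scale_app !scale1r !add_app !scale_app !(linD lq) !(linZ lq).
set a := q (h (q v)); set b := q (adjoint h (q v)) => e2 e1.
have e3 : 'i%C *: (s2%:C%C *: q v) = b - a.
  rewrite -e2 scalerDr !scalerA -expr2 sqr_i (_ : 'i%C * ('i%C)^* = 1).
    by rewrite scaleN1r scale1r addrC.
  by rewrite conjCE; apply/eqP; rewrite eq_complex /=; apply/andP; split; apply/eqP; ring.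
rewrite -scalerA scalerBl -e1 -(scalerA 'i%C) e3 opprB addrACA subrr addr0.
by rewrite -mulr2n -[a *+ 2]scaler_nat scalerA mulVf ?scale1r // pnatr_eq0.
Qed.

(* [x i \o q] are partial isometries with orthogonal ranges. *)
Definition matrix_units q n (x : nat -> V -> V) :=
  (forall i, (i < n)%N -> A (x i)) /\
  forall i j, (i < n)%N -> (j < n)%N ->
    q \o adjoint (x i) \o x j \o q = if i == j then q else 0.

Definition units_sum q n (x : nat -> V -> V) :=
  \sum_(i < n) (x i \o q \o adjoint (x i)).

Lemma star_sum (I : finType) (F : I -> V -> V) : (forall i, A (F i)) -> A (\sum_i F i).
Proof.
by move=> h; elim/big_ind: _ => //; [exact: star0|move=> x y; exact: star_add].
Qed.

Lemma sum_app (I : finType) (F : I -> V -> V) v : (\sum_i F i) v = \sum_i F i v.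
Proof. by rewrite fct_sumE. Qed.

Section Units.
Variables (q : V -> V) (n : nat) (x : nat -> V -> V).
Hypotheses (Aq : A q) (hq : projection q) (hx : matrix_units q n x).
Let f := units_sum q n x.
Let lq := lA Aq.

Lemma units_sum_mem : A f.
Proof.
apply: star_sum => i; have Ai := hx.1 i (ltn_ord i).
by apply: star_comp => //; [exact: star_comp|exact: star_adj].
Qed.

Lemma units_adj_sum i v : (i < n)%N -> q (adjoint (x i) (f v)) = q (adjoint (x i) v).
Proof.
move=> ni; have li : linear (adjoint (x i)) by apply: lA; apply: star_adj => //; exact: hx.1.
rewrite /f /units_sum sum_app.
rewrite (big_morph (adjoint (x i)) (linD li) (lin0 li)) (big_morph q (linD lq) (lin0 lq)).
rewrite (bigD1 (Ordinal ni)) //= big1 ?addr0.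
  have /(congr1 (fun g => g (adjoint (x i) v))) := hx.2 i i ni ni.
  by rewrite eqxx.
move=> j ji; have /(congr1 (fun g => g (adjoint (x j) v))) := hx.2 i j ni (ltn_ord j).
by rewrite ifF //; apply/negP => /eqP ij; case/eqP: ji; apply: val_inj.
Qed.

Lemma units_sum_idem v : f (f v) = f v.
Proof.
rewrite {1}/f /units_sum sum_app [in RHS]/f /units_sum sum_app.
by apply: eq_bigr => i _; congr (x i _); exact: units_adj_sum.
Qed.

Lemma units_sum_symm : symm f.
Proof.
move=> u v; rewrite /f /units_sum !sum_app.
have rs (F : 'I_n -> V) w : rdot (\sum_i F i) w = \sum_i rdot (F i) w.
  by apply: (big_morph (fun z => rdot z w)); [move=> a b; exact: rdotDl|exact: rdot0l].
rewrite rs rdotC rs; apply: eq_bigr => i _ /=.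
have bi := bA (hx.1 i (ltn_ord i)).
by rewrite radjP // (projection_symm hq) [RHS]radjP // rdotC.
Qed.

Lemma units_sum_projection : projection f.
Proof.
have bf := bA units_sum_mem; split=> //; last exact: symm_adj (bounded_lin bf) units_sum_symm.
by apply: funext => v; exact: units_sum_idem.
Qed.

(** The projections x_i q x_i^* are orthogonal, their sum is a projection below 1, and each has
    trace tau (q x_i^* x_i) = tau q. *)
Lemma units_count : n%:R * Re (tau q) <= Re (tau idfun).
Proof.
have nF := trace_functional vA ft.
have p1 : projection (idfun : V -> V) by split=> //; [exact: bounded_id|exact: adj_id].
have hf := units_sum_projection.
have h1f : projection (idfun - f) by apply: projection_sub.
have A1f : A (idfun - f) by apply: star_sub => //; exact: units_sum_mem.
have := nf_ge0 nF (conj A1f (projection_pos h1f)).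
rewrite (nf_sub vA nF A1 units_sum_mem) subr_ge0; apply: le_trans.
suff -> : Re (tau f) = n%:R * Re (tau q) by [].
pose F (m : nat) := units_sum q m x.
suff h m : (m <= n)%N -> A (F m) /\ Re (tau (F m)) = m%:R * Re (tau q) by have [] := h n (leqnn n).
elim: m => [_|m ih mn].
  rewrite /F /units_sum big_ord0 mul0r; split; [exact: star0|exact: (nf0 vA nF)].
have [AF hF] := ih (ltnW mn).
have Am := hx.1 m mn; have Am' := star_adj sA Am; have Aqm := star_comp sA Aq Am'.
rewrite /F /units_sum big_ord_recr /=; split.
  by apply: star_add => //; apply: star_comp => //; exact: star_comp.
rewrite (nf_add nF) //; last by apply: star_comp => //; exact: star_comp.
have -> : tau (x m \o q \o adjoint (x m)) = tau (q \o adjoint (x m) \o x m).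
  exact: (trace_comm ft Am Aqm).
have -> : tau (q \o adjoint (x m) \o x m) = tau q.
  have Aqq := star_comp sA Aqm Am.
  have /(congr1 tau) := hx.2 m m mn mn; rewrite eqxx => <-.
  rewrite [RHS](trace_comm ft Aqq Aq).
  by congr tau; apply: funext => v /=; rewrite projection_comp.
rewrite hF.
by rewrite -natr1 mulrDl mul1r.
Qed.

End Units.

(** Inserting the sum 1 on both sides, y is the sum of the x_i q x_i^* y x_j q x_j^*, and each q
    x_i^* y x_j q is a multiple of q. *)
Lemma units_span q n (x : nat -> V -> V) : A q -> projection q -> matrix_units q n x ->
  units_sum q n x = idfun ->
  (forall h, A h -> exists s : R[i], q \o h \o q = s *: q) ->
  finite_dimensional A.
Proof.
move=> Aq hq hx f1 minq; have lq := lA Aq.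
pose b (i : 'I_#|{: 'I_n * 'I_n}|) : V -> V :=
  x (enum_val i).1 \o q \o adjoint (x (enum_val i).2).
exists #|{: 'I_n * 'I_n}|, b => y Ay.
have /choice[s hs] : forall ij : 'I_n * 'I_n, exists s : R[i],
    q \o (adjoint (x ij.1) \o y \o x ij.2) \o q = s *: q.
  move=> [i j]; apply: minq; apply: star_comp; [done| |exact: hx.1].
  by apply: star_comp => //; apply: star_adj => //; exact: hx.1.
exists (fun i => s (enum_val i)); apply: funext => v.
have lx i : (i < n)%N -> linear (x i) by move=> ni; apply: lA; exact: hx.1.
have lx' i : (i < n)%N -> linear (adjoint (x i)).
  by move=> ni; apply: lA; apply: star_adj => //; exact: hx.1.
have ly := lA Ay.
have dec w : w = \sum_(i < n) x i (q (adjoint (x i) w)).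
  by rewrite -{1}[w]/(idfun w) -f1 /units_sum sum_app.
pose G (ij : 'I_n * 'I_n) := s ij *: x ij.1 (q (adjoint (x ij.2) v)).
rewrite [LHS]dec sum_app; transitivity (\sum_(i < n) \sum_(j < n) G (i, j)); last first.
  rewrite pair_bigA /=; transitivity (\sum_(ij in {: 'I_n * 'I_n}) G ij).
    by apply: eq_bigr => -[i j].
  exact: (big_enum_val (A := {: 'I_n * 'I_n}) G).
apply: eq_bigr => i _; rewrite {1}(dec v).
rewrite (big_morph y (linD ly) (lin0 ly)).
rewrite (big_morph (adjoint (x i)) (linD (lx' _ (ltn_ord i))) (lin0 (lx' _ (ltn_ord i)))).
rewrite (big_morph q (linD lq) (lin0 lq)).
rewrite (big_morph (x i) (linD (lx _ (ltn_ord i))) (lin0 (lx _ (ltn_ord i)))).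
apply: eq_bigr => j _; rewrite /G /= -(linZ (lx _ (ltn_ord i))); congr (x i _).
have /(congr1 (fun g => g (adjoint (x j) v))) := hs (i, j).
by rewrite scale_app.
Qed.

(** If q were minimal, matrix units could be enlarged indefinitely: unless their sum f is 1, which
    would make A finite-dimensional, some (1 - f) u q is nonzero and, rescaled, is one more unit.
    But n tau q <= tau 1 bounds their number. *)
Lemma proper_subprojection q : A q -> projection q -> q <> 0 ->
  exists r, [/\ A r, projection r, q \o r = r, r <> 0 & r <> q].
Proof.
move=> Aq hq q0; apply: contrapT => no.
have minr r : A r -> projection r -> q \o r = r -> r = 0 \/ r = q.
  move=> Ar hr qr; apply: contrapT => /not_orP[r0 rq]; apply: no; by exists r.
have minq h : A h -> exists s : R[i], q \o h \o q = s *: q.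
  by move=> Ah; exact: minimal_corner.
have [bq _ aq] := hq; have lq := bounded_lin bq.
have ex n : exists x : nat -> V -> V, matrix_units q n x.
  elim: n => [|n [x hx]]; first by exists (fun _ => 0); split.
  have [f1|f1] := pselect (units_sum q n x = idfun).
    by exfalso; apply: infA; exact: units_span f1 minq.
  set f := units_sum q n x in f1.
  have hf := units_sum_projection Aq hq hx; have Af := units_sum_mem Aq hx.
  have A1f : A (idfun - f) by exact: star_sub.
  have h1f : projection (idfun - f).
    by apply: projection_sub => //; split=> //; [exact: bounded_id|exact: adj_id].
  have [|u Au fuq] := factor_prime vA fA A1f Aq _ q0.
    by move=> /eqP; rewrite subr_eq0 => /eqP e; apply: f1.
  pose y := (idfun - f) \o u \o q.
  have Ay : A y by apply: star_comp => //; exact: star_comp.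
  have bY := bA Ay.
  have [s hs] := minq _ (star_comp sA (star_adj sA Ay) Ay).
  have yq v : y (q v) = y v by rewrite /y /= projection_comp.
  (* Evaluating q y^* y q = s q at v shows that s is |y v|^2 / |q v|^2 wherever q v <> 0, so s is
     positive. *)
  have sE v : (sqn (y v))%:C%C = s * (sqn (q v))%:C%C.
    rewrite -!hdot_sqn -{1 2}yq -adjPl // -[X in hdot _ X](projection_comp v hq).
    rewrite -(symm_hdot _ _ lq (projection_symm hq)).
    have /(congr1 (fun g => g v)) := hs; rewrite /= => ->.
    by rewrite scale_app hdotZl.
  have [v1 yv1] : exists v, y v <> 0.
    apply: contrapT => no'; apply: fuq; apply: funext => v; apply: contrapT => h.
    by apply: no'; exists v.
  have sy0 : 0 < sqn (y v1) by rewrite lt_neqAle sqnn_ge0 andbT eq_sym; apply/eqP => /sqn_eq0.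
  have sq0 : 0 < sqn (q v1).
    rewrite lt_neqAle sqnn_ge0 andbT eq_sym; apply/eqP => e.
    by have := sE v1; rewrite e mulr0 => -[e']; rewrite e' ltxx in sy0.
  pose c := sqn (y v1) / sqn (q v1).
  have c0 : 0 < c by exact: divr_gt0.
  have sc : s = c%:C%C.
    apply: (mulIf (x := (sqn (q v1))%:C%C)); last by rewrite -sE -rmorphM /= /c mulfVK // gt_eqF.
    by rewrite eq_complex /= eqxx andbT gt_eqF.
  pose d := (Num.sqrt c)^-1; have dd : d * d * c = 1.
    by rewrite /d -invfM -expr2 sqr_sqrtr ?(ltW c0) // mulVf // gt_eqF.
  pose z := d%:C%C *: y.
  have Az : A z by exact: star_scale.
  have bz := bA Az.
  have zz v : q (adjoint z (z (q v))) = q v.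
    rewrite /z adj_scale // conj_realC !scale_app (linZ (lA (star_adj sA Ay))) !(linZ lq) scalerA.
    have /(congr1 (fun g => g v)) := hs; rewrite /= => ->.
    by rewrite scale_app scalerA sc -!rmorphM /= dd rmorph1 scale1r.
  have xz i v : (i < n)%N -> q (adjoint (x i) (z (q v))) = 0.
    move=> ni; have li : linear (adjoint (x i)) by apply: lA; apply: star_adj => //; exact: hx.1.
    rewrite /z scale_app (linZ li) (linZ lq) yq /y /= sub_app (linB li) (linB lq).
    by rewrite (units_adj_sum Aq hx) // subrr scaler0.
  have zx i v : (i < n)%N -> q (adjoint z (x i (q v))) = 0.
    move=> ni; have bi := bA (hx.1 i ni); apply: hdot_inj => w.
    rewrite (symm_hdot _ _ lq (projection_symm hq)) adjPl // adjP //.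
    rewrite (symm_hdot _ _ lq (projection_symm hq)) xz //.
    by rewrite hdot0r hdot0l.
  exists (fun i => if (i < n)%N then x i else z); split.
    by move=> i _; case: ifP => // ni; exact: hx.1.
  move=> i j; rewrite !ltnS => ni nj; have [ni'|ni'] := ltnP i n; have [nj'|nj'] := ltnP j n.
  - exact: hx.2.
  - rewrite ltn_eqF ?(leq_trans ni') //; apply: funext => v; exact: xz.
  - rewrite gtn_eqF ?(leq_trans nj') //; apply: funext => v; exact: zx.
  - rewrite (_ : i == j); first by apply: funext => v; exact: zz.
    by rewrite eqn_leq (leq_trans ni) // (leq_trans nj).
have tq := projection_trace_gt0 Aq hq q0.
have [x hx] := ex (Num.truncn (Re (tau idfun) / Re (tau q))).+1.
have := units_count Aq hq hx; rewrite -ler_pdivlMr // leNgt.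
by rewrite truncnS_gt.
Qed.

(** If p is a proper nonzero subprojection of r, one of p and r - p has at most half the trace of r.
    The induction keeps the weaker bound tau r <= tau q / (n + 1), since 2 (n + 1) >= n + 2. *)
Theorem small_projection q e : A q -> projection q -> q <> 0 -> 0 < e ->
  exists r, [/\ A r, projection r, q \o r = r, r <> 0 & Re (tau r) < e].
Proof.
move=> Aq hq q0 e0.
have nF := trace_functional vA ft.
have halve n : exists r, [/\ A r, projection r, q \o r = r, r <> 0 &
    n.+1%:R * Re (tau r) <= Re (tau q)].
  elim: n => [|n [r [Ar hr qr r0 hn]]].
    exists q; split=> //; [by case: hq|by rewrite mul1r].
  have [p [Ap hp rp p0 pr]] := proper_subprojection Ar hr r0.
  have qp : q \o p = p by rewrite -rp -[LHS]/((q \o r) \o p) qr.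
  have hrp := projection_sub hr hp rp.
  have Arp : A (r - p) by exact: star_sub.
  have rp0 : r - p <> 0 by move=> /eqP; rewrite subr_eq0 => /eqP /esym.
  have sum : Re (tau (r - p)) = Re (tau r) - Re (tau p) by rewrite (nf_sub vA nF).
  have t1 := projection_trace_gt0 Ap hp p0; have t2 := projection_trace_gt0 Arp hrp rp0.
  have small g : Re (tau g) <= Re (tau r) / 2 -> 0 < Re (tau r) -> n.+2%:R * Re (tau g) <= Re (tau q).
    move=> hg tr; apply: le_trans hn; apply: le_trans (_ : n.+2%:R * (Re (tau r) / 2) <= _).
      by rewrite ler_wpM2l.
    rewrite mulrCA mulrC ler_wpM2r ?(ltW tr) // ler_pdivrMr // -natrM ler_nat.
    by rewrite muln2 doubleS !ltnS -addnn leq_addr.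
  have tr : 0 < Re (tau r) by exact: projection_trace_gt0.
  have [h|h] := leP (Re (tau p)) (Re (tau r) / 2).
    by exists p; split=> //; exact: small.
  exists (r - p); split=> //.
    apply: funext => v; have [bq _ _] := hq; rewrite /= sub_app (linB (bounded_lin bq)).
    by rewrite -[q (r v)]/((q \o r) v) -[q (p v)]/((q \o p) v) qr qp.
  apply: small => //; rewrite sum; move: h; move: (Re (tau p)) (Re (tau r)) => a b; lra.
have [r [Ar hr qr r0 h]] := halve (Num.truncn (Re (tau q) / e)).
exists r; split=> //.
have t0 := projection_trace_gt0 Ar hr r0.
have : Re (tau q) / e < (Num.truncn (Re (tau q) / e)).+1%:R by exact: truncnS_gt.
rewrite ltr_pdivrMr // => h2; have := le_lt_trans h h2.
by rewrite ltr_pM2l ?ltr0n.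
Qed.

End SmallProjections.

(** * Generators of the basic construction *)

Section Wstar.
Context {R : realType} {V : hilbertType R}.
Implicit Types (A X : set (V -> V)).

Lemma bounded_star : star_subalgebra (@bounded_op R V).
Proof.
split=> //.
- exact: bounded0.
- by move=> a x y; exact: bounded_lincomb.
- exact: bounded_comp.
- exact: bounded_adj.
Qed.

Lemma Wstar_sub X : X `<=` Wstar X. Proof. by move=> x Xx A _ _; apply. Qed.

Lemma Wstar_min X A : star_subalgebra A -> wot_closed A -> X `<=` A -> Wstar X `<=` A.
Proof. by move=> sA cA XA x; apply. Qed.

Lemma Wstar_closed X : wot_closed (Wstar X).
Proof.
move=> T bT lim A sA cA XA; apply: (cA T bT) => s e e0.
by have [S WS hS] := lim s e e0; exists S => //; exact: (WS A sA cA XA).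
Qed.

Lemma Wstar_star X : X `<=` @bounded_op R V -> star_subalgebra (Wstar X).
Proof.
move=> bX; split.
- by apply: Wstar_min => //; exact: bounded_star.
- by move=> A sA _ _; exact: star0.
- by move=> a x y Wx Wy A sA cA XA; apply: star_lincomb => //; [exact: (Wx A sA cA XA)|exact: (Wy A sA cA XA)].
- by move=> x y Wx Wy A sA cA XA; apply: star_comp => //; [exact: (Wx A sA cA XA)|exact: (Wy A sA cA XA)].
- by move=> x Wx A sA cA XA; apply: star_adj => //; exact: (Wx A sA cA XA).
Qed.

End Wstar.

Section BasicConstructionGenerators.
Context {R : realType} {K L : hilbertType R}.
Variables (N M : set (K -> K)) (tau : (K -> K) -> R[i]) (eta : (K -> K) -> L) (eN : L -> L).
Hypotheses (fN : is_factor N) (fM : is_factor M) (NM : N `<=` M)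
  (ft : finite_trace M tau) (tau1 : tau idfun = 1) (hL : is_L2 M tau eta)
  (pN : L2_projection N eta eN).
Implicit Types (x y z : K -> K) (S T t : L -> L) (u v w : L).
Let vM : von_neumann_algebra M := fM.1.
Let sM := vna_star vM.
Let vN : von_neumann_algebra N := fN.1.
Let sN := vna_star vN.
Local Notation lam := (lam M eta).
Local Notation rho := (rho M eta).
Local Notation xi := (xi eta).
Let lamB := lam_bounded vM ft hL.
Let rhoB := rho_bounded vM ft hL.
Let lamEe := lamE vM ft hL.
Let rhoEe := rhoE vM ft hL.
Let lamA := lam_adj vM ft hL.

Let eta_sub := eta_subspace vM hL sN NM.

Lemma jones_proj : proj_on (eta @` N) eN.
Proof.
have [p pH] := proj_exists eta_sub.
suff -> : eN = p by [].
apply: funext => v; have [h1 h2] := pN v.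
apply: (proj_uniq (v := v) eta_sub) => //.
- exact: (proj_mem pH).
- by move=> h Hh; rewrite hdotC h2 ?rmorph0 //; exact: subset_closure.
- by move=> h Hh; exact: (proj_orth pH).
Qed.

Lemma jones_proj_lam x u : N x -> eN (lam x u) = lam x (eN u).
Proof.
move=> Nx; have Mx := NM Nx; apply: (proj_commute eta_sub jones_proj).
- exact: lamB.
- by move=> _ [y Ny <-]; rewrite lamEe //; [exists (x \o y) => //; exact: star_comp|exact: NM].
- move=> _ [y Ny <-]; rewrite lamA // lamEe; [|exact: star_adj|exact: NM].
  by exists (adjoint x \o y) => //; apply: star_comp => //; exact: star_adj.
Qed.

Lemma jones_proj_rho x u : N x -> eN (rho x u) = rho x (eN u).
Proof.
move=> Nx; have Mx := NM Nx; apply: (proj_commute eta_sub jones_proj).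
- exact: rhoB.
- by move=> _ [y Ny <-]; rewrite rhoEe //; [exists (y \o x) => //; exact: star_comp|exact: NM].
- move=> _ [y Ny <-]; rewrite (rho_adj vM ft hL) // rhoEe; [|exact: star_adj|exact: NM].
  by exists (y \o adjoint x) => //; apply: star_comp => //; exact: star_adj.
Qed.

Let bE := proj_bounded jones_proj.
Let lE := bounded_lin bE.
Let EE v : eN (eN v) = eN v. Proof. exact: (proj_idem eta_sub jones_proj). Qed.
Let sE u v : hdot (eN u) v = hdot u (eN v). Proof. exact: (proj_sym jones_proj). Qed.

Section Corner.
Variables (q : K -> K).
Hypotheses (Mq : M q) (hq : projection q) (q0 : q <> 0).
Let k : L -> L := eN \o lam q \o eN.

(* The kernel is an [N]-[N] subbimodule of [L^2(N)], so it is trivial. *)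
Lemma corner_kernel (z : L) : eN z = z -> (forall x, N x -> k (lam x z) = 0) -> z = 0.
Proof.
move=> Ez kz; have bq := lamB Mq; have lq := bounded_lin bq.
have bk : bounded_op k by apply: bounded_comp bE; exact: bounded_comp.
have lk := bounded_lin bk.
pose H := [set z : L | eN z = z /\ forall x, N x -> k (lam x z) = 0].
have llam x : N x -> linear (lam x) by move=> /NM/lamB/bounded_lin.
have sH : subspace H.
  split; first by split=> [|x Nx]; rewrite ?(lin0 lE) // (lin0 (llam x Nx)) (lin0 lk).
  move=> c u v [u1 u2] [v1 v2]; split=> [|x Nx]; first by rewrite lE u1 v1.
  by rewrite (llam x Nx) lk u2 // v2 // scaler0 addr0.
have cH v : closure H v -> H v.
  move=> cv; split.
    apply/eqP; rewrite -subr_eq0; apply/eqP.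
    apply: (ker_closure (bounded_sub bE bounded_id) _ cv) => h [hh _].
    by rewrite sub_app hh subrr.
  move=> x Nx; apply: (ker_closure (bounded_comp bk (lamB (NM Nx))) _ cv) => h [_ hh].
  exact: hh.
have [p pH] := proj_exists sH.
have lamH x h : N x -> H h -> H (lam x h).
  move=> Nx [h1 h2]; split; first by rewrite jones_proj_lam // h1.
  move=> y Ny; have := h2 (y \o x) (star_comp sN Ny Nx).
  by rewrite (lam_comp vM ft hL (NM Ny) (NM Nx)).
have rhoH x h : N x -> H h -> H (rho x h).
  move=> Nx [h1 h2]; have Mx := NM Nx; split; first by rewrite jones_proj_rho // h1.
  move=> y Ny; rewrite (lam_rho vM ft hL) //; last exact: NM.
  rewrite /k /= jones_proj_rho // (lam_rho vM ft hL) // jones_proj_rho //.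
  rewrite -[eN (lam q _)]/(k (lam y h)) h2 //.
  by rewrite lin0 //; exact: bounded_lin (rhoB Mx).
have pl x : N x -> forall u, p (lam x u) = lam x (p u).
  move=> Nx; have Mx := NM Nx; apply: (proj_commute sH pH); first exact: lamB.
    by move=> h; exact: lamH.
  by move=> h; rewrite lamA //; apply: lamH; exact: star_adj.
have pr x : N x -> forall u, p (rho x u) = rho x (p u).
  move=> Nx; have Mx := NM Nx; apply: (proj_commute sH pH); first exact: rhoB.
    by move=> h; exact: rhoH.
  by move=> h; rewrite (rho_adj vM ft hL) //; apply: rhoH; exact: star_adj.
have [|h|h] := bimodule_projection vM ft tau1 hL fN NM (proj_bounded pH)
    (proj_sym pH) (proj_idem sH pH) pl pr.
- have [<- _] : H (p xi) by apply: cH; exact: (proj_mem pH).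
  exact: (proj_mem jones_proj).
- have <- : p z = z by apply: (proj_fix sH pH); apply: subset_closure.
  have cz : closure (eta @` N) z by rewrite -Ez; exact: (proj_mem jones_proj).
  by apply: (ker_closure (proj_bounded pH) _ cz) => _ [x Nx <-]; exact: h.
(* If p fixes eta (N), then xi is in H and tau q = <k xi, xi> = 0, against faithfulness of tau and q
   <> 0. *)
- exfalso; have N1 := vna_unital vN.
  have [xi1 xi2] : H xi by rewrite -[xi]h //; apply: cH; exact: (proj_mem pH).
  have := xi2 idfun N1; rewrite (lam_id vM ft hL) /k /= xi1 => kxi.
  have : hdot (lam q xi) xi = 0 by rewrite -{2}xi1 -sE kxi hdot0l.
  rewrite (lam_xi vM ft hL) // -(tau_xi vM hL) // => tq.
  by apply: q0; apply: (trace_faithful ft) => //; exact: projection_pos.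
Qed.

(** For s commuting with M and k, and x in N, the vector s x^* k u = x^* k s u lies in L^2(N), so it
    is orthogonal to (1 - e_N) w. Hence k x kills e_N s^* (1 - e_N) w, and this vector is 0 by
    [corner_kernel]. With s = t and s = t^* both off-diagonal corners of t vanish. *)
Lemma corner_commutant A t : star_subalgebra A -> commutant A t ->
  (forall x, M x -> forall u, t (lam x u) = lam x (t u)) ->
  A (lam q \o eN) -> forall v, eN (t v) = t (eN v).
Proof.
move=> sA ct tl Ay; have bq := lamB Mq.
have Ak : A k.
  have -> : k = adjoint (lam q \o eN) \o (lam q \o eN).
    rewrite adj_comp // (proj_adj jones_proj) lamA //.
    have [_ qq aq] := hq; rewrite aq.
    apply: funext => v; rewrite /k /= -[lam q (lam q _)]/((lam q \o lam q) (eN v)).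
    by rewrite -(lam_comp vM ft hL) // qq.
  by apply: star_comp => //; exact: star_adj.
have half s : commutant A s -> (forall x, M x -> forall u, s (lam x u) = lam x (s u)) ->
    forall w, eN (adjoint s (w - eN w)) = 0.
  move=> [bs cs] sl w; apply: corner_kernel => [|x Nx]; first exact: EE.
  have Mx := NM Nx; have Mx' := star_adj sM Mx.
  apply: hdot_inj => u; rewrite hdot0l /k /= sE.
  rewrite -[lam q (eN _)]/((lam q \o eN) _).
  have aq : adjoint (lam q) = lam q by rewrite lamA //; have [_ _ ->] := hq.
  rewrite /= -{1}aq adjPl // sE.
  rewrite -{1}(adjK (lamB Mx)) adjPl; last exact: bounded_adj (lamB Mx).
  rewrite lamA // sE adjPl // jones_proj_lam; last exact: star_adj.
  rewrite EE sl // -[eN (lam q (eN u))]/(k u) -cs //.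
  rewrite /k /= -jones_proj_lam; last exact: star_adj.
  by rewrite -sE (linB lE) EE subrr hdot0l.
have ct' := commutant_adj sA ct.
have tl' x : M x -> forall u, adjoint t (lam x u) = lam x (adjoint t u).
  move=> Mx u; apply: hdot_inj => w; have Mx' := star_adj sM Mx.
  have [bt _] := ct.
  rewrite adjPl // adjP; last exact: lamB.
  rewrite lamA // -tl // -adjPl // -lamA // -adjP //; exact: lamB.
have h1 w : eN (adjoint t w) = eN (adjoint t (eN w)).
  apply/eqP; rewrite -subr_eq0 -(linB lE) -linB; first by rewrite half.
  exact: bounded_lin (bounded_adj ct.1).
have h2 w : eN (t w) = eN (t (eN w)).
  have := half _ ct' tl' w; rewrite adjK; last exact: ct.1.
  move=> h; apply/eqP; rewrite -subr_eq0 -(linB lE) -linB; first by rewrite h.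
  exact: bounded_lin ct.1.
move=> v; rewrite h2; apply: hdot_inj => w.
have [bt _] := ct.
by rewrite sE adjP // sE -h1 -sE -adjP.
Qed.
End Corner.

(** An operator in the commutant of [Wstar B] commutes with M by [generated_commutant] and with e_N
    by [corner_commutant]; the double commutant theorem then puts M and e_N into [Wstar B]. *)
Theorem basic_construction_generated (X : set (K -> K)) q (B : set (L -> L)) :
  X `<=` M -> Wstar X = M -> M q -> projection q -> q <> 0 ->
  B = lam @` X `|` [set lam q \o eN] ->
  star_subalgebra (basic_construction M eta eN) -> B `<=` basic_construction M eta eN /\
  Wstar B = basic_construction M eta eN.
Proof.
move=> XM XW Mq hq q0 BE sQ.
have Qlam x : M x -> basic_construction M eta eN (lam x).
  move=> Mx; apply: Wstar_sub; left; apply/(left_multP vM ft hL); by exists x.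
have QE : basic_construction M eta eN eN by apply: Wstar_sub; right.
have BQ : B `<=` basic_construction M eta eN.
  rewrite BE => _ [[x Xx <-]|->]; first by apply: Qlam; exact: XM.
  by apply: (star_comp sQ) => //; exact: Qlam.
split=> //; apply/seteqP; split.
  by apply: Wstar_min => //; exact: Wstar_closed.
have sB : star_subalgebra (Wstar B).
  by apply: Wstar_star => T /BQ; exact: star_bounded.
have WX x : X x -> Wstar B (lam x).
  by move=> Xx; apply: Wstar_sub; rewrite BE; left; exists x.
have WX' x : X x -> Wstar B (lam (adjoint x)).
  by move=> Xx; rewrite -lamA; [apply: (star_adj sB); exact: WX|exact: XM].
(* The identity is not known to lie in [Wstar B]. The projection f onto the common null space
   satisfies f s = 0 for all s in [Wstar B], in particular for the images of X and their adjoints,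
   so f = 0. *)
have nd : nondegenerate (Wstar B).
  move=> v hv.
  pose H := [set v : L | forall s, Wstar B s -> s v = 0].
  have lin s : Wstar B s -> linear s by move=> Ws; exact: (star_linear sB Ws).
  have sH : subspace H.
    split; first by move=> s Ws; rewrite (lin0 (lin s Ws)).
    by move=> c u w Hu Hw s Ws; rewrite lin // Hu // Hw // scaler0 addr0.
  have [f fH] := proj_exists sH; have bf := proj_bounded fH.
  have sf s u : Wstar B s -> s (f u) = 0.
    move=> Ws; have cu := proj_mem fH; apply: (ker_closure (star_bounded sB Ws) _ (cu u)).
    by move=> h; apply.
  have fs s u : Wstar B s -> f (s u) = 0.
    move=> Ws; apply: hdot_inj => w; rewrite (proj_sym fH) hdot0l.
    rewrite adjP; last exact: (star_bounded sB Ws).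
    by rewrite sf ?hdot0r //; exact: (star_adj sB).
  have f0 : f = 0.
    apply: (generated_nondegenerate fM ft tau1 hL XM XW bf) => x Xx u; apply: fs.
      exact: WX.
    exact: WX'.
  have <- : f v = v by apply: (proj_fix sH fH); apply: subset_closure.
  by rewrite f0.
have cB : wot_closed (Wstar B) := @Wstar_closed _ _ B.
have tlam t : commutant (Wstar B) t -> forall x, M x -> forall u, t (lam x u) = lam x (t u).
  move=> [bt ct]; apply: (generated_commutant fM ft tau1 hL XM XW bt) => x Xx u.
    by rewrite ct //; exact: WX.
  by rewrite ct //; exact: WX'.
apply: Wstar_min => // T [/(left_multP vM ft hL)[x Mx ->]|->].
  apply: double_commutant => //; first exact: lamB.
  by move=> t ct v; rewrite (tlam t ct).
apply: double_commutant => // t ct v.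
apply: (corner_commutant Mq hq q0 sB ct (tlam t ct)).
by apply: Wstar_sub; rewrite BE; right.
Qed.

End BasicConstructionGenerators.

(** * The normalised trace of the basic construction *)

Section JonesTrace.
Context {R : realType} {K L : hilbertType R}.
Variables (M : set (K -> K)) (tau : (K -> K) -> R[i]) (eta : (K -> K) -> L) (eN : L -> L)
  (Tr : (L -> L) -> R[i]).
Hypotheses (fM : is_factor M) (ft : finite_trace M tau) (tau1 : tau idfun = 1)
  (hL : is_L2 M tau eta) (fI : finite_index M eta eN) (jT : jones_trace M eta eN Tr).
Let vM : von_neumann_algebra M := fM.1.
Let sM := vna_star vM.
Local Notation lam := (lam M eta).
Local Notation Q := (basic_construction M eta eN).

Lemma basic_construction_vna : von_neumann_algebra Q.
Proof. by case: fI => -[]. Qed.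
Let vQ := basic_construction_vna.
Let sQ := vna_star vQ.

Lemma basic_construction_lam x : M x -> Q (lam x).
Proof.
by move=> Mx; apply: Wstar_sub; left; apply/(left_multP vM ft hL); exists x.
Qed.

(** If Tr 1 = 0, faithfulness gives 1 = 0 on L, so e_N = 0, against Tr e_N = 1. *)
Lemma jones_index_gt0 : exists2 r : R, 0 < r & jones_index Tr = r%:C%C.
Proof.
have [fQ E1] := jT.
have Q1 := vna_unital vQ.
have := trace_ge0 fQ Q1 (@pos_id _ L); rewrite lecE => /andP[/eqP im re].
exists (Re (Tr idfun)); last by apply/eqP; rewrite eq_complex /= im !eqxx.
rewrite lt_neqAle re andbT eq_sym; apply/eqP => r0.
have z : (idfun : L -> L) = 0.
  apply: (trace_faithful fQ) => //; first exact: pos_id.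
  by apply/eqP; rewrite eq_complex r0 im !eqxx.
have E0 : eN = 0 by apply: funext => v; rewrite -[eN v]/(idfun (eN v)) z.
have := E1; rewrite E0.
have -> : Tr 0 = 0.
  have := trace_linear fQ (-1) (star0 sQ) (star0 sQ).
  by rewrite scaler0 addr0 mulN1r addNr.
by move=> /eqP; rewrite eq_sym oner_eq0.
Qed.

(** Pulled back along [lam], the normalised trace is a trace on M with value 1 at the identity,
    normal by [lam_limit], so [trace_unique] applies. *)
Lemma normalised_trace_lam x : posA M x ->
  Re (normalised_trace Tr (lam x)) = Re (tau x).
Proof.
move=> px; have [fQ _] := jT; have [r r0 rE] := jones_index_gt0.
have nE T : Re (normalised_trace Tr T) = r^-1 * Re (Tr T).
  by rewrite /normalised_trace rE -fmorphV ReZ.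
have ri0 : 0 < r^-1 by rewrite invr_gt0.
have nQ := normal_functional_scale ri0 (trace_functional vQ fQ).
have nT := trace_functional vM ft.
pose F y := r^-1 * Re (Tr (lam y)).
have lamD y z : M y -> M z -> lam (y + z) = lam y + lam z.
  by move=> My Mz; have := lam_lincomb vM ft hL 1 My Mz; rewrite !scale1r.
have lamZ a y : M y -> lam (a *: y) = a *: lam y.
  move=> My; have := lam_lincomb vM ft hL a My (star0 sM); rewrite addr0 => ->.
  by rewrite (lam0 vM ft hL) addr0.
have posQ y : posA M y -> posA Q (lam y).
  by move=> py; split; [exact: basic_construction_lam py.1|exact: (lam_pos vM ft hL)].
have nF : normal_functional M F.
  split.
  - move=> y z My Mz; rewrite /F lamD //.
    by apply: (nf_add nQ); exact: basic_construction_lam.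
  - move=> s y My; rewrite /F lamZ //.
    by apply: (nf_scale nQ); exact: basic_construction_lam.
  - by move=> y py; apply: (nf_ge0 nQ); exact: posQ.
  - move=> D y D0 DM dirD py ub lim e e0.
    pose D' := [set lam d | d in D].
    have D0' : D' !=set0 by have [d Dd] := D0; exists (lam d), d.
    have DQ : D' `<=` posA Q by move=> _ [d Dd <-]; apply: posQ; exact: DM.
    have dirD' : rdirected D'.
      move=> _ _ [a Da <-] [b Db <-]; have [z Dz [az bz]] := dirD a b Da Db.
      exists (lam z); first by exists z.
      by split; apply: (lam_rle vM ft hL) => //; exact: DM.
    have ub' d : D' d -> rle d (lam y).
      by move=> [a Da <-]; apply: (lam_rle vM ft hL) => //; [exact: DM|exact: ub].
    have lim' : sot_limit D' (lam y).
      apply: (form_sot_limit vQ DQ (posQ y py) ub') => v s s0.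
      have [d Dd hd] := lam_limit vM ft hL D0 DM dirD py ub lim v s0.
      by exists (lam d) => //; exists d.
    have [_ [d Dd <-] hd] := nf_sup nQ D0' DQ dirD' (posQ y py) ub' lim' e0.
    by exists d.
have tF : tracial M F.
  move=> y z My Mz; rewrite /F (lam_comp vM ft hL My Mz) (lam_comp vM ft hL Mz My).
  by rewrite (trace_comm fQ (basic_construction_lam My) (basic_construction_lam Mz)).
have tT : tracial M (fun y => Re (tau y)).
  by move=> y z My Mz; rewrite (trace_comm ft My Mz).
have T1 : 0 < Re (tau idfun) by rewrite tau1.
have F1 : F idfun = 1 * Re (tau idfun).
  rewrite /F (lam_id vM ft hL) tau1 mul1r -[Tr idfun]/(jones_index Tr) rE /= mulVf //.
  by rewrite gt_eqF.
by rewrite nE -/(F x) (trace_unique vM fM nF nT tF tT T1 ler01 F1 px) mul1r.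
Qed.
End JonesTrace.

(** * Splitting a projection of a partition *)

Section Partitions.
Context {R : realType} {V : hilbertType R}.
Variables (A : set (V -> V)) (fA : is_factor A) (tau : (V -> V) -> R[i])
  (ft : finite_trace A tau).
Let vA : von_neumann_algebra A := fA.1.
Let sA := vna_star vA.
Implicit Types (P X : {fset (V -> V)}) (p q r x y : V -> V).

Lemma partition_ge0 P p : projection_partition A P -> p \in P -> 0 <= Re (tau p).
Proof.
move=> [hP _ _] /hP[Ap hp]; apply: (nf_ge0 (trace_functional vA ft)).
by split=> //; exact: projection_pos.
Qed.

Lemma partition_sum P : projection_partition A P ->
  \sum_(p <- P) Re (tau p) = Re (tau idfun).
Proof.
move=> [hP _ sP]; rewrite -sP.
have nF := trace_functional vA ft.
suff h (s : seq (V -> V)) : {subset s <= P} -> A (\sum_(p <- s) p) /\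
    Re (tau (\sum_(p <- s) p)) = \sum_(p <- s) Re (tau p) by have [] := h P (fun x => id).
elim: s => [_|p s ih sub].
  by rewrite !big_nil; split; [exact: star0|exact: (nf0 vA nF)].
have [|As hs] := ih; first by move=> x xs; apply: sub; rewrite inE xs orbT.
have [Ap _] := hP p (sub p (mem_head _ _)).
by rewrite !big_cons -hs; split; [exact: star_add|exact: (nf_add nF)].
Qed.

Lemma partition_neq0 P : projection_partition A P -> tau idfun = 1 ->
  exists2 p, p \in P & p <> 0.
Proof.
move=> [_ _ sP] tau1; apply: contrapT => no.
have z : (idfun : V -> V) = 0.
  rewrite -sP big_seq big1 // => p pP; apply: contrapT => p0; apply: no; by exists p.
have nF := trace_functional vA ft.
by have := nf0 vA nF; rewrite -z tau1 /= => /eqP; rewrite oner_eq0.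
Qed.

Section Split.
Variables (P : {fset (V -> V)}) (p r : V -> V).
Hypotheses (hP : projection_partition A P) (pP : p \in P) (Ar : A r)
  (hr : projection r) (pr : p \o r = r) (r0 : r <> 0) (rp : r <> p).

Definition split_partition := (r |` ((p - r)%R |` (P `\ p)))%fset.

Let hp : projection p. Proof. by have [h _ _] := hP; have [] := h p pP. Qed.
Let Ap : A p. Proof. by have [h _ _] := hP; have [] := h p pP. Qed.
Let s := p - r.
Let As : A s. Proof. exact: star_sub. Qed.
Let hs : projection s. Proof. exact: projection_sub. Qed.
Let s0 : s <> 0. Proof. by move=> /eqP; rewrite subr_eq0 => /eqP /esym. Qed.
Let lp : linear p. Proof. exact: (star_linear sA Ap). Qed.
Let lr : linear r. Proof. exact: (star_linear sA Ar). Qed.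

Let rpr : r \o p = r.
Proof.
have [bp _ ap] := hp; have [br _ ar] := hr.
by rewrite -{1}ar -{1}ap -adj_comp // pr ar.
Qed.

Let prE v : p (r v) = r v. Proof. by rewrite -[LHS]/((p \o r) v) pr. Qed.
Let rpE v : r (p v) = r v. Proof. by rewrite -[LHS]/((r \o p) v) rpr. Qed.
Let ppE v : p (p v) = p v. Proof. exact: projection_comp. Qed.
Let rrE v : r (r v) = r v. Proof. exact: projection_comp. Qed.
Let psE v : p (s v) = s v. Proof. by rewrite /s sub_app (linB lp) ppE prE. Qed.
Let spE v : s (p v) = s v. Proof. by rewrite /s !sub_app ppE rpE. Qed.
Let rsE v : r (s v) = 0. Proof. by rewrite /s sub_app (linB lr) rpE rrE subrr. Qed.
Let srE v : s (r v) = 0. Proof. by rewrite /s sub_app prE rrE subrr. Qed.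

Let orth x q : x \in P -> x != p -> q = p \o q -> x \o q = 0.
Proof.
move=> xP xp ->; have [_ o _] := hP; apply: funext => v.
by have /(congr1 (fun f => f (q v))) := o x p xP pP xp.
Qed.
Let orth' x q : x \in P -> x != p -> q = q \o p -> A q -> q \o x = 0.
Proof.
move=> xP xp qp Aq; have [_ o _] := hP; apply: funext => v.
have /(congr1 (fun f => f v)) := o p x pP xP ltac:(by rewrite eq_sym).
by rewrite qp /= => ->; rewrite lin0 //; exact: (star_linear sA Aq).
Qed.

Let notin q : q = p \o q -> q = q \o p -> projection q -> q <> 0 -> q \notin (P `\ p)%fset.
Proof.
move=> q1 q2 hq q0; apply/negP; rewrite in_fsetD1 => /andP[qp qP].
apply: q0; have [_ <- _] := hq; exact: orth.
Qed.

(** Finite sets drop repetitions, so r, p - r and the remaining projections must be distinct; they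
    are, the first two being nonzero and orthogonal to each other and to the rest. *)
Lemma split_sum (T : nmodType) (F : (V -> V) -> T) :
  \sum_(a <- split_partition) F a = F r + (F s + \sum_(a <- (P `\ p)%fset) F a).
Proof.
have h1 : r \notin (P `\ p)%fset by apply: notin => //; apply: funext => v /=; rewrite ?prE ?rpE.
have h2 : s \notin (P `\ p)%fset by apply: notin => //; apply: funext => v /=; rewrite ?psE ?spE.
rewrite /split_partition !big_fsetU1 // in_fset1U (negbTE h1) orbF.
apply/eqP => rs; apply: r0; apply: funext => v.
by rewrite -rrE {2}rs rsE.
Qed.

Lemma split_partitionP : projection_partition A split_partition.
Proof.
have [hP1 hP2 hP3] := hP; split.
- move=> a; rewrite !in_fset1U => /or3P[/eqP ->|/eqP ->|] //.
  by rewrite in_fsetD1 => /andP[_ /hP1].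
- have rP x : x \in (P `\ p)%fset -> x \o r = 0 /\ r \o x = 0.
    rewrite in_fsetD1 => /andP[xp xP]; split; first exact: orth.
    exact: orth'.
  have sP x : x \in (P `\ p)%fset -> x \o s = 0 /\ s \o x = 0.
    rewrite in_fsetD1 => /andP[xp xP]; split.
      by apply: orth => //; apply: funext => v /=; rewrite psE.
    by apply: orth' => //; apply: funext => v /=; rewrite spE.
  move=> a b; rewrite !in_fset1U => /or3P[/eqP ->|/eqP ->|aP] /or3P[/eqP ->|/eqP ->|bP] ab.
  + by rewrite eqxx in ab.
  + by apply: funext => v; exact: rsE.
  + by have [] := rP b bP.
  + by apply: funext => v; exact: srE.
  + by rewrite eqxx in ab.
  + by have [] := sP b bP.
  + by have [] := rP a aP.
  + by have [] := sP a aP.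
  + move: aP bP; rewrite !in_fsetD1 => /andP[_ aP] /andP[_ bP]; exact: hP2.
- have rs : r + s = p by rewrite /s addrC subrK.
  by rewrite (split_sum id) addrA rs -hP3 [RHS](big_fsetD1 p).
Qed.

(** If p x b = 0 then r x b = 0 and (p - r) x b = 0, and likewise on the right. So nonzero blocks
    arise only inside old nonzero blocks, while tau p = tau r + tau (p - r). *)
Lemma split_inv_elt x : A x -> inv_elt tau x split_partition <= inv_elt tau x P.
Proof.
move=> Ax; have lx : linear x := star_linear sA Ax.
have nF := trace_functional vA ft.
have pge a : a \in P -> 0 <= Re (tau a) by exact: partition_ge0.
have rge : 0 <= Re (tau r) by apply: (nf_ge0 nF); split=> //; exact: projection_pos.
have sge : 0 <= Re (tau s) by apply: (nf_ge0 nF); split=> //; exact: projection_pos.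
have tp : Re (tau p) = Re (tau r) + Re (tau s).
  by rewrite /s (nf_sub vA nF) // addrC subrK.
pose g (a b : V -> V) : R := if a \o x \o b != 0 then 1 else 0.
have gE (t : (V -> V) -> R) (Z : {fset (V -> V)}) (a : V -> V) :
    \sum_(b <- Z | a \o x \o b != 0) Re (tau a) * t b = Re (tau a) * \sum_(b <- Z) g a b * t b.
  rewrite mulr_sumr big_mkcond; apply: eq_bigr => b _; rewrite /g.
  by case: ifP => _; rewrite ?mul1r ?mul0r ?mulr0.
have g0 (a b : V -> V) : 0 <= g a b by rewrite /g; case: ifP.
have gle (a b a' b' : V -> V) : (a' \o x \o b' = 0 -> a \o x \o b = 0) -> g a b <= g a' b'.
  rewrite /g; move=> h; case: ifP => [ab|_]; last by case: ifP.
  by case: ifP => // /negbFE/eqP/h e; rewrite e eqxx in ab.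
pose t (a : V -> V) := Re (tau a).
pose G (a : V -> V) := \sum_(b <- P) g a b * t b.
have bl a : A a -> linear a by exact: (@star_linear _ _ _ sA).
have inner a : A a -> \sum_(b <- split_partition) g a b * t b <= G a.
  move=> Aa; have la := bl a Aa.
  rewrite split_sum /G [leRHS](big_fsetD1 p) //= addrA lerD2r /t tp mulrDr.
  apply: lerD; apply: ler_wpM2r => //; apply: gle => e; apply: funext => v.
    by have /(congr1 (fun f => f (r v))) := e; rewrite /= prE.
  by have /(congr1 (fun f => f (s v))) := e; rewrite /= psE.
have outer : G r <= G p /\ G s <= G p.
  have bP b : b \in P -> A b by have [h _ _] := hP; move=> /h[].
  split; rewrite /G big_seq [leRHS]big_seq; apply: ler_sum => b bPP; apply: ler_wpM2r; try exact: pge.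
    apply: gle => e; apply: funext => v.
    have /(congr1 (fun f => r (f v))) := e; rewrite /= rpE => ->; exact: lin0.
  apply: gle => e; apply: funext => v.
  have /(congr1 (fun f => s (f v))) := e; rewrite /= spE => ->; exact: lin0 (bl s As).
have G0 a : 0 <= G a.
  by rewrite /G big_seq; apply: sumr_ge0 => b bP; rewrite mulr_ge0 //; exact: pge.
rewrite /inv_elt.
have -> : \sum_(a <- split_partition) \sum_(b <- split_partition | a \o x \o b != 0)
    Re (tau a) * Re (tau b) =
    \sum_(a <- split_partition) t a * \sum_(b <- split_partition) g a b * t b.
  by apply: eq_bigr => a _; exact: gE.
have -> : \sum_(a <- P) \sum_(b <- P | a \o x \o b != 0) Re (tau a) * Re (tau b) =
    \sum_(a <- P) t a * G a by apply: eq_bigr => a _; exact: gE.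
apply: le_trans (_ : \sum_(a <- split_partition) t a * G a <= _).
  have hP' := split_partitionP; rewrite big_seq [leRHS]big_seq; apply: ler_sum => a aP.
  apply: ler_wpM2l; first exact: (partition_ge0 hP').
  by apply: inner; have [h _ _] := hP'; have [] := h a aP.
rewrite split_sum [leRHS](big_fsetD1 p) //= addrA lerD2r.
have [Gr Gs] := outer; rewrite [t p]tp mulrDl.
by apply: lerD; apply: ler_wpM2l.
Qed.

End Split.
End Partitions.

(** An inequality, since a may already belong to X. *)
Lemma sumr_fset1U_le (R : realDomainType) (T : choiceType) (F : T -> R) a (X : {fset T}) :
  (forall x, 0 <= F x) ->
  \sum_(x <- (a |` X)%fset) F x <= F a + \sum_(x <- X) F x.
Proof.
move=> F0; have [aX|aX] := boolP (a \in X); last by rewrite big_fsetU1.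
by rewrite (fsetUidPr _ _ _) ?lerDr // fsub1set.
Qed.

(** * Transport of partitions to the basic construction *)

Section Transport.
Context {R : realType} {K L : hilbertType R}.
Variables (M : set (K -> K)) (tau : (K -> K) -> R[i]) (eta : (K -> K) -> L) (eN : L -> L)
  (Tr : (L -> L) -> R[i]).
Hypotheses (fM : is_factor M) (ft : finite_trace M tau) (tau1 : tau idfun = 1)
  (hL : is_L2 M tau eta) (fI : finite_index M eta eN) (jT : jones_trace M eta eN Tr).
Let vM : von_neumann_algebra M := fM.1.
Let sM := vna_star vM.
Local Notation lam := (lam M eta).
Local Notation Q := (basic_construction M eta eN).
Local Notation tau' := (normalised_trace Tr).
Implicit Types (P X : {fset (K -> K)}) (p x y : K -> K).

Let lam_mul x y : M x -> M y -> lam x \o lam y = lam (x \o y).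
Proof. by move=> Mx My; rewrite (lam_comp vM ft hL Mx My). Qed.

Let lam0 : lam 0 = 0. Proof. exact: (lam0 vM ft hL). Qed.

Lemma lam_projection p : M p -> projection p -> projection (lam p).
Proof.
move=> Mp [_ pp ap]; split; first exact: (lam_bounded vM ft hL).
  by rewrite lam_mul // pp.
by rewrite (lam_adj vM ft hL Mp) ap.
Qed.

Section Partition.
Variables (P : {fset (K -> K)}) (hP : projection_partition M P).
Definition lam_partition := [fset lam p | p in P]%fset.

Let MP p : p \in P -> M p. Proof. by move=> pP; have [h _ _] := hP; have [] := h p pP. Qed.

Let injP : {in P &, injective lam}.
Proof. by move=> a b aP bP; apply: (lam_inj2 vM ft hL); exact: MP. Qed.

Lemma lam_partitionP : projection_partition Q lam_partition.
Proof.
have [h1 h2 h3] := hP; split.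
- move=> _ /imfsetP[p pP ->]; have [Mp hp] := h1 p pP.
  by split; [exact: (basic_construction_lam fM ft hL Mp)|exact: lam_projection].
- move=> _ _ /imfsetP[p pP ->] /imfsetP[q qP ->] pq.
  rewrite lam_mul; [|exact: MP|exact: MP].
  by rewrite h2 // ?lam0 //; apply: contraNneq pq => ->.
- rewrite /lam_partition big_imfset //= -(lam_id vM ft hL) -h3.
  suff h (s : seq (K -> K)) : {subset s <= P} -> M (\sum_(p <- s) p) /\
      lam (\sum_(p <- s) p) = \sum_(p <- s) lam p by have [] := h P (fun x => id).
  elim: s => [_|p s ih sub]; first by rewrite !big_nil lam0; split=> //; exact: star0.
  have [|Ms hs] := ih; first by move=> x xs; apply: sub; rewrite inE xs orbT.
  have Mp := MP (sub p (mem_head _ _)).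
  rewrite !big_cons -hs; split; first exact: star_add.
  by have := lam_lincomb vM ft hL 1 Mp Ms; rewrite !scale1r.
Qed.

Let tauP p : p \in P -> Re (tau' (lam p)) = Re (tau p).
Proof.
move=> pP; have [h _ _] := hP; have [Mp hp] := h p pP.
apply: (normalised_trace_lam fM ft tau1 hL fI jT).
by split=> //; exact: projection_pos.
Qed.

Lemma inv_elt_lam x : M x -> inv_elt tau' (lam x) lam_partition = inv_elt tau x P.
Proof.
move=> Mx; rewrite /inv_elt /lam_partition big_imfset //= big_seq [RHS]big_seq.
apply: eq_bigr => p pP; have Mp := MP pP.
rewrite big_mkcond big_imfset //= [RHS]big_mkcond big_seq [RHS]big_seq.
apply: eq_bigr => q qP; have Mq := MP qP; have Mpx := star_comp sM Mp Mx.
have Mpxq := star_comp sM Mpx Mq.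
rewrite !tauP // lam_mul // lam_mul //.
suff -> : (lam (p \o x \o q) == 0) = (p \o x \o q == 0) by [].
by apply/eqP/eqP => [/(lam_inj vM ft hL Mpxq)|->].
Qed.

(** Distinct members of the partition being orthogonal, only the row of r contributes, and it costs
    at most tau r times the sum of all tau q, which is 1. *)
Lemma inv_elt_corner r (T : L -> L) : r \in P ->
  inv_elt tau' (lam r \o T) lam_partition <= Re (tau r).
Proof.
move=> rP; have Mr := MP rP.
have t0 p : p \in P -> 0 <= Re (tau p) by exact: (partition_ge0 fM ft hP).
rewrite /inv_elt /lam_partition big_imfset //= (big_fsetD1 r) //=.
rewrite (_ : \sum_(p <- (P `\ r)%fset) _ = 0) ?addr0; last first.
  rewrite big_seq; apply: big1 => p pD; have : p \in (P `\ r)%fset by [].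
  rewrite in_fsetD1 => /andP[pr pP]; rewrite big1 // => q.
  have -> : lam p \o (lam r \o T) = 0.
    rewrite -[LHS]/((lam p \o lam r) \o T) lam_mul //; last exact: MP.
    by have [_ o _] := hP; rewrite o // lam0.
  by rewrite -[0 \o q]/(0 : L -> L) eqxx.
rewrite big_mkcond big_imfset //=.
apply: le_trans (_ : \sum_(q <- P) Re (tau r) * Re (tau q) <= _).
  rewrite big_seq [leRHS]big_seq; apply: ler_sum => q qP.
  by rewrite !tauP //; case: ifP => // _; rewrite mulr_ge0 // t0.
by rewrite -mulr_sumr (partition_sum fM ft hP) tau1 /= mulr1.
Qed.

Lemma inv_elt_lam_ge0 T : 0 <= inv_elt tau' T lam_partition.
Proof.
rewrite /inv_elt big_seq; apply: sumr_ge0 => _ /imfsetP[p pP ->].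
rewrite big_seq_cond; apply: sumr_ge0 => _ /andP[/imfsetP[q qP ->] _].
by rewrite !tauP // mulr_ge0 //; exact: (partition_ge0 fM ft hP).
Qed.

End Partition.
End Transport.

Theorem lemma6p1 (R : realType) (K L : hilbertType R)
    (N M : set (K -> K)) (tau : (K -> K) -> R[i])
    (eta : (K -> K) -> L) (eN : L -> L) (Tr : (L -> L) -> R[i]) :
  II1_factor N -> II1_factor M -> N `<=` M ->
  tracial_state M tau ->
  is_L2 M tau eta ->
  L2_projection N eta eN ->
  finite_index M eta eN ->
  jones_trace M eta eN Tr ->
  (generator_invariant (basic_construction M eta eN)
     (normalised_trace Tr)
   <= generator_invariant M tau)%E.
Proof.
move=> [fN _ _] [fM infM _] NM [ft tau1] hL pN fI jT.
have vM : von_neumann_algebra M := fM.1.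
(* If no finite set generates M, the right-hand side is +oo and there is nothing to prove. *)
apply: le_ereal_inf_tmp => _ [X [XM XW] <-].
apply: le_ereal_inf_tmp => _ [P hP <-].
apply/lee_addgt0Pr => e e0; rewrite -EFinD.
have [p pP p0] := partition_neq0 fM ft hP tau1.
have [Mp hp] : M p /\ projection p by have [h _ _] := hP; exact: h.
have tp := projection_trace_gt0 ft Mp hp p0.
(* Besides tau r < e, the bound tau r < tau p forces r <> p, so that p - r is nonzero. *)
have m0 : 0 < Num.min e (Re (tau p)) by rewrite lt_min e0.
have [r [Mr hr pr r0]] := small_projection fM ft infM Mp hp p0 m0.
rewrite lt_min => /andP[re rp].
have {rp} rp : r <> p by move=> rpE; rewrite rpE ltxx in rp.
pose P' := split_partition P p r.
have hP' : projection_partition M P' := split_partitionP fM hP pP Mr hr pr r0 rp.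
have rP' : r \in P' by rewrite in_fset1U eqxx.
(* [y] has its range in that of [lam r], so it costs at most [tau r < e]. *)
pose y := lam M eta r \o eN.
pose X' := (y |` [fset lam M eta x | x in X])%fset.
have vQ := basic_construction_vna fI.
have [] := basic_construction_generated fN fM NM ft tau1 hL pN (q := r) XM XW Mr hr r0
  erefl (vna_star vQ).
set B := (_ `|` _) => BQ BW.
have BE : [set` X'] = B.
  apply/seteqP; split=> T.
    rewrite /= in_fset1U => /predU1P[->|/imfsetP[x xX ->]]; [by right|by left; exists x].
  case=> [[x xX <-]|->]; rewrite /= in_fset1U ?eqxx // in_imfset ?orbT //.
apply: le_trans (_ : inv_inf (basic_construction M eta eN) (normalised_trace Tr) X' <= _)%E.
  by apply: ereal_inf_lbound; exists X' => //=; rewrite BE.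
apply: le_trans (_ : (inv_fam (normalised_trace Tr) X' (lam_partition M eta P'))%:E <= _)%E.
  apply: ereal_inf_lbound; exists (lam_partition M eta P') => //.
  exact: (lam_partitionP eN fM ft hL hP').
rewrite lee_fin /inv_fam.
apply: le_trans (sumr_fset1U_le _ _ _) _.
  by move=> T; exact: (inv_elt_lam_ge0 fM ft tau1 hL fI jT hP').
rewrite addrC; apply: lerD; last first.
  apply: le_trans (ltW re).
  exact: (inv_elt_corner fM ft tau1 hL fI jT hP').
rewrite big_imfset /=; last first.
  by move=> a b aX bX; apply: (lam_inj2 vM ft hL); exact: XM.
rewrite big_seq [leRHS]big_seq; apply: ler_sum => x xX.
rewrite (inv_elt_lam fM ft tau1 hL fI jT hP') //; last exact: XM.
by apply: (split_inv_elt fM ft hP pP Mr hr pr r0 rp); exact: XM.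
Qed.
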